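(* If $(\tilde q_n)_{n\in\mathbb{N}}$ is a sequence of natural numbers satisfying $\tilde q_1\geq 108\pi$ and $\tilde q_{n+1}\geq \tilde q_n^{\,\tilde q_n}$ for all $n\in\mathbb{N}$, then there exists a weak mixing $C^\infty$-diffeomorphism of $\mathbb{T}^2$ that is uniformly rigid with respect to $(\tilde q_n)_{n\in\mathbb{N}}$.
   Context: Natural numbers are positive integers. $\mathbb{T}^2=\mathbb{R}^2/\mathbb{Z}^2$ with Lebesgue (Haar) probability measure $\mu$ and its standard metric $d$. Diffeomorphisms called weak mixing or uniformly rigid are measure-preserving for $\mu$. Weak mixing: $T$ preserves $\mu$ and for all measurable $A,B$, $\frac1N\sum_{n=1}^N|\mu(T^nA\cap B)-\mu(A)\mu(B)|\to 0$ as $N\to\infty$. Uniformly rigid with respect to an increasing sequence $(n_m)_{m\in\mathbb{N}}$ of natural numbers: $d_u(T^{n_m},\mathrm{id})\to 0$ as $m\to\infty$, where $d_u(S,T)=\sup_x d(S(x),T(x))+\sup_x d(S^{-1}(x),T^{-1}(x))$. *)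

(* Defs.v *)
From HB Require Import structures.
From mathcomp Require Import all_boot all_order all_algebra generic_quotient.
From mathcomp Require Import all_classical all_reals all_analysis.

Set Implicit Arguments.
Unset Strict Implicit.
Unset Printing Implicit Defensive.

Import Order.TTheory GRing.Theory Num.Theory.
Import numFieldNormedType.Exports.

Local Open Scope classical_set_scope.
Local Open Scope quotient_scope.
Local Open Scope ring_scope.

Section Torus.
Variable R : realType.

Definition latticeEquiv (x y : R * R) : bool :=
  (x.1 - y.1 \is a Num.int) && (x.2 - y.2 \is a Num.int).

Lemma latticeEquiv_is_equiv : equiv_class_of latticeEquiv.
Proof.
split=> [x|x y|y x z]; rewrite /latticeEquiv.
- by rewrite !subrr !rpred0.
- by rewrite -[x.1 - _]opprB -[x.2 - _]opprB !rpredN.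
- move=> /andP[xy1 xy2] /andP[yz1 yz2].
  by rewrite -(subrKA y.1) rpredD //= -(subrKA y.2) rpredD.
Qed.

Canonical latticeEquiv_equiv := EquivRelPack latticeEquiv_is_equiv.

Definition torus : Type := {eq_quot latticeEquiv}.

HB.instance Definition _ := Choice.on torus.
HB.instance Definition _ := EqQuotient.on torus.
HB.instance Definition _ := isPointed.Build torus (\pi_torus (0, 0)).

Definition torusPi (x : R * R) : torus := \pi_torus x.

Lemma torusPiP x y : torusPi x = torusPi y <->
  exists k l : int, x = (y.1 + k%:~R, y.2 + l%:~R).
Proof.
split=> [/eqP|[k [l ->]]].
  rewrite /torusPi eqquotE /= => /andP[/intrP[k xk] /intrP[l xl]].
  by exists k, l; rewrite -xk -xl !subrKC -surjective_pairing.
apply/eqP; rewrite /torusPi eqquotE /= /latticeEquiv /=.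
by rewrite [y.1 + _]addrC [y.2 + _]addrC !addrK !rpred_int.
Qed.

(* The Borel sigma-algebra of the quotient: a set is measurable iff its
   preimage in the plane is. *)
Definition torusMeasurable : set (set torus) :=
  image_set_system setT torusPi measurable.

Lemma torusMeasurable0 : torusMeasurable set0.
Proof. by rewrite /torusMeasurable/image_set_system/= preimage_set0 setI0. Qed.

Lemma torusMeasurableC A : torusMeasurable A -> torusMeasurable (~` A).
Proof.
rewrite /torusMeasurable/image_set_system/= !setTI preimage_setC.
exact: measurableC.
Qed.

Lemma torusMeasurable_bigcup (F : (set torus)^nat) :
  (forall i, torusMeasurable (F i)) -> torusMeasurable (\bigcup_i F i).
Proof.
rewrite /torusMeasurable/image_set_system/= => mF.
rewrite setTI preimage_bigcup; apply: bigcup_measurable => i _.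
by have := mF i; rewrite setTI.
Qed.

HB.instance Definition _ := @isMeasurable.Build default_measure_display torus
  torusMeasurable torusMeasurable0 torusMeasurableC torusMeasurable_bigcup.

Lemma measurable_torusPi : measurable_fun setT torusPi.
Proof. by move=> _ A. Qed.

Definition unitSquare : set (R * R) := `[0, 1[%classic `*` `[0, 1[%classic.

Lemma measurable_unitSquare : measurable unitSquare.
Proof. by apply: measurableX; exact: measurable_itv. Qed.

Definition torusMeasure : set torus -> \bar R :=
  pushforward (mrestr (lebesgue_measure \x lebesgue_measure)%E
    measurable_unitSquare) torusPi.

Lemma torusMeasure0 : torusMeasure set0 = 0%E.
Proof. by rewrite /torusMeasure/pushforward preimage_set0 measure0. Qed.

Lemma torusMeasure_ge0 A : (0 <= torusMeasure A)%E.
Proof. exact: measure_ge0. Qed.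

Lemma torusMeasure_sigma_additive : semi_sigma_additive torusMeasure.
Proof.
move=> F mF tF mUF; rewrite /torusMeasure/pushforward preimage_bigcup.
apply: measure_semi_sigma_additive.
- by move=> n; rewrite -[X in measurable X]setTI; exact: mF.
- apply/trivIsetP => /= i j _ _ ij; rewrite -preimage_setI.
  by move/trivIsetP : tF => /(_ _ _ _ _ ij) ->//; rewrite preimage_set0.
- by rewrite -preimage_bigcup -[X in measurable X]setTI; exact: mUF.
Qed.

HB.instance Definition _ := isMeasure.Build _ _ _ torusMeasure
  torusMeasure0 torusMeasure_ge0 torusMeasure_sigma_additive.

Lemma torusMeasureT : torusMeasure setT = 1%E.
Proof.
rewrite /torusMeasure/pushforward/mrestr preimage_setT setTI.
by rewrite product_measure1E//= !lebesgue_measure_itv /= lte01 sube0 mule1.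
Qed.

HB.instance Definition _ := Measure_isProbability.Build _ _ _ torusMeasure
  torusMeasureT.

Definition planeNorm (x : R * R) : R := Num.sqrt (x.1 ^+ 2 + x.2 ^+ 2).

(* The flat metric: the Euclidean distance between the fibres over p and q. *)
Definition torusDist (p q : torus) : R :=
  inf [set r | exists x y : R * R,
    [/\ torusPi x = p, torusPi y = q & r = planeNorm (x - y)]].

Definition planeBasis (i : bool) : R * R := if i then (0, 1) else (1, 0).

Fixpoint iterPartial (s : seq bool) (F : R * R -> R * R) : R * R -> R * R :=
  if s is i :: s' then fun x => 'D_(planeBasis i) (iterPartial s' F) x else F.

Definition smoothOn (U : set (R * R)) (F : R * R -> R * R) : Prop :=
  forall (s : seq bool) (x : R * R), U x ->
    {for x, continuous (iterPartial s F)} /\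
    forall i, derivable (iterPartial s F) x (planeBasis i).

(* The local inverses of torusPi are the charts of the torus, so a smooth map
   is one that has a smooth lift near every point. *)
Definition torusSmooth (f : torus -> torus) : Prop :=
  forall x : R * R, exists (U : set (R * R)) (F : R * R -> R * R),
    [/\ open U, U x, smoothOn U F &
        forall y, U y -> torusPi (F y) = f (torusPi y)].

(* A split bijection f carries its inverse f^-1. *)
Definition torusBij := {splitbij [set: torus] >-> [set: torus]}.

Definition torusDiffeo (T : torusBij) : Prop :=
  torusSmooth T /\ torusSmooth (T^-1)%FUN.

Definition measurePreserving (T : torus -> torus) : Prop :=
  measurable_fun setT T /\
  forall A, measurable A -> torusMeasure (T @^-1` A) = torusMeasure A.

Definition weakMixing (T : torus -> torus) : Prop :=
  measurePreserving T /\
  forall A B : set torus, measurable A -> measurable B ->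
    (fun N : nat => N%:R^-1 * \sum_(1 <= n < N.+1)
       `| fine (torusMeasure (iter n T @` A `&` B))
          - fine (torusMeasure A) * fine (torusMeasure B) |)
      @ \oo --> (0 : R).

Definition uniformDist (S T : torusBij) : R :=
  sup [set torusDist (S x) (T x) | x in [set: torus]] +
  sup [set torusDist ((S^-1)%FUN x) ((T^-1)%FUN x) | x in [set: torus]].

Definition uniformlyRigid (T : torusBij) (n : nat -> nat) : Prop :=
  [/\ measurePreserving T,
      {homo n : i j / (i < j)%N} &
      uniformDist [splitbij of iter (n m) T] [splitbij of idfun]
        @[m --> \oo] --> (0 : R)].

End Torus.

(* Main.v *)
From HB Require Import structures.
Require Import Defs.
From mathcomp Require Import all_boot all_order all_algebra generic_quotient.
From mathcomp Require Import all_classical all_reals all_analysis.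
From mathcomp Require Import measurable_realfun ring lra zify.

Set Implicit Arguments.
Unset Strict Implicit.
Unset Printing Implicit Defensive.

Import Order.TTheory GRing.Theory Num.Theory.
Import numFieldNormedType.Exports.

Local Open Scope classical_set_scope.
Local Open Scope ring_scope.

(* The diffeomorphism is obtained by approximation by conjugation.  Growth of
   the sequence q_n gives a Liouville number alpha with
   0 < q_n alpha - p_n <= 2 q_n / q_(n+1).  Let R_t be the translation by (t, 0)
   and, for q = q_n, let h_q be the measure-preserving map
   x |-> x + (q, 1) q sin (2 pi q (x1 - q x2)).  Then

     h_q R_t h_q^-1 x = R_t x + (q, 1) 2 q sin (pi q t) cos (2 pi q (x1 - q x2) + pi q t).

   Put H_(k+1) = H_k h_q and T_k^t = H_k R_t H_k^-1.  If q is large, then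
   sin (pi q t) is smaller than any power of 1 / q for t = alpha and,
   uniformly in n, for t = q_n alpha; hence T_(k+1)^alpha is C^k-close to T_k^alpha
   and T_(k+1)^(q_n alpha) is uniformly close to T_k^(q_n alpha).  The limit T of the
   T_k^alpha is therefore smooth and rigid along q_n.  On the other hand some multiple
   m alpha has |sin (pi q m alpha)| >= 1/2, and the oscillation of amplitude at
   least q in the formula then decorrelates Lipschitz functions up to a small error.
   So T is mixing along a sequence of times m_k, which implies weak mixing. *)

(** * Derivatives in the plane *)

(** The map [h_q] moves points along [(q, 1)], the kernel of [u = x1 - q x2], by a function of [u]
    alone. Hence [u] is invariant, the inverse only changes the sign of the amplitude, and the
    conjugate of a translation sees nothing but the shift of [u] by [t]. The profile has period
    [1 / q] in [u], so [h_q] commutes with the translations by the grid of step [1 / q]; this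
    spreads a local oscillation over the whole torus. Order k derivatives of the correction cost
    [q^(2k+2)], and the constants coming from [H_k] admit no a priori bound. Both are harmless
    because they are fixed before q is chosen. Rigidity is wanted along the whole sequence, so each
    correction must be small at all times [q_n alpha] at once, whether n precedes or follows the
    index of the chosen q. Maps are handled through lifts to the plane, and integrals through
    averages of periodic Lipschitz functions. These are limits of Riemann sums with explicit error,
    so that shear invariance and Fubini become statements about finite sums; measurable sets enter
    only by approximation. *)

Lemma quad_diff {R : realType} (V W : normedModType R) (f : V -> W)
    (d : {linear V -> W}) (x : V) (C : R) : continuous d ->
  (forall v, `|f (x + v) - f x - d v| <= C * `|v| ^+ 2) ->
  differentiable f x /\ 'd f x = d :> (V -> W).
Proof.
move=> cd H.
have E : f \o shift x = cst (f x) + d +o_ 0 id.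
  apply/eqaddoP => _/posnumP[e]; near=> v.
  have := H v; rewrite (addrC x).
  rewrite [X in _ -> is_true (`|X| <= _)](_ : _ = f (v + x) - f x - d v); last first.
    by rewrite -[LHS]/(f (v + x) - (f x + d v)) opprD addrA.
  move=> /le_trans; apply; rewrite expr2 mulrA; apply: ler_wpM2r => //.
  have : `|v| <= e%:num / (`|C| + 1).
    near: v; apply/nbhs_norm0P; exists (e%:num / (`|C| + 1)) => /=.
      by rewrite divr_gt0// ltr_wpDl.
    by move=> y /= /ltW.
  rewrite ler_pdivlMr ?ltr_wpDl// => h.
  apply: le_trans h; rewrite mulrC.
  by apply: ler_wpM2l => //; rewrite (le_trans (ler_norm _))// lerDl.
have dd := diff_unique cd E.
by split=> //; apply/diff_locallyP; rewrite dd.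
Unshelve. all: by end_near. Qed.

Section PlaneCalculus.
Context {R : realType}.
Implicit Types (f g : R * R -> R) (x v : R * R) (i : bool).

Definition pd i f : R * R -> R := fun x => 'D_(planeBasis R i) f x.

Lemma planeE v : v = v.1 *: planeBasis R false + v.2 *: planeBasis R true.
Proof.
case: v => a b; rewrite /planeBasis; congr pair => /=.
  by rewrite /GRing.scale/= mulr1 mulr0 addr0.
by rewrite /GRing.scale/= mulr1 mulr0 add0r.
Qed.

Lemma diff_plane f x v : differentiable f x ->
  'd f x v = v.1 * pd false f x + v.2 * pd true f x.
Proof.
by move=> df; rewrite {1}(planeE v) linearD !linearZ /= /pd !deriveE.
Qed.

Lemma pdD i f g x : differentiable f x -> differentiable g x ->
  pd i (f \+ g) x = pd i f x + pd i g x.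
Proof. by move=> df dg; rewrite /pd deriveD//; exact: diff_derivable. Qed.

Lemma pdN i f x : differentiable f x -> pd i (\- f) x = - pd i f x.
Proof. by move=> df; rewrite /pd deriveN//; exact: diff_derivable. Qed.

Lemma pdM i f g x : differentiable f x -> differentiable g x ->
  pd i (f \* g) x = pd i f x * g x + f x * pd i g x.
Proof.
move=> df dg; rewrite /pd deriveM//; [|exact: diff_derivable..].
by rewrite /GRing.scale/= addrC mulrC.
Qed.

Lemma pd_comp i f (g1 g2 : R * R -> R) x :
  differentiable g1 x -> differentiable g2 x ->
  differentiable f (g1 x, g2 x) ->
  pd i (fun y => f (g1 y, g2 y)) x =
  pd false f (g1 x, g2 x) * pd i g1 x + pd true f (g1 x, g2 x) * pd i g2 x.
Proof.
move=> d1 d2 df; rewrite {1}/pd.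
have dg := differentiable_pair d1 d2.
have -> : (fun y => f (g1 y, g2 y)) = f \o (fun y => (g1 y, g2 y)) by [].
rewrite deriveE; last exact: differentiable_comp.
rewrite diff_comp//= diff_plane// diff_pair//= -!deriveE//.
by rewrite mulrC [X in _ + X]mulrC.
Qed.

Lemma differentiable_comp2 f (g1 g2 : R * R -> R) x :
  differentiable g1 x -> differentiable g2 x ->
  differentiable f (g1 x, g2 x) ->
  differentiable (fun y => f (g1 y, g2 y)) x.
Proof.
move=> d1 d2 df.
have -> : (fun y => f (g1 y, g2 y)) = f \o (fun y => (g1 y, g2 y)) by [].
by apply: differentiable_comp => //; exact: differentiable_pair.
Qed.

Lemma differentiable_fst x : differentiable (fst : R * R -> R) x.
Proof. by apply: linear_differentiable => y; exact: cvg_fst. Qed.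

Lemma differentiable_snd x : differentiable (snd : R * R -> R) x.
Proof. by apply: linear_differentiable => y; exact: cvg_snd. Qed.

Lemma pd_fst i x : pd i fst x = (~~ i)%:R.
Proof.
rewrite /pd deriveE; last exact: differentiable_fst.
rewrite diff_lin; last by move=> y; exact: cvg_fst.
by case: i.
Qed.

Lemma pd_snd i x : pd i snd x = i%:R.
Proof.
rewrite /pd deriveE; last exact: differentiable_snd.
rewrite diff_lin; last by move=> y; exact: cvg_snd.
by case: i.
Qed.

(** A Taylor bound of this shape survives pointwise limits, which differentiability alone does not;
    [C1_limit] relies on this. *)
Lemma quad_differentiable f x (a b C : R) :
  (forall v, `|f (x + v) - f x - (v.1 * a + v.2 * b)| <= C * `|v| ^+ 2) ->
  [/\ differentiable f x, pd false f x = a & pd true f x = b].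
Proof.
move=> H.
pose d v : R := v.1 * a + v.2 * b.
have lin_d : linear d.
  by move=> k u v; rewrite /d /= /GRing.scale /=; ring.
pose dM := GRing.isLinear.Build _ _ _ _ _ lin_d.
pose dL : {linear _ -> _} := HB.pack d dM.
have cd : continuous dL.
  move=> y; rewrite /dL/= /d; apply: cvgD; apply: cvgM.
  - exact: cvg_fst.
  - exact: cvg_cst.
  - exact: cvg_snd.
  - exact: cvg_cst.
have [df dd] : differentiable f x /\ 'd f x = dL :> (R * R -> R).
  by apply: (quad_diff (d := dL) (C := C)) => // v; exact: H.
split=> //; rewrite /pd deriveE// dd /dL/= /d /=; rewrite ?mul0r ?mul1r ?addr0 ?add0r//.
Qed.

End PlaneCalculus.

(** * Functions with bounded partial derivatives up to a given order *)

Section CBclass.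
Context {R : realType}.
Implicit Types (f g : R * R -> R) (x v : R * R) (i : bool).

Lemma normr_pair v : `|v| = Num.max `|v.1| `|v.2|.
Proof. by []. Qed.

Lemma normr_fst_le v : `|v.1| <= `|v|.
Proof. by rewrite normr_pair le_max lexx. Qed.

Lemma normr_snd_le v : `|v.2| <= `|v|.
Proof. by rewrite normr_pair le_max lexx orbT. Qed.

Lemma normr_pair_le v (a : R) : (`|v| <= a) = (`|v.1| <= a) && (`|v.2| <= a).
Proof. by rewrite normr_pair ge_max. Qed.

Lemma segment_mvt f x v : (forall y, differentiable f y) ->
  exists2 c : R, 0 <= c <= 1 &
    f (x + v) - f x = v.1 * pd false f (x + c *: v) + v.2 * pd true f (x + c *: v).
Proof.
move=> df.
pose p (t : R) := f (x + t *: v).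
have dline (t : R) : is_diff t (fun t : R => x + t *: v) (fun h : R => h *: v).
  apply: is_diff_eq; rewrite funeqE => h.
  by rewrite -[LHS]/(0 + h *: v) add0r.
have dp (t : R) : is_derive t 1 p (v.1 * pd false f (x + t *: v) + v.2 * pd true f (x + t *: v)).
  have dc : differentiable p t.
    apply: (@differentiable_comp _ _ _ _ (fun t : R => x + t *: v) f) => //.
  apply: DeriveDef; first exact: diff_derivable.
  rewrite deriveE// /p.
  rewrite (_ : (fun t : R => f (x + t *: v)) = f \o (fun t : R => x + t *: v))//.
  rewrite diff_comp//= diff_plane//.
  by rewrite diff_val scale1r.
have [||c] := @MVT_segment R p (fun t => v.1 * pd false f (x + t *: v) + v.2 * pd true f (x + t *: v)) 0 1.
- exact: ler01.
- apply: continuous_subspaceT => t.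
  by apply: differentiable_continuous; apply/derivable1_diffP; have [] := dp t.
rewrite in_itv /= => c01; rewrite /p scale1r scale0r addr0 subr0 mulr1 => E.
by exists c.
Qed.

(** One constant serves all orders up to [n]. Even the partial derivatives of top order are required
    to be differentiable, so they are continuous and the rules of calculus apply to them. *)
Fixpoint CB (n : nat) f (M : R) : Prop :=
  [/\ forall x, differentiable f x, forall x, `|f x| <= M &
   if n is m.+1 then CB m (pd false f) M /\ CB m (pd true f) M else True].

Arguments CB : simpl never.

Lemma CB_diff n f M x : CB n f M -> differentiable f x.
Proof. by case: n => [|n] []. Qed.

Lemma CB_bound n f M x : CB n f M -> `|f x| <= M.
Proof. by case: n => [|n] []. Qed.

Lemma CB_ge0 n f M : CB n f M -> 0 <= M.
Proof. by move/(@CB_bound _ _ _ 0); apply: le_trans. Qed.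

Lemma CB_pd n i f M : CB n.+1 f M -> CB n (pd i f) M.
Proof. by case=> _ _ []; case: i. Qed.

Lemma CBS n f M : (forall x, differentiable f x) -> (forall x, `|f x| <= M) ->
  (forall i, CB n (pd i f) M) -> CB n.+1 f M.
Proof. by move=> ? ? H; split=> //; split; exact: H. Qed.

Lemma CB_pred n f M : CB n.+1 f M -> CB n f M.
Proof.
elim: n f => [|n IH] f h.
  by split => // x; [exact: CB_diff h|exact: CB_bound h].
by apply: CBS => [x|x|i]; [exact: CB_diff h|exact: CB_bound h|exact/IH/CB_pd].
Qed.

Lemma CB_leq m n f M : (m <= n)%N -> CB n f M -> CB m f M.
Proof.
move=> /subnK <-; elim: (n - m)%N => [//|k IH].
by rewrite addSn => /CB_pred.
Qed.

Lemma CB_le n f M M' : M <= M' -> CB n f M -> CB n f M'.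
Proof.
move=> MM'; elim: n f => [|n IH] f h.
  by split => // x; [exact: CB_diff h|exact: le_trans (CB_bound x h) MM'].
apply: CBS => [x|x|i]; [exact: CB_diff h|exact: le_trans (CB_bound x h) MM'|].
exact/IH/CB_pd.
Qed.

Lemma eq_CB n f g M : f =1 g -> CB n f M -> CB n g M.
Proof. by move/funext ->. Qed.

Lemma pdDE i f g : (forall x, differentiable f x) -> (forall x, differentiable g x) ->
  pd i (f \+ g) = pd i f \+ pd i g.
Proof. by move=> df dg; apply/funext => x; rewrite pdD. Qed.

Lemma pdNE i f : (forall x, differentiable f x) -> pd i (\- f) = \- pd i f.
Proof. by move=> df; apply/funext => x; rewrite pdN. Qed.

Lemma pdME i f g : (forall x, differentiable f x) -> (forall x, differentiable g x) ->
  pd i (f \* g) = (pd i f \* g) \+ (f \* pd i g).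
Proof. by move=> df dg; apply/funext => x; rewrite pdM. Qed.

Lemma CBD n f g M N : CB n f M -> CB n g N -> CB n (f \+ g) (M + N).
Proof.
elim: n f g => [|n IH] f g hf hg; have df x := CB_diff x hf;
  have dg x := CB_diff x hg; have bf x := CB_bound x hf; have bg x := CB_bound x hg.
  split=> // x; first exact: differentiableD.
  by rewrite (le_trans (ler_normD _ _))// lerD.
apply: CBS => [x|x|i].
- exact: differentiableD.
- by rewrite (le_trans (ler_normD _ _))// lerD.
- by rewrite pdDE//; apply: IH; exact: CB_pd.
Qed.

Lemma CB_cst n (c : R) : CB n (cst c) `|c|.
Proof.
have pd0 i : pd i (cst c : R * R -> R) = cst 0.
  by apply/funext => x; rewrite /pd derive_cst.
elim: n => [|n IH]; first by split.
apply: CBS => // i; rewrite pd0.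
elim: n {IH} => [|n IH]; first by split=> // x; rewrite normr0.
apply: CBS => // [x|j]; first by rewrite normr0.
suff -> : pd j (cst 0 : R * R -> R) = cst 0 by [].
by apply/funext => x; rewrite /pd derive_cst.
Qed.

(** The Leibniz rule produces two products at each order, whence the power of 2. *)
Lemma CBM n f g M N : CB n f M -> CB n g N -> CB n (f \* g) (2 ^+ n * (M * N)).
Proof.
elim: n f g => [|n IH] f g hf hg.
  have [[df bf _] [dg bg _]] := (hf, hg).
  split=> // x; first exact: differentiableM.
  by rewrite normrM expr0 mul1r ler_pM.
have MN0 : 0 <= M * N by rewrite mulr_ge0 ?(CB_ge0 hf)// (CB_ge0 hg).
have df x := CB_diff x hf; have dg x := CB_diff x hg.
apply: CBS => [x|x|i].
- exact: differentiableM.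
- rewrite normrM (@le_trans _ _ (M * N))//.
    by rewrite ler_pM ?(CB_bound _ hf) ?(CB_bound _ hg).
  by rewrite ler_peMl// exprn_ege1// ler1n.
- rewrite pdME// exprS -mulrA mulr_natl mulr2n; apply: CBD; apply: IH.
  + exact: CB_pd.
  + exact: CB_pred.
  + exact: CB_pred.
  + exact: CB_pd.
Qed.

Lemma CB_lip f M x v : CB 1 f M -> `|f (x + v) - f x| <= 2 * M * `|v|.
Proof.
move=> hf; have [c _ ->] := segment_mvt x v (fun y => CB_diff y hf).
rewrite (le_trans (ler_normD _ _))// -mulrA mulr_natl mulr2n !normrM.
by apply: lerD; rewrite mulrC ler_pM//; [exact: (CB_bound _ (CB_pd _ hf))|exact: normr_fst_le
 |exact: (CB_bound _ (CB_pd _ hf))|exact: normr_snd_le].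
Qed.

Lemma CB_taylor f M x v : CB 2 f M ->
  `|f (x + v) - f x - (v.1 * pd false f x + v.2 * pd true f x)| <= 4 * M * `|v| ^+ 2.
Proof.
move=> hf; have [c /andP[c0 c1] ->] := segment_mvt x v (fun y => CB_diff y hf).
have H i : `|pd i f (x + c *: v) - pd i f x| <= 2 * M * `|v|.
  apply: le_trans (CB_lip _ _ (CB_pd i hf)) _.
  rewrite ler_wpM2l ?mulr_ge0 ?(CB_ge0 hf)// normrZ ler_piMl// ger0_norm//.
rewrite addrC opprD addrACA -!mulrN -!mulrDr ![- _ + _]addrC.
rewrite (le_trans (ler_normD _ _))// !normrM.
have -> : 4 * M * `|v| ^+ 2 = `|v| * (2 * M * `|v|) + `|v| * (2 * M * `|v|) by ring.
by apply: lerD; apply: ler_pM => //; [exact: normr_fst_le|exact: normr_snd_le].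
Qed.

End CBclass.

Ltac nonneg := repeat first
  [done | apply: addr_ge0 | apply: mulr_ge0 | apply: exprn_ge0 | exact: ler01].

(** * Composition with maps given by their displacements *)

Section CBcomp.
Context {R : realType}.
Implicit Types (f g : R * R -> R) (x v : R * R) (i : bool).

Lemma differentiable_disp g1 x : differentiable g1 x ->
  differentiable (fun y : R * R => y.1 + g1 y) x /\
  differentiable (fun y : R * R => y.2 + g1 y) x.
Proof.
by move=> dg; split; apply: differentiableD => //; [exact: differentiable_fst|exact: differentiable_snd].
Qed.

Lemma pd_disp1 i g1 x : differentiable g1 x ->
  pd i (fun y : R * R => y.1 + g1 y) x = (~~ i)%:R + pd i g1 x.
Proof.
move=> dg; rewrite -[X in pd i X]/(fst \+ g1) pdD ?pd_fst//.
exact: differentiable_fst.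
Qed.

Lemma pd_disp2 i g1 x : differentiable g1 x ->
  pd i (fun y : R * R => y.2 + g1 y) x = i%:R + pd i g1 x.
Proof.
move=> dg; rewrite -[X in pd i X]/(snd \+ g1) pdD ?pd_snd//.
exact: differentiable_snd.
Qed.

(** A lift of a torus map is unbounded, but its displacement is bounded; all estimates are therefore
    put on [g1] and [g2]. *)
Definition disp g1 g2 : R * R -> R * R := fun x => (x.1 + g1 x, x.2 + g2 x).

Lemma differentiable_comp_disp f g1 g2 x : (forall y, differentiable f y) ->
  differentiable g1 x -> differentiable g2 x ->
  differentiable (f \o disp g1 g2) x.
Proof.
move=> df d1 d2; have [d1' _] := differentiable_disp d1.
by have [_ d2'] := differentiable_disp d2; exact: differentiable_comp2.
Qed.

Lemma pd_comp_disp i f g1 g2 : (forall x, differentiable f x) ->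
  (forall x, differentiable g1 x) -> (forall x, differentiable g2 x) ->
  pd i (f \o disp g1 g2) =
  (pd i f \o disp g1 g2) \+
  (((pd false f \o disp g1 g2) \* pd i g1) \+ ((pd true f \o disp g1 g2) \* pd i g2)).
Proof.
move=> df d1 d2; apply/funext => x.
have [d1' _] := differentiable_disp (d1 x).
have [_ d2'] := differentiable_disp (d2 x).
rewrite [LHS]pd_comp// pd_disp1// pd_disp2//=.
by case: i => /=; rewrite /disp; ring.
Qed.

(** By the chain rule a partial derivative of the composite is a sum of products of composites of
    one order less. The order of quantifiers matters: [C] depends only on [n] and on the size [G] of
    the displacements. *)
Lemma CB_comp n (G : R) : exists2 C : R, 0 <= C & forall f M g1 g2, CB n f M ->
  CB n g1 G -> CB n g2 G -> CB n (f \o disp g1 g2) (C * M).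
Proof.
elim: n => [|n [C C0 IH]].
  exists 1 => // f M g1 g2 hf h1 h2; rewrite mul1r; split => // x.
    apply: differentiable_comp_disp; first by move=> y; exact: CB_diff hf.
      exact: CB_diff h1.
    exact: CB_diff h2.
  exact: CB_bound hf.
exists (1 + (C + (2 ^+ n * (C * `|G|) + 2 ^+ n * (C * `|G|)))).
  by nonneg.
move=> f M g1 g2 hf h1 h2.
have G0 : 0 <= G := CB_ge0 h1.
have M0 : 0 <= M := CB_ge0 hf.
have df x := CB_diff x hf; have d1 x := CB_diff x h1; have d2 x := CB_diff x h2.
apply: CBS => [x|x|i].
- exact: differentiable_comp_disp.
- rewrite (le_trans (CB_bound _ hf))// ler_peMl// lerDl.
  by nonneg.
- rewrite pd_comp_disp//.
  have H j : CB n (pd j f \o disp g1 g2) (C * M).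
    by apply: IH; [exact: CB_pd|exact: CB_pred|exact: CB_pred].
  have := CBD (H i) (CBD (CBM (H false) (CB_pd i h1)) (CBM (H true) (CB_pd i h2))).
  apply: CB_le.
  rewrite ger0_norm//.
  have -> : C * M + (2 ^+ n * (C * M * G) + 2 ^+ n * (C * M * G)) =
    (C + (2 ^+ n * (C * G) + 2 ^+ n * (C * G))) * M by ring.
  by rewrite ler_wpM2r// lerDr.
Qed.

(** One derivative of [f] is spent on the mean value inequality, hence [n.+1]. The condition
    [d <= 1] keeps the displacements in a fixed ball, on which [CB_comp] has a fixed constant. *)
Lemma CB_comp_diff n (N : R) : 0 <= N -> exists2 C : R, 0 <= C &
  forall f e1 e2 (d : R), CB n.+1 f N -> d <= 1 -> CB n e1 d -> CB n e2 d ->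
  CB n ((f \o disp e1 e2) \- f) (C * d).
Proof.
move=> N0; elim: n => [|n [C C0 IH]].
  exists (2 * N); first by rewrite mulr_ge0.
  move=> f e1 e2 d hf d1 h1 h2.
  have df x := CB_diff x hf.
  split=> // x.
    apply: differentiableB => //; apply: differentiable_comp_disp => //.
      exact: CB_diff h1.
    exact: CB_diff h2.
  have -> : ((f \o disp e1 e2) \- f) x = f (x + (e1 x, e2 x)) - f x by case: x.
  rewrite (le_trans (CB_lip _ _ hf))// ler_wpM2l ?mulr_ge0// normr_pair_le.
  by rewrite (CB_bound _ h1) (CB_bound _ h2).
have [C1 C10 HC1] := CB_comp n.+1 (1 : R).
exists (2 * N + (C + (2 ^+ n * (C1 * N) + 2 ^+ n * (C1 * N)))).
  by nonneg.
move=> f e1 e2 d hf d1 h1 h2.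
have df x := CB_diff x hf; have de1 x := CB_diff x h1; have de2 x := CB_diff x h2.
have d0 : 0 <= d := CB_ge0 h1.
apply: CBS => [x|x|i].
- by apply: differentiableB => //; exact: differentiable_comp_disp.
- have -> : ((f \o disp e1 e2) \- f) x = f (x + (e1 x, e2 x)) - f x by case: x.
  rewrite (le_trans (CB_lip _ _ (CB_leq _ hf)))// [leRHS]mulrDl.
  apply: (@le_trans _ _ (2 * N * d)).
    by rewrite ler_wpM2l ?mulr_ge0// normr_pair_le (CB_bound _ h1) (CB_bound _ h2).
  by rewrite lerDl mulr_ge0// !addr_ge0// !mulr_ge0// exprn_ge0.
- have -> : pd i ((f \o disp e1 e2) \- f) = ((pd i f \o disp e1 e2) \- pd i f) \+
    (((pd false f \o disp e1 e2) \* pd i e1) \+ ((pd true f \o disp e1 e2) \* pd i e2)).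
    apply/funext => x; rewrite -[X in pd i X]/((f \o disp e1 e2) \+ (\- f)) pdDE.
    + by rewrite pdNE// pd_comp_disp//=; ring.
    + by move=> y; exact: differentiable_comp_disp.
    + by move=> y; exact: differentiableN.
  have H j : CB n (pd j f \o disp e1 e2) (C1 * N).
    apply: CB_pred; apply: HC1; first exact: CB_pd.
      exact: CB_le h1.
    exact: CB_le h2.
  have Hi : CB n ((pd i f \o disp e1 e2) \- pd i f) (C * d).
    by apply: IH => //; [exact: CB_pd|exact: CB_pred|exact: CB_pred].
  have := CBD Hi (CBD (CBM (H false) (CB_pd i h1)) (CBM (H true) (CB_pd i h2))).
  apply: CB_le.
  have -> : C * d + (2 ^+ n * (C1 * N * d) + 2 ^+ n * (C1 * N * d)) =
    (C + (2 ^+ n * (C1 * N) + 2 ^+ n * (C1 * N))) * d by ring.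
  by rewrite ler_wpM2r// lerDr mulr_ge0.
Qed.

End CBcomp.

(** * Limits of sequences with bounded derivatives *)

Section CBlimit.
Context {R : realType}.
Implicit Types (f g : R * R -> R) (x v : R * R) (i : bool).

Lemma half_pow_small (C e : R) : 0 < e -> exists m, forall k, (m <= k)%N -> C * 2^-1 ^+ k < e.
Proof.
move=> e0; pose m := Num.bound (`|C| / e).
exists m => k mk; rewrite exprVn ltr_pdivrMr ?exprn_gt0//.
have : `|C| / e < (2 ^ k)%:R.
  apply: lt_trans (archi_boundP _) _; first by rewrite divr_ge0// ltW.
  by rewrite ltr_nat (leq_ltn_trans mk)// ltn_expl.
rewrite ltr_pdivrMr// natrX mulrC; apply: le_lt_trans; exact: ler_norm.
Qed.

Lemma geom_cauchy_cvg (u : nat -> R) (C : R) :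
  (forall m, `|u m.+1 - u m| <= C * 2^-1 ^+ m) ->
  exists2 l : R, u @ \oo --> l & forall m, `|l - u m| <= 2 * C * 2^-1 ^+ m.
Proof.
move=> H.
(* The last factor keeps the exact partial geometric sum, which lets the induction on [k] close. *)
have tail m k : `|u (m + k)%N - u m| <= 2 * C * 2^-1 ^+ m * (1 - 2^-1 ^+ k).
  elim: k => [|k IH]; first by rewrite addn0 subrr normr0 expr0 subrr mulr0.
  rewrite addnS -(subrKA (u (m + k)%N)) (le_trans (ler_normD _ _))//.
  have := lerD (H (m + k)%N) IH; move/le_trans; apply.
  rewrite exprD exprS le_eqVlt; apply/orP; left; apply/eqP; by field.
have C0 : 0 <= C by have := le_trans (normr_ge0 _) (H 0%N); rewrite expr0 mulr1.
have tail' m k : `|u (m + k)%N - u m| <= 2 * C * 2^-1 ^+ m.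
  apply: le_trans (tail m k) _; rewrite ler_piMr ?mulr_ge0 ?exprn_ge0//.
have cu : cvgn u.
  apply/cauchy_cvgP; apply: cauchy_exP => e e0.
  have [m Hm] := half_pow_small (2 * C) e0.
  exists (u m); exists m => // n /= mn; rewrite /ball/= distrC.
  by rewrite -(subnKC mn) (le_lt_trans (tail' _ _))// Hm.
exists (limn u) => // m.
rewrite distrC.
have : (fun n => `|u m - u n|) @ \oo --> `|u m - limn u|.
  by apply: cvg_norm; apply: cvgB => //; exact: cvg_cst.
move/cvg_lim => <-//.
apply: limr_le; first by apply/cvg_ex; exists `|u m - limn u|; apply: cvg_norm; apply: cvgB => //; exact: cvg_cst.
exists m => // n /= mn; rewrite distrC -(subnKC mn); exact: tail'.
Qed.

Lemma cvg_le_bound (u : nat -> R) (l C : R) : u @ \oo --> l -> (forall m, `|u m| <= C) -> `|l| <= C.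
Proof.
move=> ul H; have : (fun n => `|u n|) @ \oo --> `|l| by exact: cvg_norm.
move=> h; rewrite -(cvg_lim _ h)//; apply: limr_le; first by apply/cvg_ex; exists `|l|.
by exists 0%N => // n _; exact: H.
Qed.

Lemma pdB_fun i f g : (forall x, differentiable f x) -> (forall x, differentiable g x) ->
  pd i (f \- g) = pd i f \- pd i g.
Proof.
move=> df dg; rewrite -[X in pd i X]/(f \+ (\- g)) pdDE ?pdNE//.
by move=> x; exact: differentiableN.
Qed.

(** The second order Taylor bound of [F m] has a constant independent of [m]. It passes to the
    pointwise limit and there identifies the partial derivatives of [f] with the limits of those of
    [F m]. *)
Lemma C1_limit (F : nat -> R * R -> R) f (M C : R) :
  (forall m, CB 2 (F m) M) ->
  (forall m, CB 1 (F m.+1 \- F m) (C * 2^-1 ^+ m)) ->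
  (forall x, F ^~ x @ \oo --> f x) ->
  [/\ forall x, differentiable f x, forall x, `|f x| <= M &
      forall i x, (fun m => pd i (F m) x) @ \oo --> pd i f x].
Proof.
move=> hF dF Ff.
have dFm m x : differentiable (F m) x := CB_diff x (hF m).
have cvpd i x : exists l : R, (fun m => pd i (F m) x) @ \oo --> l.
  have [|l hl _] := @geom_cauchy_cvg (fun m => pd i (F m) x) C; last by exists l.
  by move=> m; have := CB_bound x (CB_pd i (dF m)); rewrite pdB_fun.
have [G0 HG0] := choice (cvpd false).
have [G1 HG1] := choice (cvpd true).
have T x v : `|f (x + v) - f x - (v.1 * G0 x + v.2 * G1 x)| <= 4 * M * `|v| ^+ 2.
  apply: (@cvg_le_bound (fun m => F m (x + v) - F m x -
      (v.1 * pd false (F m) x + v.2 * pd true (F m) x))).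
    apply: cvgB; first by apply: cvgB; exact: Ff.
    by apply: cvgD; apply: cvgM; [exact: cvg_cst|exact: HG0|exact: cvg_cst|exact: HG1].
  by move=> m; exact: CB_taylor.
split=> [x|x|i x].
- by have [] := quad_differentiable (T x).
- by apply: (cvg_le_bound (Ff x)) => m; exact: CB_bound (hF m).
- by have [_ g0 g1] := quad_differentiable (T x); case: i; rewrite ?g0 ?g1.
Qed.

(** Two orders are lost, because a partial derivative of order [n] is seen to be differentiable only
    through its Taylor bound, which uses order [n.+2]. *)
Lemma CB_limit n (F : nat -> R * R -> R) (f : R * R -> R) (M C : R) :
  (forall m, CB n.+2 (F m) M) ->
  (forall m, CB n.+1 (F m.+1 \- F m) (C * 2^-1 ^+ m)) ->
  (forall x, F ^~ x @ \oo --> f x) -> CB n f M.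
Proof.
elim: n F f => [|n IH] F f hF dF Ff.
  by have [] := C1_limit hF dF Ff.
have hF2 m : CB 2 (F m) M by apply: CB_leq (hF m).
have dF1 m : CB 1 (F m.+1 \- F m) (C * 2^-1 ^+ m) by apply: CB_leq (dF m).
have [df bf pf] := C1_limit hF2 dF1 Ff.
apply: CBS => // i; apply: (IH (fun m => pd i (F m))) => [m|m|//].
- exact: CB_pd.
- rewrite -pdB_fun; [exact: CB_pd|by move=> x; exact: CB_diff (hF _)..].
Qed.

End CBlimit.

(** * Sine waves and their derivatives *)

Section Trig.
Context {R : realType}.
Implicit Types (x : R).

Lemma sin_le_abs x : `|sin x| <= `|x|.
Proof.
wlog x0 : x / 0 <= x.
  move=> H; have [/H//|x0] := leP 0 x.
  by rewrite -normrN -sinN -[leRHS]normrN H// oppr_ge0 ltW.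
have [||c] := @MVT_segment R sin cos 0 x.
- exact: x0.
- by apply: continuous_subspaceT; exact: continuous_sin.
- move=> _; rewrite sin0 !subr0 => ->; rewrite normrM ler_piMl//; exact: cos_max.
Qed.

Lemma sinD2npi x (n : nat) : sin (x + 2 * pi * n%:R) = sin x.
Proof.
have -> : 2 * pi * n%:R = pi *+ 2 *+ n :> R by rewrite -[RHS]mulr_natr mulr_natl.
by rewrite (periodicn (@sinD2pi R)).
Qed.

Lemma sinD2zpi x (n : int) : sin (x + 2 * pi * n%:~R) = sin x.
Proof.
case: n => n; first exact: sinD2npi.
by rewrite NegzE mulrNz mulrN -pmulrn -(sinD2npi (x - _) n.+1) subrK.
Qed.

Lemma sin_sub x y : sin x - sin y = 2 * sin ((x - y) / 2) * cos ((x + y) / 2).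
Proof.
have -> : sin x = sin ((x - y) / 2 + (x + y) / 2) by congr sin; field.
have -> : sin y = sin ((x + y) / 2 - (x - y) / 2) by congr sin; field.
rewrite sinD sinB; ring.
Qed.

(* The phase [th] makes the family stable under partial derivatives. *)
Definition wave (c a b th : R) : R * R -> R := fun z => c * sin (a * z.1 + b * z.2 + th).

Lemma wave_derive c a b th z :
  differentiable (wave c a b th) z /\
  forall i, pd i (wave c a b th) z = wave (c * (if i then b else a)) a b (th + pi / 2) z.
Proof.
pose l := fun z : R * R => a * z.1 + b * z.2 + th.
have dl : is_diff z l (fun v => a * v.1 + b * v.2).
  have h1 : is_diff z (fst : R * R -> R) fst.
    by apply: DiffDef; [exact: differentiable_fst|rewrite diff_lin// => y; exact: cvg_fst].
  have h2 : is_diff z (snd : R * R -> R) snd.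
    by apply: DiffDef; [exact: differentiable_snd|rewrite diff_lin// => y; exact: cvg_snd].
  have -> : l = (a *: (fst : R * R -> R)) + (b *: (snd : R * R -> R)) + cst th by [].
  by apply: is_diff_eq; apply/funext => v; rewrite addr0.
have ds y : differentiable (@sin R) y by apply/derivable1_diffP; exact: derivable_sin.
have dsl : differentiable (@sin R \o l) z by apply: differentiable_comp => //; exact: ds.
have wE : wave c a b th = c *: (@sin R \o l : R * R -> R) by [].
split; first by rewrite wE; exact: differentiableZ.
move=> i; rewrite wE /pd deriveE; last exact: differentiableZ.
rewrite diffZ//=.
have -> : 'd (@sin R \o l) z = 'd (@sin R) (l z) \o 'd l z :> (R * R -> R).
  by apply: diff_comp; [exact: ex_diff|exact: ds].
rewrite /=.
rewrite diff_val deriv1E; last exact: derivable_sin.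
rewrite derive1E derive_val /wave addrA sinDpihalf /= /GRing.scale/= /l.
by case: i => /=; ring.
Qed.

Lemma CB_wave n c a b th B : 1 <= B -> `|a| <= B -> `|b| <= B ->
  CB n (wave c a b th) (`|c| * B ^+ n).
Proof.
move=> B1 aB bB; elim: n c th => [|n IH] c th.
  split=> // x; first by have [] := wave_derive c a b th x.
  by rewrite expr0 mulr1 normrM ler_piMr// sin_max.
apply: CBS => [x|x|i].
- by have [] := wave_derive c a b th x.
- rewrite normrM ler_wpM2l// (le_trans (sin_max _))// exprn_ege1//.
- have -> : pd i (wave c a b th) = wave (c * (if i then b else a)) a b (th + pi / 2).
    by apply/funext => z; have [_ ->] := wave_derive c a b th z.
  apply: CB_le (IH _ _); rewrite normrM exprS mulrA ler_wpM2r//.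
    by rewrite exprn_ge0// (le_trans _ B1).
  by rewrite ler_wpM2l//; case: i.
Qed.

End Trig.

(** * Weak mixing from a mixing sequence *)

Section BoundedExpectation.
Context d {T : measurableType d} {R : realType} (mu : {finite_measure set T -> \bar R}).
Implicit Types (f g : T -> R).

Definition bmeas f := measurable_fun setT f /\ exists M, forall x, `|f x| <= M.

Definition mean f : R := Rintegral mu setT f.

Lemma bmeas_integrable f : bmeas f -> mu.-integrable setT (EFin \o f).
Proof.
move=> [mf [M fM]]; apply: measurable_bounded_integrable => //.
- exact: fin_num_fun_lty.
- exists M; split; first by rewrite num_real.
  by move=> y My x _ /=; exact: le_trans (fM x) (ltW My).
Qed.

Lemma bmeas_cst (c : R) : bmeas (cst c).
Proof. by split; [exact: measurable_cst|exists `|c|]. Qed.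

Lemma bmeasD f g : bmeas f -> bmeas g -> bmeas (f \+ g).
Proof.
move=> [mf [M fM]] [mg [N gN]]; split; first exact: measurable_funD.
by exists (M + N) => x; rewrite (le_trans (ler_normD _ _))// lerD.
Qed.

Lemma bmeasM f g : bmeas f -> bmeas g -> bmeas (f \* g).
Proof.
move=> [mf [M fM]] [mg [N gN]]; split; first exact: measurable_funM.
by exists (M * N) => x; rewrite normrM ler_pM.
Qed.

Lemma bmeasZ (c : R) f : bmeas f -> bmeas (fun x => c * f x).
Proof. exact/bmeasM/bmeas_cst. Qed.

Lemma bmeasB f g : bmeas f -> bmeas g -> bmeas (f \- g).
Proof.
move=> [mf [M fM]] [mg [N gN]]; split; first exact: measurable_funB.
by exists (M + N) => x; rewrite (le_trans (ler_normB _ _))// lerD.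
Qed.

Lemma bmeas_norm f : bmeas f -> bmeas (fun x => `|f x|).
Proof.
move=> [mf [M fM]]; split; first exact: measurableT_comp.
by exists M => x; rewrite normr_id.
Qed.

Lemma bmeas_indic (A : set T) : measurable A -> bmeas (\1_A).
Proof.
move=> mA; split; first exact: measurable_indic.
by exists 1 => x; rewrite indicE; case: (_ \in _); rewrite ?normr1 ?normr0.
Qed.

Lemma bmeas_sum (I : Type) (s : seq I) (F : I -> T -> R) :
  (forall i, bmeas (F i)) -> bmeas (fun x => \sum_(i <- s) F i x).
Proof.
move=> hF; elim: s => [|i s IH].
  rewrite (_ : (fun _ => _) = cst 0); first exact: bmeas_cst.
  by apply/funext => x; rewrite big_nil.
rewrite (_ : (fun _ => _) = F i \+ (fun x => \sum_(i <- s) F i x)); first exact: bmeasD.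
by apply/funext => x; rewrite big_cons.
Qed.

Lemma meanD f g : bmeas f -> bmeas g -> mean (f \+ g) = mean f + mean g.
Proof. by move=> hf hg; apply: RintegralD => //; exact: bmeas_integrable. Qed.

Lemma meanB f g : bmeas f -> bmeas g -> mean (f \- g) = mean f - mean g.
Proof. by move=> hf hg; apply: RintegralB => //; exact: bmeas_integrable. Qed.

Lemma meanZ (c : R) f : bmeas f -> mean (fun x => c * f x) = c * mean f.
Proof. by move=> hf; apply: RintegralZl => //; exact: bmeas_integrable. Qed.

Lemma mean_cst (c : R) : mean (cst c) = c * fine (mu setT).
Proof. by rewrite /mean Rintegral_cst. Qed.

Lemma mean_indic (A : set T) : measurable A -> mean (\1_A) = fine (mu A).
Proof. by move=> mA; rewrite /mean /Rintegral integral_indic// setIT. Qed.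

Lemma mean_ge0 f : (forall x, 0 <= f x) -> 0 <= mean f.
Proof. by move=> f0; apply: Rintegral_ge0. Qed.

Lemma mean_le f g : bmeas f -> bmeas g -> (forall x, f x <= g x) -> mean f <= mean g.
Proof. by move=> hf hg fg; apply: le_Rintegral => //; exact: bmeas_integrable. Qed.

Lemma mean_norm f : bmeas f -> `|mean f| <= mean (fun x => `|f x|).
Proof. by move=> hf; apply: le_normr_Rintegral => //; exact: bmeas_integrable. Qed.

Lemma mean_sum (I : Type) (s : seq I) (F : I -> T -> R) :
  (forall i, bmeas (F i)) ->
  mean (fun x => \sum_(i <- s) F i x) = \sum_(i <- s) mean (F i).
Proof.
move=> hF; elim: s => [|i s IH].
  rewrite big_nil (_ : (fun _ => _) = cst 0) ?mean_cst ?mul0r//.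
  by apply/funext => x; rewrite big_nil.
rewrite big_cons (_ : (fun _ => _) = F i \+ (fun x => \sum_(i <- s) F i x)).
  by rewrite meanD ?IH//; exact: bmeas_sum.
by apply/funext => x; rewrite big_cons.
Qed.

Lemma eq_mean f g : f =1 g -> mean f = mean g.
Proof. by move/funext ->. Qed.

End BoundedExpectation.

Section CesaroAverages.
Context {R : realType}.

Lemma sum_shift_le (x : nat -> R) (s N : nat) : (forall n, 0 <= x n <= 1) ->
  \sum_(1 <= n < N.+1) x n <= s%:R + \sum_(1 <= n < N.+1) x (n + s)%N.
Proof.
move=> x01.
have H : \sum_(1 <= n < N.+1) x n <= \sum_(1 <= n < (s + N).+1) x n.
  rewrite (@big_cat_nat _ _ _ N.+1 1 (s + N).+1)//=; last by rewrite ltnS leq_addl.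
  by rewrite lerDl sumr_ge0// => i _; case/andP: (x01 i).
apply: le_trans H _.
rewrite (@big_cat_nat _ _ _ s.+1 1 (s + N).+1)//=; last by rewrite ltnS leq_addr.
apply: lerD.
  apply: (@le_trans _ _ (\sum_(1 <= n < s.+1) 1)).
    by apply: ler_sum_nat => i _; case/andP: (x01 i).
  by rewrite big_const_nat subn1 /= iter_addr addr0.
by rewrite -{1}(add1n s) big_addn subSn ?leq_addr// addKn.
Qed.

(** Shifting a long sum by [s] changes it by at most [s]. Averaging over the shifts in [t] therefore
    bounds the long averages by the short ones, up to an error that division by [N] removes. *)
Lemma cesaro_criterion (x : nat -> R) : (forall n, 0 <= x n <= 1) ->
  (forall e : R, 0 < e -> exists2 t : seq nat, (0 < size t)%N &
     forall n, \sum_(s <- t) x (n + s)%N <= e * (size t)%:R) ->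
  (fun N : nat => N%:R^-1 * \sum_(1 <= n < N.+1) x n) @ \oo --> (0 : R).
Proof.
move=> x01 H; apply/cvgrPdist_le => e e0.
have e2 : 0 < e / 2 by rewrite divr_gt0.
have [t t0 Ht] := H (e / 2) e2.
pose S : R := (\sum_(s <- t) s)%:R.
pose N0 := Num.bound (S / (e / 2)).
near=> N.
have Np : (N0.+1 <= N)%N by near: N; exists N0.+1.
have N_gt0 : 0 < N%:R :> R by rewrite ltr0n (leq_trans _ Np).
rewrite sub0r normrN ger0_norm; last first.
  apply: mulr_ge0; first by rewrite invr_ge0 ltW.
  by rewrite sumr_ge0// => i _; case/andP: (x01 i).
rewrite mulrC ler_pdivrMr//.
have tS : \sum_(s <- t) (\sum_(1 <= n < N.+1) x n) <=
    \sum_(s <- t) (s%:R + \sum_(1 <= n < N.+1) x (n + s)%N).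
  by apply: ler_sum => s _; exact: sum_shift_le.
rewrite big_split/= -natr_sum -/S [X in _ <= _ + X]exchange_big/= in tS.
have : \sum_(1 <= n < N.+1) \sum_(s <- t) x (n + s)%N <= \sum_(1 <= n < N.+1) (e / 2 * (size t)%:R).
  by apply: ler_sum => n _; exact: Ht.
rewrite [X in _ <= X -> _]big_const_nat subn1 /= iter_addr addr0 => h2.
have h3 := le_trans tS (lerD (lexx S) h2).
rewrite big_const_seq count_predT iter_addr addr0 in h3.
have S_le : S <= e / 2 * N%:R.
  rewrite mulrC -ler_pdivrMr ?divr_gt0//.
  apply: ltW; apply: lt_le_trans (archi_boundP _) _.
    by apply: divr_ge0; [rewrite ler0n|rewrite ltW].
  by rewrite ler_nat; exact: ltnW.
have S0 : 0 <= S by rewrite ler0n.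
have t1 : 1 <= (size t)%:R :> R by rewrite ler1n.
rewrite -(ler_pM2l (lt_le_trans ltr01 t1)).
rewrite mulr_natl; apply: le_trans h3 _; rewrite -[_ *+ N]mulr_natr.
have : S <= e / 2 * N%:R * (size t)%:R.
  by rewrite (le_trans S_le)// ler_peMr// mulr_ge0 ?divr_ge0 ?ltW.
move: (size t)%:R (N%:R : R) => u v; nra.
Unshelve. all: by end_near. Qed.

End CesaroAverages.

Section WeakMixingCriterion.
Context d {T : measurableType d} {R : realType} (P : probability T R).
Implicit Types (f g : T -> R).

Lemma mean1 (c : R) : mean P (cst c) = c.
Proof. rewrite mean_cst -[RHS]mulr1; congr (_ * _).
exact: (congr1 fine (probability_setT P)). Qed.

Lemma mean_indicP (A : set T) : measurable A -> mean P (\1_A) = fine (P A).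
Proof. exact: mean_indic. Qed.

Lemma mean_abs_le1 f : bmeas f -> (forall x, `|f x| <= 1) -> `|mean P f| <= 1.
Proof.
move=> hf f1; rewrite -[leRHS](mean1 1); apply: le_trans (mean_norm P hf) _.
by apply: mean_le => //; [exact: bmeas_norm|exact: bmeas_cst].
Qed.

(** In the expanded square the diagonal contributes at most the size of [t], and each off-diagonal
    term at most [e]. The weights [sg] will be the signs of correlations. *)
Lemma mean_square_almost_orthogonal (X : nat -> T -> R) (sg : nat -> R) (e : R) (t : seq nat) :
  (forall s, bmeas (X s)) -> (forall s x, `|X s x| <= 1) -> (forall s, `|sg s| <= 1) -> 0 <= e ->
  pairwise (fun s s' => `|mean P (X s \* X s')| <= e) t ->
  mean P (fun x => (\sum_(s <- t) sg s * X s x) ^+ 2) <= (size t)%:R + e * (size t)%:R ^+ 2.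
Proof.
move=> mX X1 sg1 e0; elim: t => [|m t IH] /=.
  move=> _; rewrite (_ : (fun _ => _) = cst 0) ?mean1 ?mulr0n ?expr0n ?mulr0 ?addr0//.
  by apply/funext => x; rewrite big_nil expr0n.
move=> /andP[mt pt].
pose Y x := \sum_(s <- t) sg s * X s x.
have mY : bmeas Y by apply: bmeas_sum => i; exact: bmeasZ.
have mXX s s' : bmeas (X s \* X s') by exact: bmeasM.
rewrite (_ : (fun _ => _) = (fun x => sg m ^+ 2 * (X m \* X m) x) \+
   ((fun x => 2 * sg m * \sum_(s <- t) sg s * (X m \* X s) x) \+ (Y \* Y))); last first.
  apply/funext => x; rewrite big_cons /= -/(Y x).
  have -> : \sum_(s <- t) sg s * (X m x * X s x) = X m x * Y x.
    by rewrite /Y mulr_sumr; apply: eq_bigr => s _; ring.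
  by ring.
have mS : bmeas (fun x => \sum_(s <- t) sg s * (X m \* X s) x).
  by apply: bmeas_sum => i; exact: bmeasZ.
rewrite meanD; [|exact: bmeasZ|by apply: bmeasD; [exact: bmeasZ|exact: bmeasM]].
rewrite meanD; [|exact: bmeasZ|exact: bmeasM].
rewrite !meanZ// mean_sum; last by move=> i; exact: bmeasZ.
have h1 : sg m ^+ 2 * mean P (X m \* X m) <= 1.
  apply: le_trans (ler_norm _) _; rewrite normrM mulr_ile1//.
    by rewrite normrX expr_le1.
  apply: mean_abs_le1 => // x; rewrite normrM mulr_ile1//.
have h2 : 2 * sg m * \sum_(s <- t) mean P (fun x => sg s * (X m \* X s) x) <= 2 * (e * (size t)%:R).
  apply: le_trans (ler_norm _) _; rewrite -mulrA normrM gtr0_norm// ler_pM2l//.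
  rewrite normrM -[leRHS]mul1r ler_pM//.
  apply: le_trans (ler_norm_sum _ _ _) _.
  have -> : e * (size t)%:R = \sum_(s <- t) e.
    by rewrite big_const_seq count_predT iter_addr addr0 mulr_natr.
  rewrite !big_seq; apply: ler_sum => s st.
  rewrite meanZ// normrM -[leRHS]mul1r ler_pM//.
  by move/allP : mt => /(_ _ st).
have h3 := IH pt.
have -> : mean P (Y \* Y) = mean P (fun x => (\sum_(s <- t) sg s * X s x) ^+ 2).
  by apply: eq_mean => x; rewrite /= /Y expr2.
rewrite -natr1; set S := (size t)%:R in h2 h3 *.
have S0 : 0 <= S by rewrite ler0n.
apply: (le_trans (lerD h1 (lerD h2 h3))); nra.
Qed.

(** Almost orthogonal functions cannot all correlate with one [g]: with [Y] the sum of the [X s]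
    weighted by the signs of their correlations, expand the mean of [(Y - l * g) ^+ 2], which is
    nonnegative. The parameter [l] is left free for optimization. *)
Lemma sum_abs_corr_le (X : nat -> T -> R) (g : T -> R) (e l : R) (t : seq nat) :
  (forall s, bmeas (X s)) -> (forall s x, `|X s x| <= 1) ->
  bmeas g -> (forall x, `|g x| <= 1) -> 0 <= e -> 0 < l ->
  pairwise (fun s s' => `|mean P (X s \* X s')| <= e) t ->
  2 * l * \sum_(s <- t) `|mean P (X s \* g)| <= (size t)%:R + e * (size t)%:R ^+ 2 + l ^+ 2.
Proof.
move=> mX X1 mg g1 e0 l0 pt.
pose sg s : R := Num.sg (mean P (X s \* g)).
have sg1 s : `|sg s| <= 1.
  by rewrite /sg normr_sg; case: (_ == 0).
pose Y x := \sum_(s <- t) sg s * X s x.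
have mY : bmeas Y by apply: bmeas_sum => i; exact: bmeasZ.
have E : mean P (Y \* g) = \sum_(s <- t) `|mean P (X s \* g)|.
  rewrite (_ : Y \* g = fun x => \sum_(s <- t) sg s * (X s \* g) x); last first.
    by apply/funext => x; rewrite /Y /= mulr_suml; apply: eq_bigr => s _; rewrite mulrA.
  rewrite mean_sum; last by move=> i; apply: bmeasZ; exact: bmeasM.
  apply: eq_bigr => s _; rewrite meanZ; last exact: bmeasM.
  by rewrite /sg -normrEsg.
have H := mean_square_almost_orthogonal mX X1 sg1 e0 pt.
have H0 : 0 <= mean P ((fun x => (Y x) ^+ 2) \+ ((fun x => (- 2 * l) * (Y \* g) x) \+ (fun x => l ^+ 2 * (g \* g) x))).
  apply: mean_ge0 => x; rewrite /= (_ : _ + _ = (Y x - l * g x) ^+ 2) ?sqr_ge0//; ring.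
have mYY : bmeas (fun x => (Y x) ^+ 2).
  by rewrite (_ : (fun _ => _) = Y \* Y); [exact: bmeasM|apply/funext => x; rewrite expr2].
have mgg : bmeas (g \* g) by exact: bmeasM.
have mYg : bmeas (Y \* g) by exact: bmeasM.
rewrite meanD// in H0; last by apply: bmeasD; exact: bmeasZ.
rewrite meanD// in H0; [|exact: bmeasZ..].
rewrite !meanZ// E in H0.
have : mean P (g \* g) <= 1.
  by rewrite (le_trans (ler_norm _))// mean_abs_le1// => x; rewrite normrM mulr_ile1.
rewrite -[in X in X -> _](ler_pM2l (exprn_gt0 2 l0)) mulr1 => h4.
move: H H0 h4; rewrite -/Y; lra.
Qed.

Lemma iter_measurable (g : T -> T) n : measurable_fun setT g -> measurable_fun setT (iter n g).
Proof.
by move=> mg; elim: n => [|n IH]; [exact: measurable_id|exact: (measurableT_comp mg)].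
Qed.

Lemma iter_preimage_measure (g : T -> T) n A : measurable_fun setT g ->
  (forall B, measurable B -> P (g @^-1` B) = P B) ->
  measurable A -> P (iter n g @^-1` A) = P A.
Proof.
move=> mg pg; elim: n A => [//|n IH] A mA.
have -> : iter n.+1 g @^-1` A = iter n g @^-1` (g @^-1` A) by apply/funext => x.
by rewrite IH ?pg// -[X in measurable X]setTI; exact: mg.
Qed.

(** From the mixing times one extracts a finite set [t] along which the translates of [A] are
    pairwise almost independent. Then for every [n] the average over [s] in [t] of the correlations
    with [B] at times [n + s] is small, and [cesaro_criterion] applies. *)
Lemma weak_mixing_of_mixing_sequence (g : T -> T) (m : nat -> nat) :
  measurable_fun setT g ->
  (forall B, measurable B -> P (g @^-1` B) = P B) ->
  (forall A B, measurable A -> measurable B ->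
    (fun k => fine (P (iter (m k) g @^-1` A `&` B))) @ \oo --> fine (P A) * fine (P B)) ->
  forall A B, measurable A -> measurable B ->
  (fun N : nat => N%:R^-1 * \sum_(1 <= n < N.+1)
     `| fine (P (iter n g @^-1` A `&` B)) - fine (P A) * fine (P B) |)
      @ \oo --> (0 : R).
Proof.
move=> mg pg mix A B mA mB.
have mU n A' : measurable A' -> measurable (iter n g @^-1` A').
  by move=> mA'; rewrite -[X in measurable X]setTI; exact: iter_measurable.
pose a := fine (P A).
have fP01 C : measurable C -> 0 <= fine (P C) <= 1.
  move=> mC; rewrite fine_ge0//= -[leRHS]/(fine (1%:E)) fine_le//.
    exact: fin_num_measure.
  exact: probability_le1.
pose X s : T -> R := \1_(iter s g @^-1` A) \- cst a.
have mX s : bmeas (X s) by apply: bmeasB; [apply/bmeas_indic/mU|exact: bmeas_cst].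
have X1 s x : `|X s x| <= 1.
  have /andP[a0 a1] := fP01 _ mA.
  rewrite /X /= indicE; case: (_ \in _) => /=; rewrite ler_norml /a; apply/andP; split; lra.
have EX s C : measurable C -> mean P (X s \* \1_C) = fine (P (iter s g @^-1` A `&` C)) - a * fine (P C).
  move=> mC; rewrite (_ : X s \* \1_C = \1_(iter s g @^-1` A `&` C) \- (fun x => a * \1_C x)).
    rewrite meanB; [|exact/bmeas_indic/measurableI/mC/mU|exact/bmeasZ/bmeas_indic].
    by rewrite meanZ ?mean_indicP//; [exact/measurableI/mC/mU|exact: bmeas_indic].
  apply/funext => x; rewrite /X /= !indicE in_setI.
  by case: (_ \in _); case: (_ \in _) => /=; ring.
have EXX s s' : mean P (X s \* X s') = fine (P (iter s g @^-1` A `&` iter s' g @^-1` A)) - a * a.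
  rewrite (_ : X s \* X s' = (X s \* \1_(iter s' g @^-1` A)) \- (fun x => a * X s x)); last first.
    by apply/funext => x; rewrite /X /=; ring.
  rewrite meanB; [|exact/bmeasM/bmeas_indic/mU|exact: bmeasZ].
  rewrite EX ?meanZ//; last exact: mU.
  have -> : mean P (X s) = 0.
    rewrite meanB; [|exact/bmeas_indic/mU|exact: bmeas_cst].
    by rewrite (mean1 a) (mean_indicP (mU s A mA)) (iter_preimage_measure _ mg pg mA) subrr.
  by rewrite iter_preimage_measure// mulr0 subr0.
have c01 n : 0 <= `| fine (P (iter n g @^-1` A `&` B)) - a * fine (P B) | <= 1.
  rewrite normr_ge0/= -EX//; apply: mean_abs_le1; first exact/bmeasM/bmeas_indic.
  by move=> x; rewrite normrM mulr_ile1// indicE; case: (_ \in _); rewrite ?normr1 ?normr0.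
apply: cesaro_criterion => // e e0.
(* Finitely many mixing times, chosen inductively with large gaps, decorrelate [A] pairwise. *)
have Hk (K : nat) (eps : R) : 0 < eps -> exists2 t : seq nat, size t = K &
    forall n, pairwise (fun s s' => `|mean P (X (n + s)%N \* X (n + s')%N)| <= eps) t.
  move=> eps0; elim: K => [|K [t st pt]]; first by exists [::].
  have Hs : \forall k \near \oo, forall s, s \in t ->
      `|fine (P (iter (m k) g @^-1` A `&` iter s g @^-1` A)) - a * a| <= eps.
    elim: t {st pt} => [|s t IH]; first by near=> k.
    have Hs : \forall k \near \oo, `|fine (P (iter (m k) g @^-1` A `&` iter s g @^-1` A)) - a * a| <= eps.
      have /cvgrPdist_le/(_ _ eps0) := mix _ _ mA (mU s _ mA).
      rewrite (iter_preimage_measure _ mg pg mA) -/a.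
      by apply: filterS => k; rewrite distrC.
    apply: filterS2 IH Hs => k h1 h2 s'; rewrite inE => /orP[/eqP ->//|]; exact: h1.
  have [k _ /(_ k (leqnn k)) hk] := Hs.
  exists (m k :: t); first by rewrite /= st.
  move=> n /=; rewrite pt andbT; apply/allP => s st'.
  rewrite EXX.
  (* A common shift [n] of both times is absorbed by the invariance of the measure, so [t] does not
     depend on [n]. *)
  have -> : iter (n + m k) g @^-1` A `&` iter (n + s) g @^-1` A =
     iter n g @^-1` (iter (m k) g @^-1` A `&` iter s g @^-1` A).
    by apply/funext => x; rewrite /preimage /= /setI /= addnC iterD [in X in _ /\ X]addnC iterD.
  rewrite iter_preimage_measure//; last by apply: measurableI; exact: mU.
  exact: hk.
(* With this size the diagonal term [K] is at most [K ^+ 2 * e ^+ 2 / 2], as is the off-diagonal one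
   for the level [e ^+ 2 / 2]. The choice [l = K * e] then bounds the sum of correlations by
   [e * K]. *)
pose K := (Num.bound (2 / e ^+ 2)).+1.
have [t st pt] := Hk K (e ^+ 2 / 2) (divr_gt0 (exprn_gt0 2 e0) (ltr0Sn _ _)).
exists t; first by rewrite st.
move=> n.
have K0 : 0 < K%:R :> R by rewrite ltr0n.
have l0 : 0 < K%:R * e by rewrite mulr_gt0.
have := @sum_abs_corr_le (fun s => X (n + s)%N) (\1_B) (e ^+ 2 / 2) (K%:R * e) t.
rewrite st => /(_ (fun s => mX _) (fun s => X1 _) (bmeas_indic mB)).
have B1 x : `|\1_B x : R| <= 1.
  by rewrite indicE; case: (_ \in _); rewrite ?normr1 ?normr0.
move=> /(_ B1 (divr_ge0 (exprn_ge0 2 (ltW e0)) (ler0n _ _)) l0 (pt n)).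
under eq_bigr => s _ do rewrite EX//.
set S := \sum_(s <- t) _.
have hK : K%:R <= K%:R ^+ 2 * (e ^+ 2 / 2).
  have : 2 / e ^+ 2 <= K%:R.
    apply: ltW; apply: lt_trans (archi_boundP _) _; first by rewrite divr_ge0// exprn_ge0// ltW.
    by rewrite ltr_nat.
  rewrite ler_pdivrMr ?exprn_gt0// => h.
  rewrite expr2 -mulrA; apply: ler_peMr; [exact: ltW|lra].
move=> h.
rewrite -(ler_pM2l (_ : 0 < 2 * (K%:R * e))); last by rewrite mulr_gt0.
clear - h hK; move: (K%:R : R) h hK => k.
have -> : (k * e) ^+ 2 = k ^+ 2 * e ^+ 2 by ring.
have -> : e ^+ 2 / 2 * k ^+ 2 = k ^+ 2 * e ^+ 2 / 2 by ring.
have -> : k ^+ 2 * (e ^+ 2 / 2) = k ^+ 2 * e ^+ 2 / 2 by ring.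
have -> : 2 * (k * e) * (e * k) = 2 * (k ^+ 2 * e ^+ 2) by ring.
move: (k ^+ 2 * e ^+ 2) => ee; lra.
Unshelve. all: by end_near. Qed.

End WeakMixingCriterion.

(** * Averages over the torus *)

Section TorusCoordinates.
Context {R : realType}.
Implicit Types (x y z : R * R) (p : torus R).

Definition fracp (a : R) : R := a - (Num.floor a)%:~R.

Lemma fracp_itv a : 0 <= fracp a < 1.
Proof.
have /andP[h1 h2] := floor_itv a; rewrite /fracp subr_ge0 h1/=.
by rewrite ltrBlDl -[X in _ + X]mulr1z -intrD.
Qed.

Lemma fracp_id a : 0 <= a < 1 -> fracp a = a.
Proof. by move=> h; rewrite /fracp (@floor_def _ _ 0) ?subr0. Qed.

Lemma fracpDz a (k : int) : fracp (a + k%:~R) = fracp a.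
Proof. by rewrite /fracp floorDrz ?rpred_int// intrKfloor intrD; ring. Qed.

Lemma measurable_fracp : measurable_fun setT fracp.
Proof.
apply: measurable_funB; first exact: measurable_id.
by apply: nondecreasing_measurable => // a b ab; rewrite ler_int le_floor.
Qed.

Definition fracp2 x : R * R := (fracp x.1, fracp x.2).

Definition tcoord p : R * R := fracp2 (repr p).

Lemma torusPi_fracp2 x : torusPi (fracp2 x) = torusPi x.
Proof.
apply/torusPiP; exists (- Num.floor x.1), (- Num.floor x.2).
by rewrite /fracp2 /fracp !mulrNz.
Qed.

Lemma tcoordK p : torusPi (tcoord p) = p.
Proof. by rewrite /tcoord torusPi_fracp2 /torusPi reprK. Qed.

Lemma tcoord_pi x : tcoord (torusPi x) = fracp2 x.
Proof.
have /torusPiP[k [l E]] : torusPi (repr (torusPi x)) = torusPi x by rewrite {1}/torusPi reprK.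
by rewrite /tcoord E /fracp2 /= !fracpDz.
Qed.

Lemma tcoord_square p : unitSquare (tcoord p).
Proof. by rewrite /unitSquare /tcoord; split; rewrite /= in_itv/= fracp_itv. Qed.

Lemma measurable_fracp2 : measurable_fun setT fracp2.
Proof.
by apply: measurable_fun_pair; apply: measurableT_comp => //; exact: measurable_fracp.
Qed.

Lemma measurable_tcoord : measurable_fun setT tcoord.
Proof.
move=> _ B mB; rewrite setTI.
rewrite /measurable/= /torusMeasurable /image_set_system /= setTI.
have -> : @torusPi R @^-1` (tcoord @^-1` B) = fracp2 @^-1` B.
  by apply/funext => x; rewrite /preimage/= tcoord_pi.
by rewrite -[X in measurable X]setTI; exact: measurable_fracp2.
Qed.

Lemma measurable_torusE (A : set (torus R)) : measurable A ->
  measurable (@torusPi R @^-1` A).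
Proof. by move=> mA; rewrite -[X in measurable X]setTI; exact: measurable_torusPi. Qed.

Lemma measurable_to_torus d (T : measurableType d) (f : T -> torus R) :
  measurable_fun setT (tcoord \o f) -> measurable_fun setT f.
Proof.
move=> mf _ A mA; have := mf measurableT _ (measurable_torusE mA).
rewrite !setTI; congr measurable; apply/funext => t.
by rewrite /preimage/= tcoordK.
Qed.

Lemma torusMeasure_tcoord (E : set (R * R)) : measurable E ->
  @torusMeasure R (tcoord @^-1` E) =
  (lebesgue_measure \x lebesgue_measure)%E (E `&` @unitSquare R).
Proof.
move=> mE; rewrite /torusMeasure /pushforward /mrestr; congr (_ _).
apply/seteqP; split=> x [h1 h2]; split => //; move: h1; rewrite /preimage/= tcoord_pi.
  by case: h2; rewrite /= !in_itv/= => a b; rewrite /fracp2 !fracp_id//; case: x {a b}.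
by case: h2; rewrite /= !in_itv/= => a b; rewrite /fracp2 !fracp_id//; case: x {a b}.
Qed.

Definition gridCell (n i j : nat) : set (R * R) :=
  `[i%:R / n%:R, i.+1%:R / n%:R[%classic `*` `[j%:R / n%:R, j.+1%:R / n%:R[%classic.

Lemma measurable_gridCell n i j : measurable (gridCell n i j).
Proof. by apply: measurableX; exact: measurable_itv. Qed.

Lemma gridCell_measure n i j : (i < n)%N -> (j < n)%N ->
  fine (@torusMeasure R (tcoord @^-1` gridCell n i j)) = (n%:R^-1) ^+ 2.
Proof.
move=> ilt jlt; have n0 : 0 < n%:R :> R by rewrite ltr0n (leq_ltn_trans _ ilt).
rewrite torusMeasure_tcoord; last exact: measurable_gridCell.
have -> : gridCell n i j `&` @unitSquare R = gridCell n i j.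
  apply/setIidPl => x [/=]; rewrite !in_itv/= => /andP[a1 a2] /andP[b1 b2].
  have sub k (c : R) : (k < n)%N -> k%:R / n%:R <= c -> c < k.+1%:R / n%:R -> 0 <= c < 1.
    move=> kn h1 h2; rewrite (le_trans _ h1) ?divr_ge0 ?ler0n//=.
    by rewrite (lt_le_trans h2)// ler_pdivrMr// mul1r ler_nat.
  by split => /=; rewrite in_itv/=; [exact: (sub i)|exact: (sub j)].
rewrite product_measure1E; [|exact: measurable_itv..].
have mI k : (@lebesgue_measure R) `[k%:R / n%:R, k.+1%:R / n%:R[%classic = (n%:R^-1)%:E.
  rewrite lebesgue_measure_itv /= lte_fin ltr_pM2r ?invr_gt0// ltr_nat ltnSn.
  by rewrite -EFinB -mulrBl -natr1 addrAC subrr add0r mul1r.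
transitivity (fine ((n%:R^-1 : R)%:E * (n%:R^-1)%:E)%E); last by rewrite expr2.
by congr (fine (_ * _)%E); exact: mI.
Qed.

Definition periodic2 (W : R * R -> R) := forall x (k l : int), W (x.1 + k%:~R, x.2 + l%:~R) = W x.

Definition lip2 (W : R * R -> R) (L : R) := forall x y, `|W x - W y| <= L * `|x - y|.

Definition gridStep (n : nat) (W : R * R -> R) : torus R -> R :=
  fun p => \sum_(i < n) \sum_(j < n)
    W (i%:R / n%:R, j%:R / n%:R) * \1_(tcoord @^-1` gridCell n i j) p.

Lemma bmeas_gridStep n W : bmeas (gridStep n W).
Proof.
apply: bmeas_sum => i; apply: bmeas_sum => j; apply: bmeasZ; apply: bmeas_indic.
by rewrite -[X in measurable X]setTI; apply: measurable_tcoord => //; exact: measurable_gridCell.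
Qed.

Lemma lip2_ge0 W L : lip2 W L -> 0 <= L.
Proof.
move=> /(_ (1, 0) (0, 0)); rewrite /= => h; have := le_trans (normr_ge0 _) h.
by rewrite normr_pair /= subr0 subrr normr1 normr0 max_l// mulr1.
Qed.

Lemma cell_index (n : nat) (a : R) : (0 < n)%N -> 0 <= a < 1 ->
  exists2 i : 'I_n, i%:R / n%:R <= a < i.+1%:R / n%:R &
    forall k : nat, k%:R / n%:R <= a < k.+1%:R / n%:R -> k = i.
Proof.
move=> n0 /andP[a0 a1]; have n0' : 0 < n%:R :> R by rewrite ltr0n.
have uq (k l : nat) : k%:R / n%:R <= a < k.+1%:R / n%:R -> l%:R / n%:R <= a < l.+1%:R / n%:R -> k = l.
  move=> /andP[h1 h2] /andP[h3 h4]; apply/eqP; rewrite eqn_leq.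
  have := le_lt_trans h1 h4; rewrite ltr_pM2r ?invr_gt0// ltr_nat ltnS => ->.
  by have := le_lt_trans h3 h2; rewrite ltr_pM2r ?invr_gt0// ltr_nat ltnS => ->.
pose i := Num.truncn (n%:R * a).
have na0 : 0 <= n%:R * a by rewrite mulr_ge0.
have /andP[i1 i2] := truncn_itv na0.
have ia : i%:R / n%:R <= a < i.+1%:R / n%:R.
  by rewrite ler_pdivrMr// mulrC i1 ltr_pdivlMr// mulrC i2.
have iln : (i < n)%N.
  by rewrite -(ltr_nat R) (le_lt_trans i1)// -[ltRHS]mulr1 ltr_pM2l.
by exists (Ordinal iln) => // k hk; exact: uq hk ia.
Qed.

Lemma gridStep_near n W L p : (0 < n)%N -> lip2 W L ->
  `|W (tcoord p) - gridStep n W p| <= L / n%:R.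
Proof.
move=> n0 lW; have n0' : 0 < n%:R :> R by rewrite ltr0n.
have [/=] := tcoord_square p; rewrite !in_itv /= => x1 x2.
have [i hi ui] := cell_index n0 x1; have [j hj uj] := cell_index n0 x2.
have -> : gridStep n W p = W (i%:R / n%:R, j%:R / n%:R).
  have ind (k l : 'I_n) : \1_(tcoord @^-1` gridCell n k l) p = ((k == i) && (l == j))%:R :> R.
    rewrite indicE; congr (nat_of_bool _)%:R; apply/idP/andP.
      rewrite inE /gridCell /preimage /= !in_itv /= => -[/ui h1 /uj h2].
      by split; apply/eqP/val_inj.
    by move=> [/eqP -> /eqP ->]; rewrite inE /gridCell /preimage/= !in_itv.
  rewrite /gridStep (bigD1 i)//= [X in _ + X]big1 ?addr0.
    rewrite (bigD1 j)//= big1 ?addr0.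
      by rewrite ind !eqxx mulr1.
    by move=> l lj; rewrite ind (negbTE lj) andbF mulr0.
  by move=> k ki; rewrite big1// => l _; rewrite ind (negbTE ki) mulr0.
apply: le_trans (lW _ _) _; rewrite ler_wpM2l ?(lip2_ge0 lW)//.
have cl (a : R) (k : nat) : k%:R / n%:R <= a < k.+1%:R / n%:R -> `|a - k%:R / n%:R| <= n%:R^-1.
  move=> /andP[h1 h2]; rewrite ger0_norm ?subr_ge0// lerBlDl ltW//.
  by rewrite (lt_le_trans h2)// -natr1 mulrDl mul1r.
by rewrite normr_pair_le /= !cl.
Qed.

Lemma bmeas_lip2 W L : lip2 W L -> bmeas (W \o tcoord).
Proof.
move=> lW; split.
  apply: (@measurable_fun_cvg _ _ _ _ (fun n => gridStep n.+1 W)).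
    by move=> m; have [] := bmeas_gridStep m.+1 W.
  move=> p _; apply/cvgrPdist_le => e e0.
  exists (Num.bound (L / e)) => // n /= Nn.
  apply: le_trans (gridStep_near p _ lW) _ => //.
  rewrite ler_pdivrMr// mulrC -ler_pdivrMr//.
  apply: ltW; apply: lt_le_trans (archi_boundP _) _; first by rewrite divr_ge0 ?(lip2_ge0 lW)// ltW.
  by rewrite ler_nat; exact: leqW.
exists (`|W 0| + L) => p /=.
rewrite -[W (tcoord p)](subrK (W 0)) addrC (le_trans (ler_normD _ _))// lerD2l.
apply: le_trans (lW _ _) _; rewrite subr0 ler_piMr ?(lip2_ge0 lW)//.
have [/=] := tcoord_square p; rewrite !in_itv /= => /andP[a0 a1] /andP[b0 b1].
by rewrite normr_pair_le !ger0_norm// !ltW.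
Qed.

(* The torus average of a [Z^2]-periodic function of the plane. *)
Definition tE (W : R * R -> R) : R := mean (@torusMeasure R) (W \o tcoord).

(** Each invariance of [tE] is first proved for these Riemann sums up to [O (1 / n)]; letting [n]
    grow gives the exact identity. *)
Definition gridE (n : nat) (W : R * R -> R) : R :=
  (n%:R^-1) ^+ 2 * \sum_(i < n) \sum_(j < n) W (i%:R / n%:R, j%:R / n%:R).

Lemma mean_gridStep n W : mean (@torusMeasure R) (gridStep n W) = gridE n W.
Proof.
rewrite mean_sum; last first.
  move=> i; apply: bmeas_sum => j; apply: bmeasZ; apply: bmeas_indic.
  by rewrite -[X in measurable X]setTI; apply: measurable_tcoord => //; exact: measurable_gridCell.
rewrite /gridE mulr_sumr; apply: eq_bigr => i _.
have mc (j : 'I_n) : measurable (tcoord @^-1` gridCell n i j).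
  by rewrite -[X in measurable X]setTI; apply: measurable_tcoord => //; exact: measurable_gridCell.
rewrite mean_sum; last by move=> j; apply/bmeasZ/bmeas_indic.
rewrite mulr_sumr; apply: eq_bigr => j _.
rewrite (meanZ _ (W _) (bmeas_indic (mc j))) mulrC; congr (_ * _).
by rewrite -(@gridCell_measure n i j)//; exact: mean_indic.
Qed.

Lemma torus_mean1 (c : R) : mean (@torusMeasure R) (cst c) = c.
Proof. exact: mean1. Qed.

Lemma torus_mean_le f (M : R) : bmeas f -> (forall p, `|f p| <= M) -> `|mean (@torusMeasure R) f| <= M.
Proof.
move=> hf fM; rewrite -[leRHS]torus_mean1; apply: le_trans (mean_norm _ hf) _.
by apply: mean_le => //; [exact: bmeas_norm|exact: bmeas_cst].
Qed.

Lemma tE_grid n W L : (0 < n)%N -> lip2 W L -> `|tE W - gridE n W| <= L / n%:R.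
Proof.
move=> n0 lW; have bW := bmeas_lip2 lW.
rewrite -mean_gridStep /tE -meanB//; last exact: bmeas_gridStep.
apply: torus_mean_le; first by apply: bmeasB => //; exact: bmeas_gridStep.
by move=> p; exact: gridStep_near.
Qed.

Lemma tE_cst (c : R) : tE (cst c) = c.
Proof. exact: torus_mean1. Qed.

Lemma tED V W L L' : lip2 V L -> lip2 W L' -> tE (V \+ W) = tE V + tE W.
Proof. by move=> lV lW; apply: meanD; [exact: bmeas_lip2 lV|exact: bmeas_lip2 lW]. Qed.

Lemma tEB V W L L' : lip2 V L -> lip2 W L' -> tE (V \- W) = tE V - tE W.
Proof. by move=> lV lW; apply: meanB; [exact: bmeas_lip2 lV|exact: bmeas_lip2 lW]. Qed.

Lemma tEZ c W L : lip2 W L -> tE (fun x => c * W x) = c * tE W.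
Proof. by move=> lW; apply: (meanZ _ c (bmeas_lip2 lW)). Qed.

Lemma tE_sum (I : Type) (s : seq I) (F : I -> R * R -> R) (L : I -> R) :
  (forall i, lip2 (F i) (L i)) -> tE (fun x => \sum_(i <- s) F i x) = \sum_(i <- s) tE (F i).
Proof. by move=> lF; apply: (mean_sum _ s (F := fun i => F i \o tcoord)) => i; exact: bmeas_lip2 (lF i). Qed.

Lemma tE_bound W L M : lip2 W L -> (forall x, `|W x| <= M) -> `|tE W| <= M.
Proof. by move=> lW WM; apply: torus_mean_le => [|p]; [exact: bmeas_lip2 lW|exact: WM]. Qed.

Lemma tE_le V W L L' : lip2 V L -> lip2 W L' -> (forall x, V x <= W x) -> tE V <= tE W.
Proof.
by move=> lV lW VW; apply: mean_le => [||p]; [exact: bmeas_lip2 lV|exact: bmeas_lip2 lW|exact: VW].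
Qed.

Lemma eq_tE V W : V =1 W -> tE V = tE W.
Proof. by move/funext ->. Qed.

Lemma eq_of_grid_close (a b C : R) : (forall n, (0 < n)%N -> `|a - b| <= C / n%:R) -> a = b.
Proof.
move=> H; apply/eqP; rewrite -subr_eq0 -normr_eq0; apply/negPn/negP => ab0.
have abp : 0 < `|a - b| by rewrite lt_neqAle eq_sym ab0 normr_ge0.
pose n := (Num.bound (`|C| / `|a - b|)).+1.
have := H n (ltn0Sn _); apply/negP; rewrite -ltNge ltr_pdivrMr ?ltr0n//.
rewrite mulrC -ltr_pdivrMr// (le_lt_trans (ler_wpM2r _ (ler_norm C)))//.
apply: lt_trans (archi_boundP _) _; first by rewrite divr_ge0.
by rewrite ltr_nat.
Qed.

Lemma sum_shift1 (n : nat) (g : int -> R) : (forall i, g (i + n%:Z) = g i) ->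
  \sum_(i < n) g (i%:Z + 1) = \sum_(i < n) g i%:Z.
Proof.
case: n => [|n] gn; first by rewrite !big_ord0.
rewrite big_ord_recr big_ord_recl /= addrC; congr (_ + _).
  by rewrite -[RHS]gn add0r -PoszD addn1.
by apply: eq_bigr => i _; rewrite /bump /= add1n -addn1 PoszD.
Qed.

Lemma sum_shift (n : nat) (g : int -> R) (k : int) : (forall i, g (i + n%:Z) = g i) ->
  \sum_(i < n) g (i%:Z + k) = \sum_(i < n) g i%:Z.
Proof.
move=> gn.
have P (m : nat) (f : int -> R) : (forall i, f (i + n%:Z) = f i) ->
    \sum_(i < n) f (i%:Z + m%:Z) = \sum_(i < n) f i%:Z.
  move=> fn; elim: m => [|m IH]; first by apply: eq_bigr => i _; rewrite addr0.
  rewrite -IH -[RHS](@sum_shift1 n (fun i => f (i + m%:Z))).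
    by apply: eq_bigr => i _; rewrite -addn1 PoszD addrAC addrA.
  by move=> i; rewrite addrAC fn.
case: k => m; first exact: P.
rewrite NegzE -(P m.+1 (fun i => g (i - m.+1%:Z))); last by move=> i; rewrite addrAC gn.
by apply: eq_bigr => i _; rewrite addrK.
Qed.

(** On one row of the grid the shear is a translation. Rounding its length down to a multiple of
    [1 / n] costs [L / n], and the rounded translation permutes the row by periodicity. No
    regularity of [a] enters. *)
Lemma gridE_shear1 n (a : R -> R) W L : (0 < n)%N -> periodic2 W -> lip2 W L ->
  `|gridE n (fun x => W (x.1 + a x.2, x.2)) - gridE n W| <= L / n%:R.
Proof.
move=> n0 pW lW; have n0' : 0 < n%:R :> R by rewrite ltr0n.
rewrite /gridE -mulrBr [X in X - _]exchange_big [X in _ - X]exchange_big /= -sumrB.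
rewrite normrM ger0_norm ?exprn_ge0 ?invr_ge0//.
suff H (j : 'I_n) : `|\sum_(i < n) W (i%:R / n%:R + a (j%:R / n%:R), j%:R / n%:R) -
    \sum_(i < n) W (i%:R / n%:R, j%:R / n%:R)| <= L.
  apply: (@le_trans _ _ ((n%:R^-1) ^+ 2 * (\sum_(j < n) L))).
    by rewrite ler_wpM2l ?exprn_ge0 ?invr_ge0// (le_trans (ler_norm_sum _ _ _))// ler_sum.
  rewrite sumr_const card_ord -mulr_natr expr2 le_eqVlt; apply/orP; left; apply/eqP.
  by field; rewrite gt_eqF.
pose aj := a (j%:R / n%:R); pose k := Num.floor (n%:R * aj).
pose g (i : int) := W (i%:~R / n%:R, j%:R / n%:R).
have gn i : g (i + n%:Z) = g i.
  rewrite /g -[RHS](pW _ 1 0) /= addr0 intrD mulrDl divff ?gt_eqF//.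
have -> : \sum_(i < n) W (i%:R / n%:R, j%:R / n%:R) = \sum_(i < n) g (i%:Z + k).
  by rewrite sum_shift.
rewrite -sumrB (le_trans (ler_norm_sum _ _ _))//.
apply: (@le_trans _ _ (\sum_(i < n) L / n%:R)).
  apply: ler_sum => i _; apply: le_trans (lW _ _) _.
  rewrite ler_wpM2l ?(lip2_ge0 lW)// normr_pair_le /= subrr normr0 invr_ge0 ler0n andbT.
  rewrite intrD mulrDl opprD addrACA subrr add0r.
  have /andP[k1 k2] := floor_itv (n%:R * aj).
  have -> : aj - k%:~R / n%:R = (n%:R * aj - k%:~R) / n%:R by field; rewrite gt_eqF.
  rewrite normrM normfV (@ger0_norm _ n%:R)// ger0_norm ?subr_ge0//.
  by rewrite ler_pdivrMr// mulVf ?gt_eqF// lerBlDl ltW//; move: k2; rewrite intrD.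
by rewrite sumr_const card_ord -[L / _ *+ _]mulr_natr divfK ?gt_eqF.
Qed.

Definition swap2 (W : R * R -> R) : R * R -> R := fun x => W (x.2, x.1).

Lemma gridE_swap n W : gridE n (swap2 W) = gridE n W.
Proof. by rewrite /gridE exchange_big. Qed.

Lemma lip2_swap W L : lip2 W L -> lip2 (swap2 W) L.
Proof.
move=> lW x y; apply: le_trans (lW _ _) _.
by rewrite ler_wpM2l ?(lip2_ge0 lW)// !normr_pair /= maxC.
Qed.

Lemma tE_swap W L : lip2 W L -> tE (swap2 W) = tE W.
Proof.
move=> lW; apply: (@eq_of_grid_close _ _ (2 * L)) => n n0.
have h1 := tE_grid n0 lW; have := tE_grid n0 (lip2_swap lW); rewrite gridE_swap => h2.
rewrite -(subrKA (gridE n W)) (le_trans (ler_normD _ _))//.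
by rewrite mulrDl mul1r mulrDl lerD// distrC.
Qed.

Lemma tE_shear1 (a : R -> R) W L L' : periodic2 W -> lip2 W L ->
  lip2 (fun x => W (x.1 + a x.2, x.2)) L' -> tE (fun x => W (x.1 + a x.2, x.2)) = tE W.
Proof.
move=> pW lW lW'; apply: (@eq_of_grid_close _ _ (L' + (L + L))) => n n0.
have h1 := tE_grid n0 lW; have h2 := tE_grid n0 lW'.
have h3 := gridE_shear1 a n0 pW lW.
move: h1 h2 h3; set A := tE _; set B := tE _; set C := gridE _ _; set D := gridE _ _.
move=> h1 h2 h3.
have -> : B - A = (B - D) + ((D - C) + (C - A)) by ring.
rewrite (le_trans (ler_normD _ _))// !mulrDl lerD// (le_trans (ler_normD _ _))// lerD//.
by rewrite distrC.
Qed.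

Lemma periodic2_swap W : periodic2 W -> periodic2 (swap2 W).
Proof. by move=> pW x k l; rewrite /swap2 /= (pW (x.2, x.1) l k). Qed.

Lemma tE_shear2 (a : R -> R) W L L' : periodic2 W -> lip2 W L ->
  lip2 (fun x => W (x.1, x.2 + a x.1)) L' -> tE (fun x => W (x.1, x.2 + a x.1)) = tE W.
Proof.
move=> pW lW lW'; rewrite -(tE_swap lW) -(tE_swap lW').
exact: (tE_shear1 (periodic2_swap pW) (lip2_swap lW) (lip2_swap lW')).
Qed.

Lemma lip2_comp W L (f : R * R -> R * R) (M : R) : lip2 W L ->
  (forall x y, `|f x - f y| <= M * `|x - y|) -> lip2 (W \o f) (L * M).
Proof.
move=> lW lf x y; apply: le_trans (lW _ _) _.
by rewrite -mulrA ler_wpM2l ?(lip2_ge0 lW).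
Qed.

Lemma lip2_trans W L (a : R * R) : lip2 W L -> lip2 (fun x => W (x + a)) L.
Proof. by move=> lW x y; apply: le_trans (lW _ _) _; rewrite opprD addrACA subrr addr0. Qed.

Lemma tE_trans W L (a : R * R) : periodic2 W -> lip2 W L -> tE (fun x => W (x + a)) = tE W.
Proof.
move=> pW lW; have l1 : lip2 (fun x => W (x.1 + a.1, x.2)) L.
  move=> x y; apply: le_trans (lW _ _) _.
  rewrite ler_wpM2l ?(lip2_ge0 lW)// normr_pair_le /= opprD addrACA subrr addr0.
  by rewrite (normr_fst_le (x - y)) (normr_snd_le (x - y)).
rewrite -(tE_shear1 (a := fun=> a.1) pW lW l1).
have p1 : periodic2 (fun x => W (x.1 + a.1, x.2)).
  by move=> x k l /=; rewrite -(pW (x.1 + a.1, x.2) k l) /= addrAC.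
have l2 : lip2 (fun x => W (x.1 + a.1, x.2 + a.2)) L.
  by move=> x y; have := lip2_trans a lW x y.
by rewrite -(tE_shear2 (a := fun=> a.2) p1 l1 l2).
Qed.

End TorusCoordinates.

(** * Equidistribution of fast oscillations *)

Section OneVariable.
Context {R : realType}.

Definition lip1 (f : R -> R) (L : R) := forall a b, `|f a - f b| <= L * `|a - b|.

Lemma lip1_ge0 f L : lip1 f L -> 0 <= L.
Proof. by move=> /(_ 1 0) h; have := le_trans (normr_ge0 _) h; rewrite subr0 normr1 mulr1. Qed.

Lemma lip1_fst f L : lip1 f L -> lip2 (fun x : R * R => f x.1) L.
Proof.
move=> lf x y; apply: le_trans (lf _ _) _.
by rewrite ler_wpM2l ?(lip1_ge0 lf)// (normr_fst_le (x - y)).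
Qed.

Lemma lip1_continuous f L : lip1 f L -> continuous f.
Proof.
move=> lf a; apply/cvgrPdist_le => e e0.
have L1 : 0 < L + 1 by rewrite ltr_wpDl// (lip1_ge0 lf).
have d0 : 0 < e / (L + 1) by rewrite divr_gt0.
near=> b; apply: le_trans (lf _ _) _.
have : `|a - b| <= e / (L + 1) by near: b; apply: (@cvgr_dist_le _ _ _ (nbhs a) _ id a).
rewrite ler_pdivlMr// => h; apply: le_trans h; rewrite mulrC ler_wpM2l//.
by rewrite lerDl.
Unshelve. all: by end_near. Qed.

(** The integral over the unit interval, written as a torus average so that the Riemann sum
    estimates carry over. *)
Definition average1 (f : R -> R) : R := tE (fun x => f x.1).

Lemma gridE_fst n (f : R -> R) : (0 < n)%N ->
  gridE n (fun x => f x.1) = n%:R^-1 * \sum_(i < n) f (i%:R / n%:R).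
Proof.
move=> n0; have n0' : n%:R != 0 :> R by rewrite pnatr_eq0 -lt0n.
rewrite /gridE !mulr_sumr; apply: eq_bigr => i _ /=.
by rewrite sumr_const card_ord -[f _ *+ _]mulr_natr; field.
Qed.

Lemma average1_grid f L n : (0 < n)%N -> lip1 f L ->
  `|average1 f - n%:R^-1 * \sum_(i < n) f (i%:R / n%:R)| <= L / n%:R.
Proof.
by move=> n0 lf; rewrite -gridE_fst//; apply: tE_grid => //; exact: lip1_fst.
Qed.

(** On each cell the mean value theorem turns the increment of [F] into a value of [f], so the
    telescoping sum of increments is a Riemann sum of [f] up to [L / n]. *)
Lemma average1_derive (F f : R -> R) L : lip1 f L ->
  (forall x : R, is_derive x (1 : R) F (f x)) -> average1 f = F 1 - F 0.
Proof.
move=> lf dF; apply: (@eq_of_grid_close _ _ _ (L + L)) => n n0.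
have n0' : 0 < n%:R :> R by rewrite ltr0n.
have h1 := average1_grid n0 lf.
rewrite -(subrKA (n%:R^-1 * \sum_(i < n) f (i%:R / n%:R))) (le_trans (ler_normD _ _))//.
rewrite mulrDl lerD// distrC.
have -> : F 1 - F 0 = \sum_(i < n) (F (i.+1%:R / n%:R) - F (i%:R / n%:R)).
  rewrite -(big_mkord xpredT (fun i => F (i.+1%:R / n%:R) - F (i%:R / n%:R))).
  by rewrite telescope_sumr// divff ?gt_eqF// mul0r.
rewrite mulr_sumr -sumrB (le_trans (ler_norm_sum _ _ _))//.
apply: (@le_trans _ _ (\sum_(i < n) (n%:R^-1 * (L / n%:R)))); last first.
  rewrite sumr_const card_ord -[_ *+ _]mulr_natr mulrAC mulVf ?gt_eqF// mul1r//.
apply: ler_sum => i _.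
have lt : i%:R / n%:R <= i.+1%:R / n%:R :> R by rewrite ler_pM2r ?invr_gt0// ler_nat.
have [||c] := @MVT_segment R F f (i%:R / n%:R) (i.+1%:R / n%:R).
- exact: lt.
- apply: continuous_subspaceT => t.
  by apply: differentiable_continuous; apply/derivable1_diffP; have [] := dF t.
rewrite in_itv /= => /andP[c1 c2] ->.
have -> : i.+1%:R / n%:R - i%:R / n%:R = n%:R^-1 :> R by rewrite -mulrBl -natr1 addrAC subrr add0r mul1r.
rewrite [X in _ - X]mulrC -mulrBl normrM (@ger0_norm _ n%:R^-1) ?invr_ge0 ?ler0n//.
rewrite [leRHS]mulrC ler_wpM2r ?invr_ge0 ?ler0n//.
apply: le_trans (lf _ _) _; rewrite ler_wpM2l ?(lip1_ge0 lf)//.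
rewrite ger0_norm ?subr_ge0// lerBlDl (le_trans c2)//.
by rewrite -natr1 mulrDl mul1r.
Qed.

Lemma continuous_antiderivative_itv (k : R -> R) (B : R) : continuous k -> 0 < B ->
  exists2 Q : R -> R, Q 0 = 0 & forall x : R, `|x| < B -> is_derive x (1 : R) Q (k x).
Proof.
move=> ck B0.
pose Q0 x := (\int[lebesgue_measure]_(t in `[-B, x]) k t)%R.
exists (fun x => Q0 x - Q0 0); first by rewrite subrr.
move=> x /ltr_normlP[]; rewrite ltrNl => Bx xB.
have intk : lebesgue_measure.-integrable `[-B, B] (EFin \o k).
  apply: continuous_compact_integrable; first exact: segment_compact.
  exact: continuous_subspaceT.
have [dQ dQE] := @continuous_FTC1 R k (BLeft (-B)) x B xB intk Bx (ck x).
have : is_derive x (1 : R) Q0 (k x).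
  by apply: DeriveDef => //; rewrite -derive1E.
move=> h; rewrite -[k x]subr0.
by apply: is_deriveB.
Qed.

Lemma is_derive_continuous (F f : R -> R) : (forall x : R, is_derive x (1 : R) F (f x)) -> continuous F.
Proof.
by move=> dF t; apply: differentiable_continuous; apply/derivable1_diffP; have [] := dF t.
Qed.

(** Antiderivatives that vanish at 0 on growing symmetric intervals agree on their common domain, so
    they glue together. *)
Lemma continuous_antiderivative (k : R -> R) : continuous k ->
  exists2 Q : R -> R, Q 0 = 0 & forall x : R, is_derive x (1 : R) Q (k x).
Proof.
move=> ck.
have /choice[Q HQ] : forall n : nat, exists Q : R -> R, Q 0 = 0 /\ forall x : R, `|x| < n.+1%:R -> is_derive x (1 : R) Q (k x).
  move=> n; have [|Q Q0 dQ] := @continuous_antiderivative_itv k n.+1%:R ck; first by rewrite ltr0n.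
  by exists Q.
have uniq_Q m n x : `|x| < m.+1%:R -> `|x| < n.+1%:R -> Q m x = Q n x.
  move=> xm xn.
  pose D y := Q m y - Q n y.
  have dD y : `|y| <= `|x| -> is_derive y (1 : R) D 0.
    move=> yx; rewrite -(subrr (k y)).
    have h1 := (HQ m).2 y (le_lt_trans yx xm); have h2 := (HQ n).2 y (le_lt_trans yx xn).
    exact: is_deriveB.
  have D0 : D 0 = 0 by rewrite /D (HQ m).1 (HQ n).1 subrr.
  suff : D x = D 0 by rewrite D0 => /eqP; rewrite subr_eq0 => /eqP.
  have cD y : `|y| <= `|x| -> {for y, continuous D}.
    move=> yx; apply: differentiable_continuous; apply/derivable1_diffP.
    by have [] := dD y yx.
  have [x0|x0] := leP 0 x.
    have hin y : y \in `[0, x]%R -> `|y| <= `|x|.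
      by rewrite in_itv/= => /andP[y0 yx]; rewrite !ger0_norm.
    have [||c _] := @MVT_segment R D (cst 0) 0 x x0.
    + by move=> y yi; apply: dD; apply: hin; rewrite in_itv/= !ltW ?(itvP yi).
    + apply: continuous_in_subspaceT => y /set_mem /= yi; exact/cD/hin.
    by rewrite mul0r => /eqP; rewrite subr_eq0 => /eqP.
  have hin y : y \in `[x, 0]%R -> `|y| <= `|x|.
    by rewrite in_itv/= => /andP[y0 yx]; rewrite !ler0_norm ?lerN2// ltW.
  have [||c _] := @MVT_segment R D (cst 0) x 0 (ltW x0).
  + by move=> y yi; apply: dD; apply: hin; rewrite in_itv/= !ltW ?(itvP yi).
  + apply: continuous_in_subspaceT => y /set_mem /= yi; exact/cD/hin.
  by rewrite mul0r => /eqP; rewrite subr_eq0 => /eqP.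
pose N (x : R) := Num.bound `|x|.
have NP (x : R) : `|x| < (N x)%:R by exact: archi_boundP.
have NP1 (x : R) : `|x| < (N x).+1%:R by rewrite (lt_trans (NP x))// ltr_nat.
exists (fun x => Q (N x) x); first by rewrite (HQ _).1.
(* One more than needed at [x] itself, so that the unit ball around [x] stays inside the domain of
   [Q m]. *)
move=> x; pose m := (N x).+1.
have hx : `|x| < m.+1%:R by rewrite (lt_trans (NP1 x))// ltr_nat.
apply: (@near_eq_is_derive _ _ _ (Q m)); last exact: (HQ m).2.
exists 1 => //= y; rewrite /ball/= => xy.
apply: uniq_Q; last exact: NP1.
have -> : y = x - (x - y) by ring.
rewrite (le_lt_trans (ler_normB _ _))// /m -natr1 ltrD//.
Qed.

End OneVariable.

Section Equidistribution.
Context {R : realType}.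

Definition bl1 (f : R -> R) := exists L M, lip1 f L /\ forall x, `|f x| <= M.

Lemma bl1_cst (c : R) : bl1 (cst c).
Proof. by exists 0, `|c|; split=> // a b; rewrite subrr normr0 mul0r. Qed.

Lemma bl1D f g : bl1 f -> bl1 g -> bl1 (f \+ g).
Proof.
move=> [L [M [lf bf]]] [L' [M' [lg bg]]]; exists (L + L'), (M + M'); split=> [a b|x].
  have -> : (f \+ g) a - (f \+ g) b = (f a - f b) + (g a - g b) by rewrite /=; ring.
  by rewrite (le_trans (ler_normD _ _))// mulrDl lerD.
by rewrite (le_trans (ler_normD _ _))// lerD.
Qed.

Lemma bl1M f g : bl1 f -> bl1 g -> bl1 (f \* g).
Proof.
move=> [L [M [lf bf]]] [L' [M' [lg bg]]]; exists (L * M' + M * L'), (M * M'); split=> [a b|x].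
  have -> : (f \* g) a - (f \* g) b = (f a - f b) * g a + f b * (g a - g b) by rewrite /=; ring.
  rewrite (le_trans (ler_normD _ _))// [leRHS]mulrDl lerD// normrM.
    by rewrite mulrAC ler_pM.
  by rewrite -mulrA ler_pM.
by rewrite normrM ler_pM.
Qed.

Lemma bl1Z (c : R) f : bl1 f -> bl1 (fun x => c * f x).
Proof. exact/bl1M/bl1_cst. Qed.

Lemma bl1X f n : bl1 f -> bl1 (fun x => f x ^+ n).
Proof.
move=> bf; elim: n => [|n IH].
  by rewrite (_ : (fun _ => _) = cst 1); [exact: bl1_cst|apply/funext => x; rewrite expr0].
rewrite (_ : (fun _ => _) = f \* (fun x => f x ^+ n)); first exact: bl1M.
by apply/funext => x; rewrite exprS.
Qed.

Lemma bl1B f g : bl1 f -> bl1 g -> bl1 (f \- g).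
Proof.
move=> bf bg; rewrite (_ : f \- g = f \+ (fun x => (-1) * g x)); first exact/bl1D/bl1Z.
by apply/funext => x /=; rewrite mulN1r.
Qed.

Lemma bl1_lip2 f : bl1 f -> exists L, lip2 (fun x : R * R => f x.1) L.
Proof. by move=> [L [_ [lf _]]]; exists L; exact: lip1_fst. Qed.

Lemma average1D f g : bl1 f -> bl1 g -> average1 (f \+ g) = average1 f + average1 g.
Proof. by move=> /bl1_lip2[L lf] /bl1_lip2[L' lg]; exact: tED lf lg. Qed.

Lemma average1B f g : bl1 f -> bl1 g -> average1 (f \- g) = average1 f - average1 g.
Proof. by move=> /bl1_lip2[L lf] /bl1_lip2[L' lg]; exact: tEB lf lg. Qed.

Lemma average1Z c f : bl1 f -> average1 (fun x => c * f x) = c * average1 f.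
Proof. by move=> /bl1_lip2[L lf]; exact: tEZ lf. Qed.

Lemma average1_cst (c : R) : average1 (cst c) = c.
Proof. exact: tE_cst. Qed.

Lemma average1_bound f M : bl1 f -> (forall x, `|f x| <= M) -> `|average1 f| <= M.
Proof. by move=> /bl1_lip2[L lf] fM; apply: (tE_bound lf). Qed.

Lemma average1_le f g : bl1 f -> bl1 g -> (forall x, f x <= g x) -> average1 f <= average1 g.
Proof. by move=> /bl1_lip2[L lf] /bl1_lip2[L' lg] fg; apply: (tE_le lf lg) => x; exact: fg. Qed.

Lemma average1_derive_periodic (F f : R -> R) : bl1 f ->
  (forall x : R, is_derive x (1 : R) F (f x)) -> F 1 = F 0 -> average1 f = 0.
Proof. by move=> [L [_ [lf _]]] dF FE; rewrite (average1_derive lf dF) FE subrr. Qed.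

Lemma lip1_derive (F f : R -> R) (C : R) : (forall x : R, is_derive x (1 : R) F (f x)) ->
  (forall x, `|f x| <= C) -> lip1 F C.
Proof.
move=> dF fC a b; wlog ab : a b / a <= b.
  move=> H; have [ab|/ltW ba] := leP a b; first exact: H.
  by rewrite distrC [`|a - b|]distrC H.
have [||c _] := @MVT_segment R F f a b.
- exact: ab.
- by apply: continuous_subspaceT; exact: is_derive_continuous dF.
by rewrite distrC => ->; rewrite normrM [`|b - a|]distrC ler_wpM2r.
Qed.

Variables (q : nat) (th : R).
Hypothesis q_gt0 : (0 < q)%N.

Local Notation om := (2 * pi * q%:R : R).
Local Notation sn := (fun u : R => sin (om * u + th)).
Local Notation cn := (fun u : R => cos (om * u + th)).

Lemma is_derive_sn (u : R) : is_derive u (1 : R) sn (om * cn u).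
Proof.
have h : is_derive u (1 : R) (fun u : R => om * u + th) om.
  by apply: is_derive_eq; rewrite addr0 [LHS]mulr1.
have := @is_derive1_comp R (@sin R) (fun u : R => om * u + th) u _ _ (is_derive_sin _) h.
by move=> h'; apply: (is_derive_eq h'); rewrite mulrC.
Qed.

Lemma is_derive_cn (u : R) : is_derive u (1 : R) cn (- (om * sn u)).
Proof.
have h : is_derive u (1 : R) (fun u : R => om * u + th) om.
  by apply: is_derive_eq; rewrite addr0 [LHS]mulr1.
have := @is_derive1_comp R (@cos R) (fun u : R => om * u + th) u _ _ (is_derive_cos _) h.
by move=> h'; apply: (is_derive_eq h'); rewrite mulNr mulrC.
Qed.

Lemma om_gt0 : 0 < om.
Proof. by rewrite !mulr_gt0// ?pi_gt0// ltr0n. Qed.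

Lemma bl1_sn : bl1 sn.
Proof.
exists om, 1; split; last by move=> x; exact: sin_max.
apply: (lip1_derive is_derive_sn) => x.
by rewrite normrM (ger0_norm (ltW om_gt0)) ler_piMr ?cos_max// ltW// om_gt0.
Qed.

Lemma bl1_cn : bl1 cn.
Proof.
exists om, 1; split; last by move=> x; exact: cos_max.
apply: (lip1_derive is_derive_cn) => x.
by rewrite normrN normrM (ger0_norm (ltW om_gt0)) ler_piMr ?sin_max// ltW// om_gt0.
Qed.

Lemma sn_periodic1 : sn 1 = sn 0.
Proof. by rewrite /= mulr1 mulr0 add0r addrC sinD2npi. Qed.

Lemma cosD2npi (x : R) (n : nat) : cos (x + 2 * pi * n%:R) = cos x.
Proof.
have -> : 2 * pi * n%:R = pi *+ 2 *+ n :> R by rewrite -[RHS]mulr_natr mulr_natl.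
by rewrite (periodicn (@cosD2pi R)).
Qed.

Lemma cn_periodic1 : cn 1 = cn 0.
Proof. by rewrite /= mulr1 mulr0 add0r addrC cosD2npi. Qed.

Lemma is_derive_prod (f g : R -> R) (df dg : R) (x : R) :
  is_derive x (1 : R) f df -> is_derive x (1 : R) g dg ->
  is_derive x (1 : R) (f \* g) (df * g x + f x * dg).
Proof.
move=> hf hg; apply: is_derive_eq.
by rewrite /GRing.scale/= addrC mulrC.
Qed.

Lemma is_derive_pow (f : R -> R) (df : R) n (x : R) :
  is_derive x (1 : R) f df ->
  is_derive x (1 : R) (fun y => f y ^+ n.+1) (n.+1%:R * f x ^+ n * df).
Proof.
move=> hf; elim: n => [|n IH].
  by rewrite expr0 !mulr1 mul1r; under eq_fun do rewrite expr1.
have -> : (fun y => f y ^+ n.+2) = f \* (fun y => f y ^+ n.+1).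
  by apply/funext => y; rewrite exprS.
have := is_derive_prod hf IH.
move=> h; apply: (is_derive_eq h); rewrite -[in RHS]natr1 exprS; ring.
Qed.

(** As [N] grows, this weight concentrates where the cosine vanishes, that is, at the stationary
    points of the oscillation. There integration by parts gains nothing, and the moment measures the
    loss. *)
Definition sinMoment (N : nat) : R := average1 (fun u => sn u ^+ (2 * N)).

(** The Wallis recurrence, read off from the derivative of the periodic function
    [sn ^+ (2 * N).+1 * cn]. *)
Lemma sinMomentS N : (2 * N.+1)%:R * sinMoment N.+1 = (2 * N).+1%:R * sinMoment N.
Proof.
pose F u := sn u ^+ (2 * N).+1 * cn u.
pose f u := om * ((2 * N).+1%:R * sn u ^+ (2 * N) - (2 * N.+1)%:R * sn u ^+ (2 * N.+1)).
have b1 n : bl1 (fun u => sn u ^+ n) by apply: bl1X; exact: bl1_sn.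
have bf : bl1 f by apply: bl1Z; apply: bl1B; exact: bl1Z.
have dF (x : R) : is_derive x (1 : R) F (f x).
  have := is_derive_prod (is_derive_pow (2 * N) (is_derive_sn x)) (is_derive_cn x).
  move=> h; apply: (is_derive_eq h); rewrite /f /=.
  have c2 : cn x * cn x = 1 - sn x ^+ 2 by rewrite -expr2 cos2sin2.
  have -> : (2 * N).+1%:R * sn x ^+ (2 * N) * (om * cn x) * cn x =
    (2 * N).+1%:R * sn x ^+ (2 * N) * om * (cn x * cn x) by ring.
  rewrite c2 mulnS !exprS -[(2 * N).+1%:R]natr1 natrD /=; ring.
have := average1_derive_periodic bf dF.
rewrite /F sn_periodic1 cn_periodic1 => /(_ erefl).
rewrite average1Z; last by apply: bl1B; exact: bl1Z.
move/eqP; rewrite mulf_eq0 gt_eqF ?om_gt0//= average1B; [|exact: bl1Z..].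
by rewrite !average1Z// subr_eq0 => /eqP <-.
Qed.

Lemma sinMoment_sqr N : sinMoment N ^+ 2 * N.+1%:R <= 1.
Proof.
elim: N => [|N IH].
  rewrite /sinMoment muln0 (_ : (fun _ => _) = cst 1) ?average1_cst ?expr1n ?mulr1//.
have E : sinMoment N.+1 = (2 * N).+1%:R / (2 * N.+1)%:R * sinMoment N.
  have h0 : (2 * N.+1)%:R != 0 :> R by rewrite pnatr_eq0.
  by apply: (mulfI h0); rewrite sinMomentS; field.
rewrite E; apply: le_trans IH.
rewrite exprMn mulrAC mulrC ler_wpM2l ?sqr_ge0//.
rewrite exprMn exprVn mulrAC ler_pdivrMr ?exprn_gt0 ?ltr0n//.
rewrite -!natrX -!natrM ler_nat; lia.
Qed.

Lemma sinMoment_ge0 N : 0 <= sinMoment N.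
Proof.
rewrite -(average1_cst 0); apply: average1_le; first exact: bl1_cst.
  by apply: bl1X; exact: bl1_sn.
by move=> x; rewrite exprM exprn_ge0// sqr_ge0.
Qed.

(** Zero average makes the antiderivative periodic, so it is bounded by its variation over a single
    period. *)
Lemma periodic_bounded_antiderivative (p : R -> R) (L M : R) : lip1 p L ->
  (forall x, p (x + 1) = p x) -> (forall x, `|p x| <= M) -> average1 p = 0 ->
  exists2 P : R -> R, forall x : R, is_derive x (1 : R) P (p x) & forall x, `|P x| <= M.
Proof.
move=> lp pp pM p0; have [P P0 dP] := continuous_antiderivative (lip1_continuous lp).
exists P => // x.
have P1 : P 1 = 0 by have := average1_derive lp dP; rewrite p0 P0 subr0.
have Pper y : P (y + 1) = P y.
  pose D z := P (z + 1) - P z.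
  have dD (z : R) : is_derive z (1 : R) D 0.
    have h1 : is_derive z (1 : R) (fun z : R => z + 1) 1.
      by apply: is_derive_eq; rewrite addr0.
    have h2 := @is_derive1_comp R P (fun z : R => z + 1) z _ _ (dP (z + 1)) h1.
    have := is_deriveB h2 (dP z); move=> h; apply: (is_derive_eq h).
    by rewrite mulr1 pp subrr.
  have := is_derive_0_is_cst y 0 dD; rewrite /D add0r P1 P0 subrr => /eqP.
  by rewrite subr_eq0 => /eqP.
have PperN y (n : nat) : P (y + n%:R) = P y.
  by elim: n => [|n IH]; rewrite ?addr0// -natr1 addrA Pper IH.
have PperZ y (n : int) : P (y + n%:~R) = P y.
  case: n => n; first exact: PperN.
  by rewrite NegzE mulrNz -pmulrn -(PperN (y - _) n.+1) subrK.
have -> : P x = P (fracp x) - P 0.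
  by rewrite P0 subr0 -(PperZ (fracp x) (Num.floor x)) /fracp subrK.
have /andP[f0 f1] := fracp_itv x.
apply: le_trans (lip1_derive dP pM _ _) _.
rewrite subr0 ger0_norm//; apply: ler_piMr; last exact: ltW.
exact: le_trans (normr_ge0 _) (pM 0).
Qed.

Lemma bl1_lip_comp (f g : R -> R) L M : lip1 f L -> (forall x, `|f x| <= M) -> bl1 g -> bl1 (f \o g).
Proof.
move=> lf fM [L' [M' [lg _]]]; exists (L * L'), M; split=> [a b|x]; last exact: fM.
by apply: le_trans (lf _ _) _; rewrite -mulrA ler_wpM2l ?(lip1_ge0 lf).
Qed.

(* Integration by parts shows that weighting the average by [sin ^ 2] costs
   [O (1 / l)]; after [N] such steps the weight has average [O (N ^ (-1/2))]. *)
Lemma equidistribution (k : R -> R) (L M l : R) (N : nat) :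
  lip1 k L -> (forall x, k (x + 1) = k x) -> (forall x, `|k x| <= M) -> 0 < l ->
  `|average1 (fun u => k (l * sn u)) - average1 k| <=
    2 * M * sinMoment N + 2 * M * (N%:R ^+ 2) / l.
Proof.
move=> lk pk kM l0; set kap := average1 k.
have bk : bl1 k by exists L, M.
have M0 : 0 <= M by exact: le_trans (normr_ge0 _) (kM 0).
have kapM : `|kap| <= M by exact: average1_bound.
pose p := k \- cst kap.
have bp : bl1 p by apply: bl1B => //; exact: bl1_cst.
have pM x : `|p x| <= 2 * M.
  by rewrite /p /= (le_trans (ler_normB _ _))// mulrDl mul1r lerD.
have [Lp [_ [lp _]]] := bp.
have pp x : p (x + 1) = p x by rewrite /p /= pk.
have p0 : average1 p = 0.
  by rewrite average1B ?average1_cst ?subrr//; exact: bl1_cst.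
have [P dP PM] := periodic_bounded_antiderivative lp pp pM p0.
have lP := lip1_derive dP pM.
pose g u := l * sn u.
have bg : bl1 g by apply: bl1Z; exact: bl1_sn.
have bpg : bl1 (p \o g) by exact: bl1_lip_comp lp pM bg.
have bPg : bl1 (P \o g) by exact: bl1_lip_comp lP PM bg.
have b1 n : bl1 (fun u => sn u ^+ n) by apply: bl1X; exact: bl1_sn.
have bc n : bl1 (fun u => cn u ^+ n) by apply: bl1X; exact: bl1_cn.
have bcn := bl1_cn.
have sn1 u : `|sn u| <= 1 by exact: sin_max.
have cn1 u : `|cn u| <= 1 by exact: cos_max.
have -> : average1 (fun u => k (l * sn u)) - kap = average1 (p \o g).
  rewrite -[kap in LHS]average1_cst -average1B//; last exact: bl1_cst.
  by rewrite (_ : (fun u => k (l * sn u)) = k \o g)//; exact: bl1_lip_comp lk kM bg.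
have bA j : bl1 (fun u => p (g u) * sn u ^+ (2 * j)) by apply: (bl1M bpg).
(* Integration by parts against [p o g], where [g' = l * om * cn]. *)
have step j : `|average1 (fun u => p (g u) * sn u ^+ (2 * j)) -
    average1 (fun u => p (g u) * sn u ^+ (2 * j.+1))| <= 2 * M * (2 * j + 1)%:R / l.
  (* [G] is the derivative of [cn * sn ^+ (2 * j)]; the case distinction avoids a negative exponent
     at [j = 0]. *)
  pose G u := - (om * sn u ^+ (2 * j).+1) +
              (if j is j'.+1 then om * (2 * j)%:R * sn u ^+ (2 * j').+1 * cn u ^+ 2 else 0).
  have bG : bl1 G.
    rewrite /G; apply: bl1D.
      rewrite (_ : (fun _ => _) = (fun x => (- om) * sn x ^+ (2 * j).+1)); first exact: bl1Z.
      by apply/funext => x; rewrite mulNr.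
    case: (j) => [|j']; first exact: bl1_cst.
    by apply: bl1M => //; exact: bl1Z.
  have dcs (u : R) : is_derive u (1 : R) (fun u => cn u * sn u ^+ (2 * j)) (G u).
    rewrite /G; case: (j) => [|j'].
      have -> : (fun u => cn u * sn u ^+ (2 * 0)) = cn.
        by apply/funext => x; rewrite expr0 mulr1.
      by apply: (is_derive_eq (is_derive_cn u)); rewrite expr1 addr0.
    have := is_derive_prod (is_derive_cn u) (is_derive_pow (2 * j').+1 (is_derive_sn u)).
    rewrite mulnS add2n => h; apply: (is_derive_eq h) => /=.
    rewrite !exprS; ring.
  have bcs : bl1 (fun u => cn u * sn u ^+ (2 * j)) by exact: (bl1M bcn).
  (* The function [P (g u) * cn u * sn u ^+ (2 * j)] is periodic, so its derivative has average
     zero. Differentiating [P \o g] gives [f1], after writing the squared cosine as [1 - sn u ^+ 2];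
     the rest is [f2], which lacks the large factor [l]. *)
  pose f1 u := (l * om) * (p (g u) * sn u ^+ (2 * j) - p (g u) * sn u ^+ (2 * j.+1)).
  pose f2 u := P (g u) * G u.
  have bf1 : bl1 f1 by apply: bl1Z; apply: bl1B.
  have bf2 : bl1 f2 by exact: (bl1M bPg).
  have dW (u : R) : is_derive u (1 : R) ((P \o g) \* (fun u => cn u * sn u ^+ (2 * j))) ((f1 \+ f2) u).
    have dg : is_derive u (1 : R) g (l * (om * cn u)).
      have := is_derive_sn u => hs.
      by apply: (is_derive_eq (is_deriveZ l hs)).
    have dPg := @is_derive1_comp R P g u _ _ (dP (g u)) dg.
    apply: (is_derive_eq (is_derive_prod dPg (dcs u))).
    rewrite /f1 /f2 /=.
    have -> : sn u ^+ (2 * j.+1) = sn u ^+ (2 * j) * (1 - cn u ^+ 2).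
      by rewrite mulnS addnC exprD sin2cos2.
    ring.
  have per : ((P \o g) \* (fun u => cn u * sn u ^+ (2 * j))) 1 = ((P \o g) \* (fun u => cn u * sn u ^+ (2 * j))) 0.
    by rewrite /= /g; have /= -> := sn_periodic1; have /= -> := cn_periodic1.
  have := average1_derive_periodic (bl1D bf1 bf2) dW per.
  rewrite average1D// /f1 average1Z; last exact: bl1B.
  rewrite average1B// => /eqP; rewrite addr_eq0 => /eqP E.
  have lom : 0 < l * om by rewrite mulr_gt0// om_gt0.
  rewrite -(ler_pM2l lom) -[X in X * `|_|](gtr0_norm lom) -normrM E normrN.
  have -> : l * om * (2 * M * (2 * j + 1)%:R / l) = 2 * M * (om * (2 * j + 1)%:R) by field; rewrite gt_eqF.
  apply: average1_bound => // u; rewrite normrM ler_pM//.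
  have om0 := om_gt0.
  have X1 (x : R) n : `|x| <= 1 -> `|x ^+ n| <= 1 by move=> h; rewrite normrX exprn_ile1.
  have -> : om * (2 * j + 1)%:R = om + om * (2 * j)%:R by rewrite natrD; ring.
  rewrite /G (le_trans (ler_normD _ _))// addrC [leRHS]addrC lerD//.
    case: (j) => [|j']; first by rewrite normr0 muln0 mulr0.
    have c0 : 0 < om * (2 * j'.+1)%:R by rewrite mulr_gt0// ltr0n.
    rewrite -mulrA normrM (gtr0_norm c0); apply: ler_piMr; first exact: ltW.
    by rewrite normrM mulr_ile1// X1.
  by rewrite normrN normrM (gtr0_norm om0); apply: ler_piMr; [exact: ltW|exact: X1].
(* The square is the sum of the odd numbers [2 * j + 1] for [j < n], one from each step. *)
have tele n : `|average1 (p \o g) - average1 (fun u => p (g u) * sn u ^+ (2 * n))| <= 2 * M * (n%:R ^+ 2) / l.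
  elim: n => [|n IH].
    have -> : (fun u => p (g u) * sn u ^+ (2 * 0)) = p \o g.
      by apply/funext => u; rewrite expr0 mulr1.
    by rewrite subrr normr0 expr0n mulr0 mul0r.
  rewrite -(subrKA (average1 (fun u => p (g u) * sn u ^+ (2 * n)))) (le_trans (ler_normD _ _))//.
  apply: le_trans (lerD IH (step n)) _.
  rewrite -mulrDl -mulrDr; apply: ler_wpM2r; first by rewrite invr_ge0 ltW.
  apply: ler_wpM2l; first by rewrite mulr_ge0.
  by rewrite -!natrX -natrD ler_nat; lia.
rewrite -[average1 _](subrK (average1 (fun u => p (g u) * sn u ^+ (2 * N)))) addrC.
rewrite (le_trans (ler_normD _ _))// lerD//.
have bb : bl1 (fun u => (2 * M) * sn u ^+ (2 * N)) by exact: bl1Z.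
rewrite /sinMoment -average1Z//.
rewrite ler_norml -mulN1r -average1Z//; apply/andP; split; apply: average1_le => //; first exact: bl1Z.
  move=> u; rewrite mulN1r lerNl -mulNr.
  have s0 : 0 <= sn u ^+ (2 * N) by rewrite exprM exprn_ge0// sqr_ge0.
  rewrite ler_wpM2r//; have := pM (g u).
  by rewrite ler_norml lerNl => /andP[].
move=> u; have s0 : 0 <= sn u ^+ (2 * N) by rewrite exprM exprn_ge0// sqr_ge0.
by rewrite ler_wpM2r// (le_trans (ler_norm _)).
Qed.

End Equidistribution.

(** * Decorrelation by one fast shear *)

Section MixingBlock.
Context {R : realType}.
Implicit Types (F G W V : R * R -> R) (x y z : R * R).

Lemma lip2M F G L M L' M' : lip2 F L -> (forall x, `|F x| <= M) ->
  lip2 G L' -> (forall x, `|G x| <= M') -> lip2 (F \* G) (L * M' + M * L').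
Proof.
move=> lF bF lG bG x y.
have -> : (F \* G) x - (F \* G) y = (F x - F y) * G x + F y * (G x - G y) by rewrite /=; ring.
rewrite (le_trans (ler_normD _ _))// [leRHS]mulrDl lerD// normrM.
  by rewrite mulrAC ler_pM.
by rewrite -mulrA ler_pM.
Qed.

Lemma lip2D F G L L' : lip2 F L -> lip2 G L' -> lip2 (F \+ G) (L + L').
Proof.
move=> lF lG x y.
have -> : (F \+ G) x - (F \+ G) y = (F x - F y) + (G x - G y) by rewrite /=; ring.
by rewrite (le_trans (ler_normD _ _))// mulrDl lerD.
Qed.

Lemma lip2Z (c : R) F L : lip2 F L -> lip2 (fun x => c * F x) (`|c| * L).
Proof. by move=> lF x y; rewrite -mulrBr normrM -mulrA ler_wpM2l. Qed.

Lemma lip2_cst (c : R) : lip2 (cst c) 0.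
Proof. by move=> x y; rewrite subrr normr0 mul0r. Qed.

Lemma lip2_sum (I : Type) (s : seq I) (F : I -> R * R -> R) (L : I -> R) :
  (forall i, lip2 (F i) (L i)) -> lip2 (fun x => \sum_(i <- s) F i x) (\sum_(i <- s) L i).
Proof.
move=> lF; elim: s => [|i s IH].
  by rewrite big_nil => x y; rewrite !big_nil subrr normr0 mul0r.
rewrite big_cons (_ : (fun _ => _) = F i \+ (fun x => \sum_(i <- s) F i x)); first exact: lip2D.
by apply/funext => x; rewrite big_cons.
Qed.

Lemma tE_dist V W L L' C : lip2 V L -> lip2 W L' -> (forall x, `|V x - W x| <= C) ->
  `|tE V - tE W| <= C.
Proof.
move=> lV lW VW; rewrite -(tEB lV lW).
have lW' : lip2 (\- W) L' by move=> x y; rewrite (_ : _ - _ = - (W x - W y)) ?normrN//=; ring.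
exact: (tE_bound (lip2D lV lW')).
Qed.

Definition correl F G (a : R * R) : R := tE (fun y => F (y + a) * G y).

Section Bounds.
Variables (F G : R * R -> R) (L M : R).
Hypotheses (pF : periodic2 F) (lF : lip2 F L) (lG : lip2 G L).
Hypotheses (bF : forall x, `|F x| <= M) (bG : forall x, `|G x| <= M).

Let L0 : 0 <= L := lip2_ge0 lF.
Let M0 : 0 <= M. Proof. exact: le_trans (normr_ge0 _) (bF 0). Qed.

Lemma lip2_correl_integrand (a b : R * R) : lip2 (fun y => F (y + a) * G (y + b)) (L * M + M * L).
Proof.
apply: (@lip2M (fun y => F (y + a)) (fun y => G (y + b))) => //; exact: lip2_trans.
Qed.

Lemma lip2_correl : lip2 (correl F G) (L * M).
Proof.
have l0 a : lip2 (fun y => F (y + a) * G y) (L * M + M * L).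
  have := lip2_correl_integrand a 0; congr lip2; apply/funext => y; by rewrite addr0.
move=> a b; apply: (tE_dist (l0 a) (l0 b)) => y.
rewrite -mulrBl normrM mulrAC ler_pM//.
by apply: le_trans (lF _ _) _; rewrite opprD addrACA subrr add0r.
Qed.

Lemma correl_bound a : `|correl F G a| <= M * M.
Proof.
have l0 : lip2 (fun y => F (y + a) * G y) (L * M + M * L).
  have := lip2_correl_integrand a 0; congr lip2; apply/funext => y; by rewrite addr0.
by apply: (tE_bound l0) => y; rewrite normrM ler_pM.
Qed.

Lemma periodic2_correl : periodic2 (correl F G).
Proof.
move=> a k l; apply: eq_tE => y; congr (_ * _).
by rewrite -[RHS](pF _ k l); congr F; rewrite /=; apply/pair_equal_spec; split; rewrite addrA.
Qed.

(** Fubini with the inner integral replaced by a Riemann sum: each of its terms is a translate of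
    [F] times a constant, whose average over the displacement [a] is known by translation
    invariance. *)
Lemma tE_correl : tE (correl F G) = tE F * tE G.
Proof.
apply: (@eq_of_grid_close _ _ _ (L * M + M * L + M * L)) => n n0.
have n0' : 0 < n%:R :> R by rewrite ltr0n.
have l0 a : lip2 (fun y => F (y + a) * G y) (L * M + M * L).
  have := lip2_correl_integrand a 0; congr lip2; apply/funext => y; by rewrite addr0.
pose V a := gridE n (fun y => F (y + a) * G y).
have lVz (i j : 'I_n) : lip2 (fun a => F ((i%:R / n%:R, j%:R / n%:R) + a) * G (i%:R / n%:R, j%:R / n%:R)) (`|G (i%:R / n%:R, j%:R / n%:R)| * L).
  move=> a b; rewrite -mulrBl normrM mulrC -mulrA ler_wpM2l//.
  by apply: le_trans (lF _ _) _; rewrite opprD addrACA subrr add0r.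
have lV : lip2 V (`|(n%:R^-1) ^+ 2| * \sum_(i < n) \sum_(j < n) (`|G (i%:R / n%:R, j%:R / n%:R)| * L)).
  by apply: lip2Z; apply: lip2_sum => i; apply: lip2_sum => j; exact: lVz.
have EV : tE V = tE F * gridE n G.
  have lS i := lip2_sum (index_enum 'I_n) (lVz i).
  rewrite /V /gridE (tEZ _ (lip2_sum (index_enum 'I_n) lS)).
  rewrite mulrCA; congr (_ * _).
  rewrite (tE_sum _ lS) mulr_sumr; apply: eq_bigr => i _.
  rewrite (tE_sum _ (lVz i)).
  rewrite mulr_sumr; apply: eq_bigr => j _.
  rewrite (eq_tE (W := fun a => G (i%:R / n%:R, j%:R / n%:R) * F (a + (i%:R / n%:R, j%:R / n%:R)))).
    by rewrite (tEZ _ (lip2_trans _ lF)) (tE_trans _ pF lF) mulrC.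
  by move=> a; rewrite mulrC addrC.
rewrite -(subrKA (tE V)) (le_trans (ler_normD _ _))// [leRHS]mulrDl lerD//.
  apply: (tE_dist lip2_correl lV) => a; exact: (tE_grid n0 (l0 a)).
rewrite EV -mulrBr normrM -mulrA ler_pM//; first exact: tE_bound lF bF.
by rewrite distrC; exact: tE_grid.
Qed.

Lemma sum_blocks (q m : nat) (f : nat -> R) :
  \sum_(i < q * m) f i = \sum_(b < m) \sum_(a < q) f (a + q * b)%N.
Proof.
elim: m => [|m IH]; first by rewrite muln0 !big_ord0.
rewrite big_ord_recr /= -IH mulnS addnC big_split_ord /=; congr (_ + _).
by apply: eq_bigr => a _; rewrite addnC.
Qed.

(* The closed curve [r |-> (t + q * r, r)] is [1 / q]-dense in the torus. *)
Lemma average1_line (q : nat) (t : R) : (0 < q)%N ->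
  `|average1 (fun r => correl F G (t + q%:R * r, r)) - tE F * tE G| <= 3 * (L * M) / q%:R.
Proof.
move=> q0; have q0' : 0 < q%:R :> R by rewrite ltr0n.
have q1 : 1 <= q%:R :> R by rewrite ler1n.
set k := (fun r => _).
have lk : lip1 k (L * M * q%:R).
  move=> a b; apply: le_trans (lip2_correl _ _) _.
  rewrite -[leRHS]mulrA ler_wpM2l ?mulr_ge0// normr_pair_le /= opprD addrACA subrr add0r -mulrBr.
  by rewrite normrM (gtr0_norm q0') lexx/= ler_peMl.
(* Sampling the curve at the [q * q] parameters [(a + q * b) / q ^ 2] gives, modulo integers, points
   within [1 / q] of the grid points [(t + a / q, b / q)], each grid point being met once. Curve
   sum, rounding and torus grid each cost [L * M / q]. *)
have qq0 : (0 < q * q)%N by rewrite muln_gt0 q0.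
have h1 := average1_grid qq0 lk.
have lt : lip2 (fun x => correl F G (x + (t, 0))) (L * M) by exact: lip2_trans lip2_correl.
have h2 := tE_grid q0 lt.
rewrite (tE_trans _ periodic2_correl lip2_correl) tE_correl in h2.
have h3 : `|((q * q)%:R^-1 * \sum_(i < q * q) k (i%:R / (q * q)%:R)) -
    gridE q (fun x => correl F G (x + (t, 0)))| <= L * M / q%:R.
  rewrite (sum_blocks q q (fun i => k (i%:R / (q * q)%:R))) /gridE exchange_big /= natrM invfM -expr2 -mulrBr -sumrB normrM.
  rewrite ger0_norm ?exprn_ge0 ?invr_ge0 ?ler0n//.
  apply: (@le_trans _ _ ((q%:R^-1) ^+ 2 * \sum_(b < q) \sum_(a < q) (L * M / q%:R))); last first.
    rewrite !sumr_const card_ord -[(_ *+ _) *+ _]mulr_natr -[(_ / _) *+ _]mulr_natr le_eqVlt.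
    by apply/orP; left; apply/eqP; field; rewrite gt_eqF.
  rewrite ler_wpM2l ?exprn_ge0 ?invr_ge0 ?ler0n// (le_trans (ler_norm_sum _ _ _))//.
  apply: ler_sum => a _; rewrite -sumrB (le_trans (ler_norm_sum _ _ _))//.
  apply: ler_sum => b _.
  have -> : k ((a + q * b)%:R * (q%:R^-1) ^+ 2) = correl F G (t + a%:R / q%:R, b%:R / q%:R + a%:R / (q%:R * q%:R)).
    rewrite /k -[RHS](periodic2_correl _ b 0) /= addr0 natrD natrM; congr (correl F G (_, _)).
      rewrite -pmulrn; field; by rewrite gt_eqF.
    by field; rewrite gt_eqF.
  apply: le_trans (lip2_correl _ _) _; rewrite ler_wpM2l ?mulr_ge0// normr_pair_le /=.
  apply/andP; split.
    by rewrite (_ : _ - _ = 0) ?normr0 ?invr_ge0 ?ler0n//; ring.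
  rewrite addr0 addrAC subrr add0r ger0_norm ?divr_ge0 ?mulr_ge0 ?ler0n//.
  rewrite invfM mulrA ler_piMl ?invr_ge0 ?ler0n// ler_pdivrMr// mul1r ler_nat.
  by rewrite ltnW.
rewrite -(subrKA ((q * q)%:R^-1 * \sum_(i < q * q) k (i%:R / (q * q)%:R))).
rewrite (le_trans (ler_normD _ _))//.
have -> : 3 * (L * M) / q%:R = (L * M * q%:R / (q * q)%:R) + (L * M / q%:R + L * M / q%:R).
  by rewrite natrM; field; rewrite gt_eqF.
rewrite lerD//.
rewrite -(subrKA (gridE q (fun x => correl F G (x + (t, 0))))).
by rewrite (le_trans (ler_normD _ _))// lerD// distrC.
Qed.

End Bounds.

(* A displacement along [(q, 1)], the direction that leaves [x.1 - q * x.2] unchanged. *)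
Definition shear (q : nat) (v : R -> R) : R * R -> R * R :=
  fun x => (x.1 + q%:R * v (x.1 - q%:R * x.2), x.2 + v (x.1 - q%:R * x.2)).

Lemma shear_lip q v K : lip1 v K -> exists2 C, 0 <= C & forall x y, `|shear q v x - shear q v y| <= C * `|x - y|.
Proof.
move=> lv; have K0 := lip1_ge0 lv.
pose q1 : R := 1 + q%:R.
have q10 : 0 <= q1 by rewrite addr_ge0.
exists (1 + q1 * (K * q1)); first by rewrite addr_ge0// !mulr_ge0.
move=> x y; set d := `|x - y|.
have d1 : `|x.1 - y.1| <= d by exact: (normr_fst_le (x - y)).
have d2 : `|x.2 - y.2| <= d by exact: (normr_snd_le (x - y)).
have d0 : 0 <= d by exact: normr_ge0.
have hv : `|v (x.1 - q%:R * x.2) - v (y.1 - q%:R * y.2)| <= K * q1 * d.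
  apply: le_trans (lv _ _) _; rewrite -mulrA ler_wpM2l//.
  have -> : x.1 - q%:R * x.2 - (y.1 - q%:R * y.2) = (x.1 - y.1) - q%:R * (x.2 - y.2) by ring.
  rewrite (le_trans (ler_normB _ _))// /q1 mulrDl mul1r lerD// normrM ger0_norm//.
  by rewrite ler_wpM2l.
rewrite normr_pair_le; apply/andP; split => /=.
  rewrite opprD addrACA -mulrBr (le_trans (ler_normD _ _))// mulrDl mul1r lerD// normrM ger0_norm//.
  by rewrite -mulrA ler_pM// /q1 lerDr.
rewrite opprD addrACA (le_trans (ler_normD _ _))// mulrDl mul1r lerD//.
apply: le_trans hv _; rewrite -[leRHS]mulrA; apply: ler_peMl; first by rewrite !mulr_ge0.
by rewrite /q1 lerDl.
Qed.

Definition sinwave (q : nat) (l th : R) : R -> R := fun u => l * sin (2 * pi * q%:R * u + th).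

Lemma sinwave_lip q l th : exists K, lip1 (sinwave q l th) K.
Proof.
case: q => [|q].
  by exists 0 => a b; rewrite /sinwave !mulr0 !mul0r subrr normr0.
have [K [_ [h _]]] := @bl1Z R l _ (bl1_sn th (ltn0Sn q)).
by exists K.
Qed.

(** This is what makes the shear commute with the translations by the grid of step [1 / q]. *)
Lemma sinwave_shift q l th (i j : int) (u : R) : (0 < q)%N ->
  sinwave q l th (u + (i%:~R / q%:R) - j%:~R) = sinwave q l th u.
Proof.
move=> q0; rewrite /sinwave; congr (_ * _).
rewrite -[RHS](sinD2zpi _ (i - q%:Z * j)); congr sin.
rewrite intrB intrM -pmulrn; field; by rewrite pnatr_eq0 -lt0n.
Qed.

Lemma sinwave_neg q l th : sinwave q l th = sinwave q (- l) (th + pi).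
Proof. by apply/funext => u; rewrite /sinwave addrA (@sinDpi R) mulrNN. Qed.

(** Averaging over the grid of step [1 / q] replaces the product by [correl F G] at the displacement
    of [x], which depends on [x.1 - q * x.2] only. A linear shear makes this a one-variable average
    of [k (l * sin ..)], where [k] is the correlation along the closed line of direction [(q, 1)].
    Now [equidistribution] removes the sine and [average1_line] evaluates the average of [k]. The
    constant 5 is 2 from the grid plus 3 from the line. *)
Lemma mixing_block_pos (F G : R * R -> R) (L M l th t : R) (q N : nat) :
  periodic2 F -> periodic2 G -> lip2 F L -> lip2 G L ->
  (forall x, `|F x| <= M) -> (forall x, `|G x| <= M) -> (0 < q)%N -> q%:R <= l ->
  `|tE (fun x => F (shear q (sinwave q l th) x + (t, 0)) * G x) - tE F * tE G| <=
  (5 * (L * M) + 2 * (M * M) * N%:R ^+ 2) / q%:R + 2 * (M * M) * Num.sqrt (N.+1%:R^-1).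
Proof.
move=> pF pG lF lG bF bG q0 ql.
have q0' : 0 < q%:R :> R by rewrite ltr0n.
have l0 : 0 < l by exact: lt_le_trans ql.
have L0 := lip2_ge0 lF; have M0 : 0 <= M by exact: le_trans (normr_ge0 _) (bF 0).
have [Kw lw] := sinwave_lip q l th.
have [C C0 lS] := shear_lip q lw.
set w := sinwave q l th in lw lS *.
pose Phi x := shear q w x + (t, 0).
have lPhi x y : `|Phi x - Phi y| <= C * `|x - y|.
  by rewrite /Phi opprD addrACA subrr addr0.
pose z (i j : 'I_q) : R * R := (i%:R / q%:R, j%:R / q%:R).
have Phiz i j x : Phi (x + z i j) = Phi x + z i j.
  have wz : w (x.1 + i%:R / q%:R - q%:R * (x.2 + j%:R / q%:R)) = w (x.1 - q%:R * x.2).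
    rewrite /w -[RHS](@sinwave_shift q l th i%:Z j%:Z)//; congr sinwave.
    by rewrite -!pmulrn; field; rewrite gt_eqF.
  rewrite /Phi /shear /= wz; apply/pair_equal_spec; split; rewrite /=; ring.
pose Hf x := F (Phi x) * G x.
have bFP x : `|F (Phi x)| <= M by [].
have lFP : lip2 (F \o Phi) (L * C) by exact: lip2_comp.
have lH : lip2 Hf (L * C * M + M * L) by exact: (lip2M lFP bFP lG bG).
have pPhi x (a b : int) : Phi (x.1 + a%:~R, x.2 + b%:~R) = (((Phi x).1 + a%:~R), ((Phi x).2 + b%:~R)).
  have wz : w (x.1 + a%:~R - q%:R * (x.2 + b%:~R)) = w (x.1 - q%:R * x.2).
    rewrite /w -[RHS](@sinwave_shift q l th (q%:Z * a) (q%:Z * b))//; congr sinwave.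
    by rewrite !intrM -!pmulrn; field; rewrite gt_eqF.
  rewrite /Phi /shear /= wz; apply/pair_equal_spec; split; rewrite /=; ring.
have pH : periodic2 Hf by move=> x a b; rewrite /Hf pPhi pF pG.
pose V x := gridE q (fun y => F (y + Phi x) * G (y + x)).
have lVz i j : lip2 (fun x => F (z i j + Phi x) * G (z i j + x)) (L * C * M + M * L).
  apply: (@lip2M (fun x => F (z i j + Phi x)) (fun x => G (z i j + x))) => //.
    move=> x y; apply: le_trans (lF _ _) _.
    by rewrite opprD addrACA subrr add0r -mulrA ler_wpM2l.
  by move=> x y; apply: le_trans (lG _ _) _; rewrite opprD addrACA subrr add0r.
have lS1 i := lip2_sum (index_enum 'I_q) (lVz i).
have lS2 := lip2_sum (index_enum 'I_q) lS1.
have lV := lip2Z ((q%:R^-1) ^+ 2) lS2.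
(* The translations by the grid of step [1 / q] commute with [Phi], so one may average over them. *)
have EV : tE Hf = tE V.
  rewrite /V /gridE (tEZ _ lS2) (tE_sum _ lS1).
  rewrite (eq_bigr (fun=> \sum_(j < q) tE Hf)); last first.
    move=> i _; rewrite (tE_sum _ (lVz i)); apply: eq_bigr => j _.
    rewrite -(tE_trans (z i j) pH lH); apply: eq_tE => x.
    by rewrite /Hf Phiz addrC [x + _]addrC.
  rewrite !sumr_const card_ord -[(_ *+ _) *+ _]mulr_natr -[_ *+ _]mulr_natr.
  by field; rewrite gt_eqF.
pose k0 (u : R) := correl F G (t + q%:R * w u, w u).
have lc := lip2_correl lF lG bF bG.
have pc := @periodic2_correl F G pF.
have PhiK x : correl F G (Phi x - x) = k0 (x.1 - q%:R * x.2).
  rewrite /k0 /Phi /shear /=; congr (correl F G _).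
  by apply/pair_equal_spec; split; rewrite /=; ring.
have lk0 : lip1 k0 (L * M * (q%:R * Kw)).
  move=> a b; apply: le_trans (lc _ _) _.
  rewrite -[leRHS]mulrA ler_wpM2l ?mulr_ge0// normr_pair_le /= opprD addrACA subrr add0r -mulrBr.
  rewrite normrM (gtr0_norm q0') -mulrA; apply/andP; split; first by rewrite ler_wpM2l.
  by apply: le_trans (lw _ _) _; rewrite ler_peMl ?mulr_ge0 ?(lip1_ge0 lw)// ler1n.
have pk0 (u : R) (a : int) : k0 (u + a%:~R) = k0 u.
  rewrite /k0; have -> : w (u + a%:~R) = w u; last by [].
  rewrite /w -[RHS](@sinwave_shift q l th 0 (- a))//; congr sinwave.
  by rewrite mul0r addr0 mulrNz opprK.
have lD : lip2 (fun x => k0 (x.1 - q%:R * x.2)) (L * M * (q%:R * Kw) * (1 + q%:R)).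
  move=> x y; apply: le_trans (lk0 _ _) _.
  rewrite -[leRHS]mulrA ler_wpM2l ?mulr_ge0 ?(lip1_ge0 lw)//.
  have -> : x.1 - q%:R * x.2 - (y.1 - q%:R * y.2) = (x.1 - y.1) - q%:R * (x.2 - y.2) by ring.
  rewrite (le_trans (ler_normB _ _))// mulrDl mul1r lerD//; first exact: (normr_fst_le (x - y)).
  by rewrite normrM ger0_norm// ler_wpM2l// (normr_snd_le (x - y)).
have h1 : `|tE V - tE (fun x => k0 (x.1 - q%:R * x.2))| <= (L * M + M * L) / q%:R.
  apply: (tE_dist lV lD) => x; rewrite -PhiK /correl.
  have lc0 := lip2_correl_integrand lF lG bF bG (Phi x) x.
  have := tE_grid q0 lc0; rewrite distrC; congr (`|_ - _| <= _).
  have lc1 : lip2 (fun y => F (y + (Phi x - x)) * G y) (L * M + M * L).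
    have := lip2_correl_integrand lF lG bF bG (Phi x - x) 0; congr lip2.
    by apply/funext => y; rewrite addr0.
  have pc1 : periodic2 (fun y => F (y + (Phi x - x)) * G y).
    move=> y a b; rewrite pG; congr (_ * _); rewrite -[RHS](pF _ a b); congr F.
    by apply/pair_equal_spec; split; rewrite /= addrAC.
  rewrite -(tE_trans x pc1 lc1); apply: eq_tE => y.
  by rewrite -addrA (addrCA x) subrr addr0.
have h2 : tE (fun x => k0 (x.1 - q%:R * x.2)) = average1 k0.
  apply: (@tE_shear1 R (fun r => - (q%:R * r)) (fun x => k0 x.1) _ _ _ (lip1_fst lk0) lD).
  by move=> x a b /=; rewrite pk0.
pose k (r : R) := correl F G (t + q%:R * r, r).
(* This constant grows with [q], which is harmless: the bound of [equidistribution] contains only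
   the supremum of [k]. *)
have lk : lip1 k (L * M * q%:R).
  move=> a b; apply: le_trans (lc _ _) _.
  rewrite -[leRHS]mulrA ler_wpM2l ?mulr_ge0// normr_pair_le /= opprD addrACA subrr add0r -mulrBr.
  by rewrite normrM (gtr0_norm q0') lexx/= ler_peMl// ler1n.
have pk r : k (r + 1) = k r.
  by rewrite /k mulrDr mulr1 addrA -[RHS](pc _ q%:Z 1).
have bk r : `|k r| <= M * M by exact: (correl_bound lF lG bF bG).
have h3 := equidistribution th q0 N lk pk bk l0.
have h4 := average1_line pF lF lG bF bG t q0.
have E0 : average1 (fun u => k (l * sin (2 * pi * q%:R * u + th))) = average1 k0 by [].
rewrite E0 in h3.
rewrite -[tE _]/(tE Hf) EV -(subrKA (average1 k0)) (le_trans (ler_normD _ _))//.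
rewrite -h2 in h3 *.
have Ml : 2 * (M * M) * N%:R ^+ 2 / l <= 2 * (M * M) * N%:R ^+ 2 / q%:R.
  by rewrite ler_wpM2l ?mulr_ge0 ?exprn_ge0// lef_pV2// posrE.
have I0 := sinMoment_ge0 th q0 N.
have Is : sinMoment q th N <= Num.sqrt (N.+1%:R^-1).
  rewrite -[leLHS](ger0_norm I0) -sqrtr_sqr; apply: ler_wsqrtr.
  by rewrite -[leRHS]div1r ler_pdivlMr ?ltr0n// sinMoment_sqr.
apply: le_trans (lerD h1 (_ : _ <= 2 * (M * M) * sinMoment q th N + 2 * (M * M) * N%:R ^+ 2 / l + 3 * (L * M) / q%:R)) _.
  rewrite -(subrKA (average1 k)) (le_trans (ler_normD _ _))// lerD//.
have : 2 * (M * M) * sinMoment q th N <= 2 * (M * M) * Num.sqrt (N.+1%:R^-1).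
  by rewrite ler_wpM2l// !mulr_ge0.
have -> : (5 * (L * M) + 2 * (M * M) * N%:R ^+ 2) / q%:R =
  5 * (L * M / q%:R) + 2 * (M * M) * N%:R ^+ 2 / q%:R by ring.
have -> : (L * M + M * L) / q%:R = 2 * (L * M / q%:R) by ring.
have -> : 3 * (L * M) / q%:R = 3 * (L * M / q%:R) by ring.
move: Ml; set a1 := L * M / q%:R; set a2 := _ / q%:R; set a3 := _ / l; lra.
Qed.

(** First [N] is taken large to make the sine moment small, then [q] is taken large against
    [N ^+ 2]. The threshold is uniform in the phase, the time and the functions, because it has to
    be known before [q] is selected. *)
Lemma mixing_block (L M e : R) : 0 < e -> exists Q : nat, forall q l th t F G, (Q <= q)%N -> q%:R <= `|l| ->
  periodic2 F -> periodic2 G -> lip2 F L -> lip2 G L ->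
  (forall x, `|F x| <= M) -> (forall x, `|G x| <= M) ->
  `|tE (fun x => F (shear q (sinwave q l th) x + (t, 0)) * G x) - tE F * tE G| <= e.
Proof.
move=> e0.
pose A : R := 2 * (M * M).
have A0 : 0 <= A by rewrite mulr_ge0// -expr2 sqr_ge0.
pose N := Num.bound ((2 * A / e) ^+ 2).
pose B : R := `|5 * (L * M) + A * N%:R ^+ 2|.
pose Q := (Num.bound (B / (e / 2))).+1.
have e2 : 0 < e / 2 by rewrite divr_gt0.
exists Q => q l th t F G Qq ql pF pG lF lG bF bG.
have q0 : (0 < q)%N by exact: leq_trans Qq.
have q0' : 0 < q%:R :> R by rewrite ltr0n.
have hN : A * Num.sqrt (N.+1%:R^-1) <= e / 2.
  have N0 : 0 < N.+1%:R :> R by rewrite ltr0n.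
  have : (2 * A / e) ^+ 2 <= N.+1%:R.
    apply: ltW; apply: lt_trans (archi_boundP _) _; first by rewrite sqr_ge0.
    by rewrite ltr_nat.
  have s0 : 0 < Num.sqrt (N.+1%:R : R) by rewrite sqrtr_gt0.
  have x0 : 0 <= 2 * A / e by apply: divr_ge0; [exact: mulr_ge0|exact: ltW].
  rewrite -[X in _ <= X](sqr_sqrtr (ltW N0)) ler_sqr ?nnegrE ?sqrtr_ge0//.
  rewrite ler_pdivrMr// => h.
  rewrite sqrtrV ?(ltW N0)// ler_pdivrMr//.
  have -> : e / 2 * Num.sqrt N.+1%:R = (Num.sqrt N.+1%:R * e) / 2 by ring.
  by rewrite ler_pdivlMr// mulrC.
have hB : (5 * (L * M) + A * N%:R ^+ 2) / q%:R <= e / 2.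
  rewrite ler_pdivrMr// -(ler_pdivrMl _ _ e2) [leLHS]mulrC.
  apply: le_trans (_ : B / (e / 2) <= _).
    by rewrite ler_wpM2r ?invr_ge0 ?(ltW e2)// ler_norm.
  apply: ltW; apply: lt_trans (archi_boundP _) _; first by apply: divr_ge0; [exact: normr_ge0|exact: ltW].
  by rewrite ltr_nat.
have key l' th' : q%:R <= l' ->
  `|tE (fun x => F (shear q (sinwave q l' th') x + (t, 0)) * G x) - tE F * tE G| <= e.
  move=> ql'; apply: le_trans (mixing_block_pos th' t N pF pG lF lG bF bG q0 ql') _.
  by rewrite [leRHS]splitr lerD.
have [l0|l0] := leP 0 l; first by apply: key; rewrite -(ger0_norm l0).
by rewrite sinwave_neg; apply: key; rewrite -(ler0_norm (ltW l0)).
Qed.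

End MixingBlock.

(** * Approximation of measurable sets by periodic Lipschitz functions *)

Section TorusApproximation.
Context {R : realType}.
Implicit Types (F G W V : R * R -> R) (x y z : R * R).

Definition testfun F :=
  [/\ periodic2 F, exists L, lip2 F L & forall x, 0 <= F x <= 1].

Lemma testfun_bmeas F : testfun F -> bmeas (F \o tcoord).
Proof. by move=> [_ [L lF] _]; exact: bmeas_lip2 lF. Qed.

Lemma testfun_norm F x : testfun F -> `|F x| <= 1.
Proof. by move=> [_ _ /(_ x)/andP[a b]]; rewrite ger0_norm. Qed.

Lemma testfun_cst (c : R) : 0 <= c <= 1 -> testfun (cst c).
Proof. by move=> c01; split=> //; exists 0; exact: lip2_cst. Qed.

Lemma testfunC F : testfun F -> testfun (fun x => 1 - F x).
Proof.
move=> [pF [L lF] bF]; split.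
- by move=> x k l; rewrite pF.
- exists L => x y; have -> : 1 - F x - (1 - F y) = F y - F x by ring.
  by rewrite distrC lF.
- by move=> x; have /andP[a b] := bF x; rewrite subr_ge0 b/= lerBlDr lerDl.
Qed.

Lemma testfunM F G : testfun F -> testfun G -> testfun (F \* G).
Proof.
move=> tF tG; have [pF [L lF] bF] := tF; have [pG [L' lG] bG] := tG; split.
- by move=> x k l /=; rewrite pF pG.
- exists (L * 1 + 1 * L'); apply: lip2M => // x; exact: testfun_norm.
- move=> x /=; have /andP[a b] := bF x; have /andP[c d] := bG x.
  by rewrite mulr_ge0//= mulr_ile1.
Qed.

Lemma min_lip (a b a' b' : R) : `|Num.min a b - Num.min a' b'| <= Num.max `|a - a'| `|b - b'|.
Proof.
have h (u v : R) : Num.min u v <= u /\ Num.min u v <= v by rewrite !ge_min !lexx orbT.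
rewrite ler_norml; set m := Num.max _ _.
have m1 : `|a - a'| <= m by rewrite le_max lexx.
have m2 : `|b - b'| <= m by rewrite le_max lexx orbT.
move: m1 m2; rewrite !ler_norml => /andP[m1 m1'] /andP[m2 m2'].
have [h1 h2] := h a b; have [h3 h4] := h a' b'.
apply/andP; split.
  rewrite lerBrDr addrC le_min; apply/andP; split; lra.
by rewrite lerBlDr -lerBlDl le_min; apply/andP; split; lra.
Qed.

(** For [0 <= a] it is positive exactly where the fractional part exceeds [a]. The term
    [1 - fracp u] brings it down to 0 before each integer, so that it is continuous on the circle
    although [fracp] jumps. *)
Definition sawtooth (a u : R) : R := Num.max 0 (Num.min (fracp u - a) (1 - fracp u)).

Lemma sawtooth_itv (a y : R) : 0 <= a -> 0 <= sawtooth a y <= 1.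
Proof.
move=> a0; have /andP[f0 f1] := fracp_itv y.
rewrite /sawtooth le_max lexx /= ge_max ler01 /= ge_min; apply/orP; right.
by rewrite lerBlDr lerDl.
Qed.

Lemma sawtooth_lip (a : R) : 0 <= a -> lip1 (sawtooth a) 1.
Proof.
move=> a0 y z; rewrite mul1r; wlog yz : y z / y <= z.
  move=> H; have [h|/ltW h] := leP y z; first exact: H.
  by rewrite distrC [`|y - z|]distrC H.
rewrite [leRHS]distrC (@ger0_norm _ (z - y)) ?subr_ge0//.
have [zy|zy] := leP 1 (z - y).
  have /andP[s0 s1] := sawtooth_itv y a0; have /andP[s2 s3] := sawtooth_itv z a0.
  by apply: le_trans zy; rewrite ler_norml; apply/andP; split; lra.
have /andP[f1 f2] := floor_itv y; have /andP[f3 f4] := floor_itv z.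
have [E|E] := eqVneq (Num.floor z) (Num.floor y).
  rewrite /sawtooth /fracp E; set k := _%:~R.
  have nn (u v : R) : `|- u - - v| = `|u - v| by rewrite opprK addrC distrC.
  have maxl (u v : R) : `|Num.max 0 u - Num.max 0 v| <= `|u - v|.
    have := min_lip 0 (- u) 0 (- v).
    rewrite -[0 in X in `|X|](oppr0 R).
    rewrite -!oppr_max subrr normr0 => h.
    have : `|Num.max 0 u - Num.max 0 v| <= Num.max 0 `|- u - - v|.
      by apply: le_trans h; rewrite nn.
    move=> /le_trans; apply; rewrite ge_max normr_ge0/=.
    by rewrite nn.
  apply: le_trans (maxl _ _) _; apply: le_trans (min_lip _ _ _ _) _.
  rewrite ge_max; apply/andP; split.
    by rewrite (_ : _ - _ = - (z - y)) ?normrN ?ger0_norm ?subr_ge0//; ring.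
  by rewrite (_ : _ - _ = (z - y)) ?ger0_norm ?subr_ge0//; ring.
have E1 : (Num.floor z)%:~R = (Num.floor y)%:~R + 1 :> R.
  have : Num.floor z = Num.floor y + 1.
    apply/eqP; rewrite eq_le; apply/andP; split.
      rewrite -ltzD1 -(ltr_int R) (le_lt_trans f3)// !intrD.
      by move: f2; rewrite intrD; lra.
    by rewrite lezD1 lt_neqAle eq_sym E le_floor.
  by move=> ->; rewrite intrD.
(* With an integer between [y] and [z], each of the two values is at most the distance of its
   argument to that integer. *)
have s1 : sawtooth a y <= z - y.
  rewrite /sawtooth ge_max subr_ge0 yz /= ge_min; apply/orP; right.
  by rewrite /fracp; move: f3; rewrite E1; lra.
have s2 : sawtooth a z <= z - y.
  rewrite /sawtooth ge_max subr_ge0 yz /= ge_min; apply/orP; left.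
  by rewrite /fracp E1; move: f2; rewrite intrD; lra.
have /andP[s3 _] := sawtooth_itv y a0; have /andP[s4 _] := sawtooth_itv z a0.
by rewrite ler_norml; apply/andP; split; lra.
Qed.

Variables (d : measure_display) (S : measurableType d) (P : probability S R).
(* Two maps at once, in order to compare the measures that they induce on the torus. *)
Variable g : bool -> S -> torus R.
Hypothesis mg : forall i, measurable_fun setT (g i).

(** The principle of good sets: these sets form a sigma-algebra that contains the strips given by a
    ray in one coordinate, hence all Borel sets. *)
Let approximable (A : set (torus R)) := measurable A /\ forall e : R, 0 < e ->
  exists2 F, testfun F & forall i,
    mean P (fun s => `|\1_A (g i s) - F (tcoord (g i s))|) <= e.

Let mgA i (A : set (torus R)) : measurable A -> measurable (g i @^-1` A).
Proof. by move=> mA; rewrite -[X in measurable X]setTI; exact: mg. Qed.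

Let bmeas_comp i (h : torus R -> R) : bmeas h -> bmeas (h \o g i).
Proof.
move=> [mh [M hM]]; split; first by apply: measurableT_comp => //; exact: mg.
by exists M => s; exact: hM.
Qed.

Let bmeas_diff i A F : measurable A -> testfun F ->
  bmeas (fun s => `|\1_A (g i s) - F (tcoord (g i s))|).
Proof.
move=> mA tF; apply/bmeas_norm/bmeasB.
  exact: (bmeas_comp i (bmeas_indic mA)).
exact: (bmeas_comp i (testfun_bmeas tF)).
Qed.

Let approximable0 : approximable set0.
Proof.
split => // e e0; exists (cst 0); first by apply: testfun_cst; rewrite lexx ler01.
move=> i; rewrite (_ : (fun _ => _) = cst 0); first by rewrite mean1 ltW.
by apply/funext => s; rewrite indic0 subrr normr0.
Qed.

Let approximableC A : approximable A -> approximable (~` A).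
Proof.
move=> [mA H]; split; first exact: measurableC.
move=> e /H[F tF HF]; exists (fun x => 1 - F x); first exact: testfunC.
move=> i; apply: le_trans (HF i); rewrite le_eqVlt; apply/orP; left; apply/eqP.
apply: eq_mean => s; rewrite !indicE in_setC.
by case: (_ \in A) => /=; rewrite -[RHS]normrN; congr (`|_|); ring.
Qed.

Let approximableU A B : approximable A -> approximable B -> approximable (A `|` B).
Proof.
move=> [mA HA] [mB HB]; split; first exact: measurableU.
move=> e e0; have e2 : 0 < e / 2 by rewrite divr_gt0.
have [F tF HF] := HA _ e2; have [G tG HG] := HB _ e2.
exists (fun x => 1 - (1 - F x) * (1 - G x)).
  by apply: testfunC; apply: (testfunM (testfunC tF) (testfunC tG)).
move=> i; have tFG : testfun (fun x => 1 - (1 - F x) * (1 - G x)).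
  by apply: testfunC; apply: (testfunM (testfunC tF) (testfunC tG)).
apply: (@le_trans _ _ (mean P (fun s => `|\1_A (g i s) - F (tcoord (g i s))|) +
    mean P (fun s => `|\1_B (g i s) - G (tcoord (g i s))|))); last first.
  by rewrite [leRHS]splitr lerD.
rewrite -(meanD P (bmeas_diff i mA tF) (bmeas_diff i mB tG)).
apply: mean_le => [||s].
- by apply: (bmeas_diff i (measurableU _ _ mA mB) tFG).
- by apply: bmeasD; exact: bmeas_diff.
rewrite /= !indicE in_setU; set x := tcoord (g i s).
have [_ _ /(_ x)/andP[F0 F1]] := tF; have [_ _ /(_ x)/andP[G0 G1]] := tG.
have FG0 : 0 <= (1 - F x) * (1 - G x) by rewrite mulr_ge0// subr_ge0.
have FG1 : 0 <= F x * (1 - G x) by rewrite mulr_ge0// subr_ge0.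
have FG2 : 0 <= (1 - F x) * G x by rewrite mulr_ge0// subr_ge0.
have FG3 : 0 <= F x * G x by rewrite mulr_ge0.
case: (_ \in A); case: (_ \in B) => /=; rewrite -?[0%:R]/0 -?[1%:R]/1 ler_norml;
  have := ler_norm (1 - F x); have := ler_norm (1 - G x);
  have := ler_normr (F x) (0 - F x); have := ler_normr (G x) (0 - G x);
  rewrite !sub0r !opprK !lexx !orbT => h1 h2 h3 h4; apply/andP; split; lra.
Qed.

Let measure_increasing (C : (set (torus R))^nat) : (forall n, measurable (C n)) ->
  nondecreasing_seq C -> forall e : R, 0 < e -> exists N : nat, forall i,
    fine (P (g i @^-1` \bigcup_n C n)) - fine (P (g i @^-1` C N)) <= e.
Proof.
move=> mC ndC e e0.
have H i : \forall n \near \oo, fine (P (g i @^-1` \bigcup_n C n)) - fine (P (g i @^-1` C n)) <= e.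
  have mU : measurable (\bigcup_n C n) by exact: bigcup_measurable.
  have nd : nondecreasing_seq (fun n => g i @^-1` C n).
    move=> m n mn; apply/subsetPset => s; rewrite /preimage/=.
    by have /subsetPset := ndC _ _ mn; apply.
  have := @nondecreasing_cvg_mu _ _ _ P (fun n => g i @^-1` C n) (fun n => mgA i (mC n)).
  rewrite -preimage_bigcup => /(_ (mgA i mU) nd) h.
  have h' : P (g i @^-1` C n) @[n --> \oo] --> (fine (P (g i @^-1` \bigcup_n C n)))%:E.
    by rewrite fineK// fin_num_measure//; exact: mgA.
  have h2 : (fun n => fine (P (g i @^-1` C n))) @ \oo --> fine (P (g i @^-1` \bigcup_n C n)).
    by apply: fine_cvg; exact: h'.
  have /cvgrPdist_le/(_ _ e0) := h2.
  by apply: filterS => n; apply: le_trans; exact: ler_norm.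
have [N0 _ HN0] := H false; have [N1 _ HN1] := H true.
exists (maxn N0 N1) => -[].
  by apply: HN1; rewrite /= leq_maxr.
by apply: HN0; rewrite /= leq_maxl.
Qed.

(** It suffices to approximate the union as well as [C n] does, since continuity from below makes
    the defect small for both maps at a common [n]. *)
Let approximable_limit (C : (set (torus R))^nat) : (forall n, measurable (C n)) ->
  nondecreasing_seq C ->
  (forall n (e : R), 0 < e -> exists2 F, testfun F & forall i,
     mean P (fun s => `|\1_(\bigcup_n C n) (g i s) - F (tcoord (g i s))|) <=
       fine (P (g i @^-1` \bigcup_n C n)) - fine (P (g i @^-1` C n)) + e) ->
  approximable (\bigcup_n C n).
Proof.
move=> mC ndC H; split; first exact: bigcup_measurable.
move=> e e0; have e2 : 0 < e / 2 by rewrite divr_gt0.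
have [N HN] := measure_increasing mC ndC e2.
have [F tF HF] := H N _ e2.
by exists F => // i; rewrite (le_trans (HF i))// [leRHS]splitr lerD.
Qed.

Let mean_diff_indic i A B : measurable A -> measurable B -> B `<=` A ->
  mean P (fun s => \1_A (g i s) - \1_B (g i s)) = fine (P (g i @^-1` A)) - fine (P (g i @^-1` B)).
Proof.
move=> mA mB BA.
have E C : measurable C -> mean P (fun s => \1_C (g i s)) = fine (P (g i @^-1` C)).
  by move=> mC; rewrite -(mean_indicP P (mgA i mC)).
by rewrite -E// -E// -meanB//; exact: (bmeas_comp i (bmeas_indic _)).
Qed.

Let approximable_bigcup (A : (set (torus R))^nat) : (forall n, approximable (A n)) ->
  approximable (\bigcup_n A n).
Proof.
move=> aA.
pose C n := \big[setU/set0]_(k < n) A k.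
have aC n : approximable (C n).
  rewrite /C; elim: n => [|n IH]; first by rewrite big_ord0.
  by rewrite big_ord_recr /=; exact: approximableU.
have EC : \bigcup_n C n = \bigcup_n A n.
  apply/seteqP; split=> x [n _].
    by rewrite /C -bigcup_mkord => -[k /= kn Ax]; exists k.
  by move=> Ax; exists n.+1 => //; rewrite /C -bigcup_mkord; exists n => //=.
have mC n : measurable (C n) by have [] := aC n.
rewrite -EC; apply: approximable_limit => //.
  move=> m n mn; apply/subsetPset; rewrite /C -!bigcup_mkord => x [k /= km Ax].
  by exists k => //=; exact: leq_trans km mn.
move=> n e e0; have [_ /(_ _ e0)[F tF HF]] := aC n; exists F => // i.
have mU : measurable (\bigcup_n C n) by exact: bigcup_measurable.
have sub : C n `<=` \bigcup_n C n by move=> x Cx; exists n.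
rewrite -mean_diff_indic//.
apply: le_trans (lerD (lexx _) (HF i)).
have bC A' : measurable A' -> bmeas (fun s => \1_A' (g i s) : R).
  by move=> mA'; exact: (bmeas_comp i (bmeas_indic mA')).
rewrite -meanD; [|exact: (bmeasB (bC _ mU) (bC _ (mC n)))|exact: bmeas_diff].
apply: mean_le; first exact: bmeas_diff.
  by apply: bmeasD; [exact: (bmeasB (bC _ mU) (bC _ (mC n)))|exact: bmeas_diff].
move=> s; rewrite -(subrKA (\1_(C n) (g i s))) (le_trans (ler_normD _ _))// lerD2r.
rewrite !indicE; case: (boolP (g i s \in C n)) => [|_] /=; last first.
  by rewrite subr0; case: (_ \in _) => /=; rewrite ?normr1 ?normr0.
rewrite inE => /sub h; rewrite mem_set//= subrr normr0//.
Qed.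

(** The set is the increasing union of the sets where [n * G0] is at least 1. The truncation of
    [n * G0] at 1 equals 1 there and vanishes off the union, so it errs only on the difference. *)
Let approximable_pos G0 L : periodic2 G0 -> lip2 G0 L -> (forall x, 0 <= G0 x <= 1) ->
  approximable [set p | 0 < G0 (tcoord p)].
Proof.
move=> pG lG bG.
have tG : testfun G0 by split=> //; exists L.
pose C (n : nat) := [set p : torus R | 1 <= n%:R * G0 (tcoord p)].
have EC : \bigcup_n C n = [set p | 0 < G0 (tcoord p)].
  apply/seteqP; split=> p /=.
    move=> [n _]; rewrite /C /= => h; have /andP[g0 _] := bG (tcoord p).
    rewrite lt_neqAle g0 andbT; apply/eqP => E; move: h; rewrite -E mulr0.
    by rewrite ler10.
  move=> g0; exists (Num.bound ((G0 (tcoord p))^-1)) => //; rewrite /C/=.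
  have gi : 0 < (G0 (tcoord p))^-1 by rewrite invr_gt0.
  have /ltW := archi_boundP (ltW gi).
  by rewrite -[X in X <= _ -> _]div1r ler_pdivrMr.
have mC n : measurable (C n).
  have [mG _] := testfun_bmeas tG.
  have : measurable_fun setT (fun p => n%:R * G0 (tcoord p)) by exact: measurable_funM.
  move=> /(_ measurableT `[1, +oo[%classic (measurable_itv _)); rewrite setTI.
  by congr measurable; apply/seteqP; split=> p; rewrite /preimage/= in_itv/= andbT.
rewrite -EC; apply: approximable_limit => //.
  move=> m n mn; apply/subsetPset => p; rewrite /C/= => /le_trans; apply.
  by have /andP[g0 _] := bG (tcoord p); rewrite ler_wpM2r// ler_nat.
move=> n e e0.
pose F x := Num.min (n%:R * G0 x) 1.
have tF : testfun F.
  split.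
  - by move=> x k l; rewrite /F pG.
  - exists (n%:R * L) => x y; apply: le_trans (min_lip _ _ _ _) _.
    rewrite subrr normr0 ge_max mulr_ge0 ?mulr_ge0 ?(lip2_ge0 lG)// andbT.
    by rewrite -mulrBr normrM ger0_norm// -mulrA ler_wpM2l.
  - move=> x; have /andP[g0 _] := bG x.
    by rewrite /F le_min ler01 mulr_ge0//= ge_min lexx orbT.
exists F => // i.
have mU : measurable (\bigcup_n C n) by exact: bigcup_measurable.
have sub : C n `<=` \bigcup_n C n by move=> x Cx; exists n.
rewrite -mean_diff_indic//.
have bC A' : measurable A' -> bmeas (fun s => \1_A' (g i s) : R).
  by move=> mA'; exact: (bmeas_comp i (bmeas_indic mA')).
apply: (@le_trans _ _ (mean P (fun s => \1_(\bigcup_n C n) (g i s) - \1_(C n) (g i s)))); last first.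
  by rewrite lerDl ltW.
apply: mean_le; [exact: bmeas_diff|exact: (bmeasB (bC _ mU) (bC _ (mC n)))|].
move=> s; set p := g i s; have [_ _ /(_ (tcoord p))/andP[F0 F1]] := tF.
rewrite !indicE; case: (boolP (p \in C n)) => [|pC] /=.
  rewrite inE => Cp; have /sub h := Cp; rewrite mem_set//=.
  have -> : F (tcoord p) = 1 by rewrite /F; apply/min_idPr; exact: Cp.
  by rewrite !subrr normr0.
case: (boolP (p \in _)) => /= pU.
  by rewrite subr0 ger0_norm ?subr_ge0// lerBlDr lerDl.
have -> : F (tcoord p) = 0.
  have : ~ (\bigcup_n C n) p by move: pU; rewrite notin_setE.
  rewrite EC /= => /negP; rewrite -leNgt => g0'.
  have /andP[g0 _] := bG (tcoord p).
  have -> : F (tcoord p) = Num.min (n%:R * 0) 1.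
    by rewrite /F; congr (Num.min (_ * _) _); apply/eqP; rewrite eq_le g0 g0'.
  by rewrite mulr0; apply/min_idPl; exact: ler01.
by rewrite subr0 normr0.
Qed.

Let approximable_ray (pr : R * R -> R) a :
  (forall x y, `|pr x - pr y| <= `|x - y|) ->
  (forall x (k l : int), exists j : int, pr (x.1 + k%:~R, x.2 + l%:~R) = pr x + j%:~R) ->
  (forall p, 0 <= pr (tcoord p) < 1) ->
  approximable [set p | a < pr (tcoord p)].
Proof.
move=> lpr ppr bpr; have [a0|a0] := ltP a 0.
  rewrite (_ : [set p | _] = ~` set0); first exact: approximableC.
  rewrite setC0; apply/seteqP; split => // p _ /=.
  by have /andP[h _] := bpr p; exact: lt_le_trans h.
have := @approximable_pos (sawtooth a \o pr) 1.
rewrite (_ : [set p | 0 < (sawtooth a \o pr) (tcoord p)] = [set p | a < pr (tcoord p)]).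
  apply.
  - move=> x k l /=; have [j ->] := ppr x k l.
    by rewrite /sawtooth fracpDz.
  - move=> x y; apply: le_trans (sawtooth_lip a0 _ _) _.
    by rewrite !mul1r.
  - by move=> x; exact: sawtooth_itv.
apply/seteqP; split=> p /=; have /andP[h1 h2] := bpr p.
  by rewrite /sawtooth fracp_id ?h1//; rewrite lt_max ltxx /= lt_min subr_gt0 => /andP[].
by rewrite /sawtooth fracp_id ?h1// => h; rewrite lt_max ltxx /= lt_min !subr_gt0 h h2.
Qed.

Let approximable_sigma (T : Type) (f : torus R -> T) :
  sigma_algebra [set: T] [set E | approximable (f @^-1` E)].
Proof.
split => /=.
- by rewrite preimage_set0; exact: approximable0.
- by move=> A hA; rewrite setTD preimage_setC; exact: approximableC.
- by move=> A hA; rewrite preimage_bigcup; exact: approximable_bigcup.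
Qed.

Let approximable_proj (pr : R * R -> R) (B : set R) :
  (forall x y, `|pr x - pr y| <= `|x - y|) ->
  (forall x (k l : int), exists j : int, pr (x.1 + k%:~R, x.2 + l%:~R) = pr x + j%:~R) ->
  (forall p, 0 <= pr (tcoord p) < 1) -> measurable B ->
  approximable [set p | B (pr (tcoord p))].
Proof.
move=> lpr ppr bpr.
rewrite [measurable]RGenOInfty.measurableE => mB.
apply: (smallest_sub (approximable_sigma (fun p => pr (tcoord p))) _ mB).
move=> _ [a ->] /=.
have := approximable_ray a lpr ppr bpr; congr approximable.
by apply/seteqP; split => p; rewrite /preimage/= in_itv/= andbT.
Qed.

Lemma torus_approximation A : measurable A -> forall e : R, 0 < e ->
  exists2 F, testfun F & forall i,
    mean P (fun s => `|\1_A (g i s) - F (tcoord (g i s))|) <= e.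
Proof.
move=> mA; suff [] : approximable A by [].
have mE := measurable_torusE mA.
have -> : A = tcoord @^-1` (@torusPi R @^-1` A).
  by apply/funext => p; rewrite /preimage/= tcoordK.
apply: (smallest_sub (approximable_sigma tcoord) _ mE).
have sq (p : torus R) : 0 <= (tcoord p).1 < 1 /\ 0 <= (tcoord p).2 < 1.
  by have [/=] := tcoord_square p; rewrite !in_itv.
rewrite subUset; split=> _ [B mB <-] /=; rewrite setTI.
  apply: (@approximable_proj fst) => //.
  - by move=> x y; exact: (normr_fst_le (x - y)).
  - by move=> x k l; exists k.
  - by move=> p; exact: (proj1 (sq p)).
apply: (@approximable_proj snd) => //.
- by move=> x y; exact: (normr_snd_le (x - y)).
- by move=> x k l; exists l.
- by move=> p; exact: (proj2 (sq p)).
Qed.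

End TorusApproximation.

(** * Torus maps given by equivariant lifts *)

Section TorusMaps.
Context {R : realType}.
Implicit Types (f g : R * R -> R * R) (F G : R * R -> R) (x y z : R * R) (p : torus R).

Definition equiv2 f := forall x (k l : int),
  f (x.1 + k%:~R, x.2 + l%:~R) = ((f x).1 + k%:~R, (f x).2 + l%:~R).

Definition lipmap f := exists2 C : R, 0 <= C & forall x y, `|f x - f y| <= C * `|x - y|.

(** Invariance of the measure, tested on Lipschitz functions only: in this form it follows from
    Riemann sums for shears and passes to uniform limits. *)
Definition tE_preserving f := forall F L, periodic2 F -> lip2 F L -> tE (F \o f) = tE F.

Definition tmap f p : torus R := torusPi (f (tcoord p)).

Lemma equiv2_comp f g : equiv2 f -> equiv2 g -> equiv2 (f \o g).
Proof. by move=> ef eg x k l /=; rewrite eg ef. Qed.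

Lemma lipmap_comp f g : lipmap f -> lipmap g -> lipmap (f \o g).
Proof.
move=> [C C0 fC] [D D0 gD]; exists (C * D); first exact: mulr_ge0.
by move=> x y; apply: le_trans (fC _ _) _; rewrite -mulrA ler_wpM2l.
Qed.

Lemma lip2_lipmap F L f : lip2 F L -> lipmap f -> exists L', lip2 (F \o f) L'.
Proof. by move=> lF [C _ fC]; exists (L * C); exact: lip2_comp lF fC. Qed.

Lemma periodic2_comp F f : periodic2 F -> equiv2 f -> periodic2 (F \o f).
Proof. by move=> pF ef x k l /=; rewrite ef pF. Qed.

Lemma tE_preserving_comp f g : equiv2 f -> lipmap f -> tE_preserving f -> tE_preserving g ->
  tE_preserving (f \o g).
Proof.
move=> ef lf pf pg F L pF lF; have [L' lF'] := lip2_lipmap lF lf.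
by rewrite -(pf F L)// -(pg (F \o f) L')//; exact: periodic2_comp.
Qed.

Lemma lipmap_iter f n : lipmap f -> lipmap (iter n f).
Proof.
move=> lf; elim: n => [|n IH]; last exact: (lipmap_comp lf IH).
by exists 1 => // x y; rewrite mul1r.
Qed.

Lemma tmap_pi f x : equiv2 f -> tmap f (torusPi x) = torusPi (f x).
Proof.
move=> ef; rewrite /tmap tcoord_pi; apply/torusPiP.
exists (- Num.floor x.1), (- Num.floor x.2).
by rewrite -ef /fracp2 /fracp !mulrNz.
Qed.

Lemma periodic2_tcoord F y : periodic2 F -> F (tcoord (torusPi y)) = F y.
Proof.
move=> pF; rewrite tcoord_pi -[RHS](pF y (- Num.floor y.1) (- Num.floor y.2)).
by rewrite /fracp2 /fracp !mulrNz.
Qed.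

Lemma tmap_comp f g p : equiv2 f -> tmap f (tmap g p) = tmap (f \o g) p.
Proof. by move=> ef; rewrite {2}/tmap tmap_pi. Qed.

Lemma iter_tmap f n p : equiv2 f -> iter n (tmap f) p = tmap (iter n f) p.
Proof.
move=> ef; elim: n => [|n IH]; first by rewrite /tmap /= tcoordK.
by rewrite iterS IH tmap_comp.
Qed.

Lemma tmap_cancel f g : equiv2 f -> cancel g f -> cancel (tmap g) (tmap f).
Proof. by move=> ef fg p; rewrite tmap_comp// /tmap /= fg tcoordK. Qed.

Lemma measurable_tmap f : lipmap f -> measurable_fun setT (tmap f).
Proof.
move=> [C _ fC]; apply: measurable_to_torus.
have -> : tcoord \o tmap f = fracp2 \o (f \o tcoord).
  by apply/funext => p; rewrite /tmap /= tcoord_pi.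
have [m1 _] : bmeas ((fst \o f) \o @tcoord R).
  by apply: (@bmeas_lip2 _ _ C) => x y; exact: le_trans (normr_fst_le (f x - f y)) _.
have [m2 _] : bmeas ((snd \o f) \o @tcoord R).
  by apply: (@bmeas_lip2 _ _ C) => x y; exact: le_trans (normr_snd_le (f x - f y)) _.
apply: measurable_fun_pair.
  exact: (measurableT_comp (@measurable_fracp R) m1).
exact: (measurableT_comp (@measurable_fracp R) m2).
Qed.

Lemma mean_dist_le (d : measure_display) (S : measurableType d) (P : probability S R)
  (u v : S -> R) (e : R) : bmeas u -> bmeas v -> mean P (fun s => `|u s - v s|) <= e ->
  `|mean P u - mean P v| <= e.
Proof.
by move=> bu bv; apply: le_trans; rewrite -meanB//; apply: mean_norm; exact: bmeasB.
Qed.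

(** The test function must approximate the indicator of [A] also for the image measure, which is not
    yet known to be Haar measure; hence the simultaneous approximation for the identity and
    [tmap f]. *)
Lemma tmap_measure_preserving f : equiv2 f -> lipmap f -> tE_preserving f ->
  measurePreserving (tmap f).
Proof.
move=> ef lf pf; have mf := measurable_tmap lf; split=> // A mA.
have mfA : measurable (tmap f @^-1` A) by rewrite -[X in measurable X]setTI; exact: mf.
suff H : fine (torusMeasure (tmap f @^-1` A)) = fine (torusMeasure A).
  by rewrite -[LHS]fineK ?fin_num_measure// -[RHS]fineK ?fin_num_measure// H.
apply/eqP; rewrite -subr_eq0 -normr_le0; apply/ler_addgt0Pr => e e0; rewrite add0r.
have e2 : 0 < e / 2 by rewrite divr_gt0.
pose g (i : bool) := if i then tmap f else idfun : torus R -> torus R.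
have mg i : measurable_fun setT (g i) by case: i => //=; exact: measurable_id.
have [F tF HF] := torus_approximation (@torusMeasure R) mg mA e2.
have [pF [L lF] _] := tF.
have [L' lF'] := lip2_lipmap lF lf.
have h1 : `|fine (torusMeasure A) - tE F| <= e / 2.
  rewrite -(mean_indicP _ mA); apply: mean_dist_le (HF false).
    exact: bmeas_indic.
  exact: bmeas_lip2 lF.
have h2 : `|fine (torusMeasure (tmap f @^-1` A)) - tE F| <= e / 2.
  rewrite -(pf _ _ pF lF) -(mean_indicP _ mfA).
  have E p : F (tcoord (tmap f p)) = F (f (tcoord p)) by rewrite /tmap periodic2_tcoord.
  apply: mean_dist_le; first exact: bmeas_indic.
    exact: bmeas_lip2 lF'.
  by apply: le_trans (HF true); rewrite le_eqVlt; apply/orP; left; apply/eqP/eq_mean => p; rewrite /= -E.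
rewrite -(subrKA (tE F)) (le_trans (ler_normD _ _))// [leRHS]splitr lerD//.
by rewrite distrC.
Qed.

Lemma mean_invariant (d : measure_display) (S : measurableType d) (P : probability S R)
  (T : S -> S) (h : S -> R) : measurable_fun setT T ->
  (forall B, measurable B -> P (T @^-1` B) = P B) -> bmeas h -> mean P (h \o T) = mean P h.
Proof.
move=> mT pT bh; rewrite /mean /Rintegral; congr fine.
have [mh [M hM]] := bh.
have bhT : bmeas (h \o T) by split; [exact: measurableT_comp|exists M => p; exact: hM].
have E := @integral_pushforward _ _ _ _ _ T mT P setT (EFin \o h).
rewrite preimage_setT in E; rewrite -E//.
- by apply: eq_measure_integral => A mA _; exact: pT.
- by apply/measurable_EFinP.
- exact: bmeas_integrable.
Qed.

Lemma mean_preserving (T : torus R -> torus R) (h : torus R -> R) :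
  measurePreserving T -> bmeas h -> mean (@torusMeasure R) (h \o T) = mean (@torusMeasure R) h.
Proof. by move=> [mT pT]; exact: (@mean_invariant _ _ (@torusMeasure R)). Qed.

Lemma iter_measurePreserving (T : torus R -> torus R) n :
  measurePreserving T -> measurePreserving (iter n T).
Proof.
move=> [mT pT]; split; first exact: iter_measurable.
by move=> A mA; exact: (@iter_preimage_measure _ _ _ (@torusMeasure R)).
Qed.

Lemma mixing_sets (f : R * R -> R * R) (m : nat -> nat) :
  equiv2 f -> lipmap f -> tE_preserving f ->
  (forall F G, testfun F -> testfun G ->
    (fun k => tE (fun x => F (iter (m k) f x) * G x)) @ \oo --> tE F * tE G) ->
  forall A B, measurable A -> measurable B ->
    (fun k => fine (torusMeasure (iter (m k) (tmap f) @^-1` A `&` B))) @ \oo -->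
    fine (@torusMeasure R A) * fine (@torusMeasure R B).
Proof.
move=> ef lf pf H A B mA mB; apply/cvgrPdist_le => e e0.
(* Replacing the indicators costs two parts in the product of measures and two in the correlation;
   the fifth is for the convergence itself. *)
have e5 : 0 < e / 5 by rewrite divr_gt0.
pose g (i : bool) := idfun : torus R -> torus R.
have mg i : measurable_fun setT (g i) by exact: measurable_id.
have [F tF HF] := torus_approximation (@torusMeasure R) mg mA e5.
have [G tG HG] := torus_approximation (@torusMeasure R) mg mB e5.
have {}HF := HF true; have {}HG := HG true.
have [pF [L lF] bF] := tF; have [pG [L' lG] bG] := tG.
have bA : bmeas (\1_A : torus R -> R) := bmeas_indic mA.
have bB : bmeas (\1_B : torus R -> R) := bmeas_indic mB.
have bF' := testfun_bmeas tF; have bG' := testfun_bmeas tG.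
have i1 (C : set (torus R)) p : `|\1_C p : R| <= 1.
  by rewrite indicE; case: (_ \in _); rewrite ?normr1 ?normr0.
have h1 : `|fine (torusMeasure A) - tE F| <= e / 5.
  by rewrite -(mean_indicP _ mA); apply: mean_dist_le HF.
have h2 : `|fine (torusMeasure B) - tE G| <= e / 5.
  by rewrite -(mean_indicP _ mB); apply: mean_dist_le HG.
have a1 : `|fine (@torusMeasure R A)| <= 1.
  by rewrite -(mean_indicP _ mA); apply: mean_abs_le1.
have a2 : `|tE G| <= 1 by apply: mean_abs_le1 => // p; exact: testfun_norm.
have h3 : `|fine (torusMeasure A) * fine (torusMeasure B) - tE F * tE G| <= e / 5 + e / 5.
  have -> : fine (torusMeasure A) * fine (torusMeasure B) - tE F * tE G =
    fine (torusMeasure A) * (fine (torusMeasure B) - tE G) + (fine (torusMeasure A) - tE F) * tE G by ring.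
  rewrite (le_trans (ler_normD _ _))// !normrM lerD//.
    by apply: le_trans h2; rewrite ler_piMl.
  by apply: le_trans h1; rewrite ler_piMr.
have h4 k : `|fine (torusMeasure (iter (m k) (tmap f) @^-1` A `&` B)) -
    tE (fun x => F (iter (m k) f x) * G x)| <= e / 5 + e / 5.
  set T := iter (m k) (tmap f).
  have TP : measurePreserving T by apply: iter_measurePreserving; exact: tmap_measure_preserving.
  have [mT _] := TP.
  have mTA : measurable (T @^-1` A) by rewrite -[X in measurable X]setTI; exact: mT.
  have bT (h : torus R -> R) : bmeas h -> bmeas (h \o T).
    by move=> [mh [M hM]]; split; [exact: measurableT_comp|exists M => p; exact: hM].
  have -> : tE (fun x => F (iter (m k) f x) * G x) =
      mean (@torusMeasure R) (fun p => F (tcoord (T p)) * G (tcoord p)).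
    by apply: eq_mean => p /=; rewrite /T iter_tmap// /tmap periodic2_tcoord.
  have -> : fine (torusMeasure (T @^-1` A `&` B)) =
      mean (@torusMeasure R) (fun p => \1_A (T p) * \1_B p).
    rewrite -(mean_indicP _ (measurableI _ _ mTA mB)); apply: eq_mean => p.
    by rewrite !indicE in_setI -natrM mulnb; congr (_ && _)%:R; apply/idP/idP; rewrite !inE.
  have b1 := bmeasM (bT _ bA) bB; have b2 := bmeasM (bT _ bF') bG'.
  apply: mean_dist_le => //.
  have b3 : bmeas (fun p => `|\1_A p - F (tcoord p)|) by apply/bmeas_norm/bmeasB.
  have b4 : bmeas (fun p => `|\1_B p - G (tcoord p)|) by apply/bmeas_norm/bmeasB.
  apply: (@le_trans _ _ (mean (@torusMeasure R) (fun p => `|\1_A (T p) - F (tcoord (T p))| + `|\1_B p - G (tcoord p)|))).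
    apply: mean_le; first by apply/bmeas_norm/(bmeasB b1 b2).
      exact: bmeasD (bT _ b3) b4.
    move=> p; have -> : \1_A (T p) * \1_B p - F (tcoord (T p)) * G (tcoord p) =
      (\1_A (T p) - F (tcoord (T p))) * \1_B p + F (tcoord (T p)) * (\1_B p - G (tcoord p)) by ring.
    rewrite (le_trans (ler_normD _ _))// !normrM lerD//.
      by rewrite ler_piMr.
    by rewrite ler_piMl// testfun_norm.
  rewrite (@meanD _ _ _ _ (fun p => `|\1_A (T p) - F (tcoord (T p))|) _ (bT _ b3) b4).
  by rewrite lerD// (mean_preserving TP b3).
have := H F G tF tG => /cvgrPdist_le/(_ _ e5).
apply: filterS => k h5.
have -> : e = (e / 5 + e / 5) + (e / 5 + (e / 5 + e / 5)) by field.
rewrite -(subrKA (tE F * tE G)) (le_trans (ler_normD _ _))// lerD//.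
rewrite -(subrKA (tE (fun x => F (iter (m k) f x) * G x))) (le_trans (ler_normD _ _))// lerD//.
by rewrite distrC.
Qed.

(** Weak mixing is stated with forward images, which are preimages under the inverse, so the
    criterion is applied to [tmap g]. Its mixing along [m] follows from that of [tmap f] by
    exchanging the two sets. *)
Lemma torus_weak_mixing f g (m : nat -> nat) : equiv2 f -> equiv2 g -> lipmap f -> lipmap g ->
  tE_preserving f -> tE_preserving g -> cancel f g -> cancel g f ->
  (forall F G, testfun F -> testfun G ->
    (fun k => tE (fun x => F (iter (m k) f x) * G x)) @ \oo --> tE F * tE G) ->
  weakMixing (tmap f).
Proof.
move=> ef eg lf lg pf pg fg gf H; have Pf := tmap_measure_preserving ef lf pf.
split=> // A B mA mB.
have [mg Pg] := tmap_measure_preserving eg lg pg.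
have FG := tmap_cancel eg fg; have GF := tmap_cancel ef gf.
have ifg n : cancel (iter n (tmap f)) (iter n (tmap g)).
  by elim: n => [//|n IH] p; rewrite iterSr (iterS n (tmap f)) FG IH.
have igf n : cancel (iter n (tmap g)) (iter n (tmap f)).
  by elim: n => [//|n IH] p; rewrite iterSr (iterS n (tmap g)) GF IH.
have E n : iter n (tmap f) @` A = iter n (tmap g) @^-1` A.
  apply/seteqP; split=> p /=; first by move=> [r Ar <-]; rewrite ifg.
  by move=> Ap; exists (iter n (tmap g) p); rewrite // igf.
have E2 (X Y : set (torus R)) k : measurable X -> measurable Y ->
    torusMeasure (iter k (tmap g) @^-1` X `&` Y) = torusMeasure (iter k (tmap f) @^-1` Y `&` X).
  move=> mX mY; have [mfk Pfk] := iter_measurePreserving k Pf.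
  have mgk := iter_measurable k mg.
  rewrite -Pfk; last first.
    by apply: measurableI => //; rewrite -[X in measurable X]setTI; exact: mgk.
  rewrite setIC preimage_setI; congr (torusMeasure (_ `&` _)).
  by apply/seteqP; split => p; rewrite /preimage/= ifg.
under eq_fun do under eq_bigr do rewrite E.
apply: (@weak_mixing_of_mixing_sequence _ _ _ (@torusMeasure R) (tmap g) m) => // X Y mX mY.
have M := mixing_sets ef lf pf H mY mX; rewrite mulrC in M.
by apply: cvg_trans M; apply: near_eq_cvg; near=> k; congr fine; exact: esym (E2 _ _ _ mX mY).
Unshelve. all: by end_near.
Qed.

End TorusMaps.

(** * The rotation number *)

Section RotationNumber.
Context {R : realType}.
Variable q : nat -> nat.
Hypothesis q6 : forall n, (6 <= q n)%N.
Hypothesis q_growth : forall n, (q n ^ q n <= q n.+1)%N.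

Lemma growth_double n : (2 * q n <= q n.+1)%N.
Proof.
apply: leq_trans (q_growth n); have h := q6 n.
apply: (@leq_trans (q n ^ 2)); last by rewrite leq_exp2l; lia.
by rewrite -mulnn leq_mul2r; apply/orP; right; lia.
Qed.

Lemma growth_ltn n : (q n < q n.+1)%N.
Proof. by have := growth_double n; have := q6 n; lia. Qed.

Lemma growth_homo : {homo q : i j / (i < j)%N}.
Proof. by apply: homo_ltn growth_ltn => a b c; exact: ltn_trans. Qed.

Lemma growth_homo_leq : {homo q : i j / (i <= j)%N}.
Proof. by apply: homo_leq => // [a b c|n]; [exact: leq_trans|exact: ltnW (growth_ltn n)]. Qed.

Lemma growth_ge n : (n <= q n)%N.
Proof. by elim: n => [//|n IH]; exact: leq_trans (growth_ltn n). Qed.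

(** Each fraction [numer n / q n] is the smallest one with its denominator that strictly exceeds its
    predecessor. Strictness will make [q n * al - p n] positive, without which no mixing time would
    exist. *)
Fixpoint numer (n : nat) : nat := if n is m.+1 then ((q m.+1 * numer m) %/ q m).+1 else 0%N.

Let ratio n : R := (numer n)%:R / (q n)%:R.

Let qpos n : 0 < (q n)%:R :> R. Proof. by rewrite ltr0n; have := q6 n; lia. Qed.

Lemma ratio_step n : ratio n < ratio n.+1 <= ratio n + (q n.+1)%:R^-1.
Proof.
have q0 : (0 < q n)%N by have := q6 n; lia.
have e1 := divn_eq (q n.+1 * numer n) (q n); have e2 := ltn_pmod (q n.+1 * numer n) q0.
have E1 : (q n.+1)%:R * (numer n)%:R < (numer n.+1)%:R * (q n)%:R :> R.
  by rewrite -!natrM ltr_nat /=; lia.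
have E2 : (numer n.+1)%:R * (q n)%:R <= (q n.+1)%:R * (numer n)%:R + (q n)%:R :> R.
  by rewrite -!natrM -natrD ler_nat /=; lia.
apply/andP; split.
  by rewrite /ratio ltr_pdivrMr// mulrAC ltr_pdivlMr// mulrC.
rewrite /ratio ler_pdivrMr// mulrDl mulVf ?gt_eqF// -(ler_pM2r (qpos n)).
apply: le_trans E2 _; rewrite mulrDl mul1r lerD2r le_eqVlt; apply/orP; left; apply/eqP.
by field; rewrite gt_eqF.
Qed.

Lemma ratio_incr m n : (m <= n)%N -> ratio m <= ratio n.
Proof.
elim: n => [|n IH]; first by rewrite leqn0 => /eqP ->.
rewrite leq_eqVlt => /orP[/eqP -> //|mn].
by have /andP[/ltW h _] := ratio_step n; exact: le_trans (IH mn) h.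
Qed.

(** The upper ends decrease because a step adds at most [1 / q n.+1] to the ratio, while the
    correction drops by at least that much as [q] doubles. *)
Lemma ratio_upper m n : (m <= n)%N ->
  ratio n + 2 / (q n.+1)%:R <= ratio m + 2 / (q m.+1)%:R.
Proof.
elim: n => [|n IH]; first by rewrite leqn0 => /eqP ->.
rewrite leq_eqVlt => /orP[/eqP -> //|mn]; apply: le_trans (IH mn).
have /andP[_ h] := ratio_step n.
have h2 : 2 / (q n.+2)%:R <= (q n.+1)%:R^-1 :> R.
  rewrite ler_pdivrMr// mulrC ler_pdivlMr// -natrM ler_nat; exact: growth_double.
rewrite (_ : ratio n + 2 / (q n.+1)%:R = (ratio n + (q n.+1)%:R^-1) + (q n.+1)%:R^-1); last by ring.
exact: lerD.
Qed.

Lemma liouville_number : exists (al : R) (p : nat -> nat), forall n,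
  0 < (q n)%:R * al - (p n)%:R <= 2 * (q n)%:R / (q n.+1)%:R.
Proof.
pose E := [set ratio n | n in [set: nat]].
have ub m : ubound E (ratio m + 2 / (q m.+1)%:R).
  move=> _ [n _ <-]; have [mn|/ltnW nm] := leqP m n.
    apply: le_trans (ratio_upper mn); rewrite lerDl divr_ge0// ltW//.
  by apply: le_trans (ratio_incr nm) _; rewrite lerDl divr_ge0// ltW.
have E0 : E !=set0 by exists (ratio 0), 0%N.
have hE : has_sup E by split=> //; exists (ratio 0 + 2 / (q 1)%:R).
exists (sup E), numer => n.
have h1 : ratio n < sup E.
  have /andP[h _] := ratio_step n; apply: lt_le_trans h _.
  by apply: ub_le_sup; [case: hE|exists n.+1].
have h2 : sup E <= ratio n + 2 / (q n.+1)%:R by apply: ge_sup.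
have eq : (q n)%:R * sup E - (numer n)%:R = (q n)%:R * (sup E - ratio n).
  by rewrite /ratio; field; rewrite gt_eqF.
rewrite eq; apply/andP; split; first by rewrite mulr_gt0// subr_gt0.
rewrite (_ : 2 * _ / _ = (q n)%:R * (2 / (q n.+1)%:R)); last by ring.
by rewrite ler_pM2l// lerBlDl.
Qed.

End RotationNumber.

(** * Size of the sine at multiples of the rotation number *)

Section SmallSine.
Context {R : realType}.

Lemma pi_le4 : (pi : R) <= 4.
Proof. by have := pihalf_lt2 R; lra. Qed.

Lemma sinDnpi_norm (x : R) (n : nat) : `|sin (x + pi * n%:R)| = `|sin x|.
Proof.
elim: n => [|n IH]; first by rewrite mulr0 addr0.
by rewrite -[n.+1%:R]natr1 mulrDr mulr1 addrA (@sinDpi R) normrN.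
Qed.

Lemma norm_sin_pi (x y : R) (k : int) : x = y + k%:~R -> `|sin (pi * x)| = `|sin (pi * y)|.
Proof.
move=> ->; case: k => n; first by rewrite mulrDr; exact: sinDnpi_norm.
by rewrite NegzE -(sinDnpi_norm _ n.+1); congr (`|sin _|); rewrite mulrNz -pmulrn; ring.
Qed.

Lemma norm_sin_le (x : R) : `|sin (pi * x)| <= 4 * `|x|.
Proof.
apply: le_trans (sin_le_abs _) _; rewrite normrM ger0_norm ?pi_ge0// ler_wpM2r//.
exact: pi_le4.
Qed.

Lemma norm_sin_middle (x : R) : 4^-1 <= x <= 3 / 4 -> 2^-1 <= `|sin (pi * x)|.
Proof.
move=> /andP[x1 x2]; have pi0 := @pi_gt0 R.
have c : cos (2 * (pi * x)) <= 0.
  have -> : 2 * (pi * x) = (2 * (pi * x) - pi / 2) + pi / 2 by ring.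
  rewrite cosD cos_pihalf sin_pihalf mulr0 mulr1 sub0r oppr_le0; apply: sin_ge0_pi.
  by apply/andP; split; nra.
have h : cos (2 * (pi * x)) = 1 - 2 * `|sin (pi * x)| ^+ 2.
  rewrite mulr_natl mulr2n cosD real_normK ?num_real//.
  by have := cos2Dsin2 (pi * x); rewrite !expr2; lra.
have := normr_ge0 (sin (pi * x)); move: c; rewrite h; set s := `|_|; nra.
Qed.

End SmallSine.

Section SmallSineAlong.
Context {R : realType}.
Variables (q : nat -> nat) (al : R) (p : nat -> nat).
Hypothesis q6 : forall n, (6 <= q n)%N.
Hypothesis q_growth : forall n, (q n ^ q n <= q n.+1)%N.
Hypothesis al_approx : forall n, 0 < (q n)%:R * al - (p n)%:R <= 2 * (q n)%:R / (q n.+1)%:R.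

Let eps n : R := (q n)%:R * al - (p n)%:R.

Let qpos n : 0 < (q n)%:R :> R. Proof. by rewrite ltr0n; have := q6 n; lia. Qed.

(** Here the growth beats a prescribed power: [q n.+1] is at least [q n ^ (r + 3)], so [eps n] is at
    most [2 / q n ^ (r + 2)]. *)
Lemma approx_gain (r n : nat) : (r + 3 <= q n)%N ->
  (q n)%:R ^+ r.+1 * (4 * eps n) <= 8 / (q n)%:R.
Proof.
move=> rq; have /andP[e0 e1] := al_approx n.
have h : (q n)%:R ^+ r.+3 <= (q n.+1)%:R :> R.
  rewrite -natrX ler_nat; apply: leq_trans (q_growth n).
  by rewrite leq_pexp2l//; have := q6 n; lia.
have e2 : eps n <= 2 * (q n)%:R / (q n)%:R ^+ r.+3.
  apply: le_trans e1 _; rewrite ler_pM2l ?mulr_gt0// lef_pV2// posrE//.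
  by rewrite exprn_gt0.
apply: (@le_trans _ _ ((q n)%:R ^+ r.+1 * (4 * (2 * (q n)%:R / (q n)%:R ^+ r.+3)))).
  by rewrite ler_pM2l ?exprn_gt0// ler_pM2l.
rewrite le_eqVlt; apply/orP; left; apply/eqP; rewrite !exprS.
by field; rewrite expf_eq0 gt_eqF//= andbF.
Qed.

(** Modulo integers [q N * (j * al)] is [j * eps N]. This settles [j <= M], and also [j = q n] with
    [n <= N], where the spare power in [approx_gain] absorbs the factor [j <= q N]. For [n] beyond
    [N] the roles are exchanged: the product is [q N * eps n], and [q N] is at most [q n]. *)
Lemma small_sine (r M : nat) (e : R) : 0 < e -> exists Q : nat, forall N, (Q <= q N)%N ->
  (forall j, (j <= M)%N -> (q N)%:R ^+ r * `|sin (pi * ((q N)%:R * (j%:R * al)))| <= e) /\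
  (forall n, (q N)%:R ^+ r * `|sin (pi * ((q N)%:R * ((q n)%:R * al)))| <= e).
Proof.
move=> e0; pose Q := (r + 3 + Num.bound (8 * M.+1%:R / e))%N.
exists Q => N QN.
have small n : (Q <= q n)%N -> (q n)%:R ^+ r.+1 * (4 * eps n) <= e / M.+1%:R.
  move=> Qn; apply: le_trans (approx_gain _) _; first by rewrite /Q in Qn; lia.
  rewrite ler_pdivrMr// mulrAC ler_pdivlMr// -ler_pdivrMl// mulrC.
  have p0 : 0 <= 8 * M.+1%:R / e by rewrite divr_ge0 ?mulr_ge0// ltW.
  have /ltW h := archi_boundP p0.
  by apply: le_trans h _; rewrite ler_nat; move: Qn; rewrite /Q; lia.
have epos n : 0 < eps n by have /andP[] := al_approx n.
have M1 : e / M.+1%:R <= e by rewrite ler_pdivrMr// ler_peMr ?ler1n// ltW.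
have q1 n : 1 <= (q n)%:R :> R by rewrite ler1n; have := q6 n; lia.
have below (j : nat) : (j <= M \/ j <= q N)%N ->
    (q N)%:R ^+ r * `|sin (pi * ((q N)%:R * (j%:R * al)))| <= e.
  move=> jM; rewrite (@norm_sin_pi _ _ (j%:R * eps N) (j * p N)%N); last first.
    by rewrite -pmulrn natrM /eps; ring.
  have s1 := norm_sin_le (j%:R * eps N).
  have s2 := small N QN.
  rewrite normrM (ger0_norm (ltW (epos N))) ger0_norm ?ler0n// in s1.
  apply: le_trans (ler_wpM2l _ s1) _; first by rewrite exprn_ge0// ltW.
  have s3 : (q N)%:R ^+ r * (4 * eps N) <= (q N)%:R ^+ r.+1 * (4 * eps N).
    by rewrite ler_pM2r ?mulr_gt0// exprS ler_peMl// exprn_ge0// ltW.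
  have -> : (q N)%:R ^+ r * (4 * (j%:R * eps N)) = j%:R * ((q N)%:R ^+ r * (4 * eps N)) by ring.
  case: jM => jM.
    apply: (@le_trans _ _ (M%:R * (e / M.+1%:R))).
      apply: ler_pM => //; last exact: le_trans s3 s2.
        by rewrite mulr_ge0 ?exprn_ge0 ?mulr_ge0// ltW.
      by rewrite ler_nat.
    rewrite mulrCA ler_piMr ?(ltW e0)// ler_pdivrMr// mul1r ler_nat //.
  apply: le_trans M1; apply: le_trans s2; rewrite exprS -mulrA ler_wpM2r//.
    by rewrite mulr_ge0 ?exprn_ge0 ?mulr_ge0// ltW.
  by rewrite ler_nat.
split=> [j jM|n]; first by apply: below; left.
have [nN|/ltnW Nn] := leqP n N; first by apply: below; right; exact: growth_homo_leq.
have qNn : (q N)%:R <= (q n)%:R :> R by rewrite ler_nat; exact: growth_homo_leq.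
rewrite (@norm_sin_pi _ _ ((q N)%:R * eps n) (q N * p n)%N); last first.
  by rewrite -pmulrn natrM /eps; ring.
apply: le_trans M1; apply: le_trans (small n _); last first.
  by apply: leq_trans QN _; exact: growth_homo_leq.
have s1 := norm_sin_le ((q N)%:R * eps n).
rewrite normrM (ger0_norm (ltW (epos n))) ger0_norm ?ler0n// in s1.
rewrite exprSr -mulrA; apply: ler_pM => //.
- by rewrite lerXn2r// nnegrE ltW.
- apply: le_trans s1 _; rewrite mulrCA ler_wpM2r// mulr_ge0// ltW//.
Qed.

Lemma mixing_time (N : nat) : exists m : nat,
  2^-1 <= `|sin (pi * ((q N)%:R * (m%:R * al)))|.
Proof.
have /andP[e0 e1] := al_approx N.
have e2 : eps N <= 2^-1.
  have := @approx_gain 0 N; rewrite add0n expr1 => /(_ _).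
  have q6' := q6 N; rewrite (leq_trans _ q6')// => /(_ isT) h.
  have : 6 <= (q N)%:R :> R by rewrite ler_nat.
  rewrite ler_pdivlMr// in h; rewrite /eps in h *; move: h; set E := _ - _.
  by set x := (q N)%:R; move=> h x6; nra.
have ex : exists m : nat, 4^-1 <= m%:R * eps N.
  exists (Num.bound ((4 * eps N)^-1)).
  have p4 : 0 < 4 * eps N by rewrite mulr_gt0.
  have := archi_boundP (ltW (_ : 0 < (4 * eps N)^-1)); rewrite invr_gt0 => /(_ p4) /ltW h.
  by rewrite -ler_pdivrMr// -invfM.
pose m := ex_minn ex; exists m.
rewrite (@norm_sin_pi _ _ (m%:R * eps N) (m * p N)%N); last first.
  by rewrite -pmulrn natrM /eps; ring.
apply: norm_sin_middle; rewrite /m; case: ex_minnP => k hk kmin; rewrite hk /=.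
case: k hk kmin => [|k] hk kmin; first by rewrite mul0r; lra.
rewrite -natr1 mulrDl mul1r.
have : k%:R * eps N < 4^-1.
  by rewrite ltNge; apply/negP => /kmin; rewrite ltnn.
move: e2; rewrite /eps; lra.
Qed.

End SmallSineAlong.

(** * The approximation by conjugation *)

Section NiceMaps.
Context {R : realType}.
Implicit Types (f g H K : R * R -> R * R) (F G : R * R -> R) (x y z : R * R) (i : bool).

Definition pj i x : R := if i then x.2 else x.1.

Definition dis i f : R * R -> R := fun x => pj i (f x) - pj i x.

(* Lifts of smooth measure-preserving torus maps homotopic to the identity. *)
Definition nice f :=
  [/\ equiv2 f, forall n, exists M, forall i, CB n (dis i f) M & tE_preserving f].

Lemma norm_pj i x : `|pj i x| <= `|x|.
Proof. by case: i; [exact: normr_snd_le|exact: normr_fst_le]. Qed.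

Lemma norm_pj_le x (c : R) : (forall i, `|pj i x| <= c) -> `|x| <= c.
Proof. by move=> h; rewrite normr_pair_le (h false) (h true). Qed.

Lemma pjB i x y : pj i (x - y) = pj i x - pj i y.
Proof. by case: i. Qed.

Lemma disp_dis f : disp (dis false f) (dis true f) = f.
Proof. by apply/funext => x; rewrite /disp /dis /= addrC subrK addrC subrK -surjective_pairing. Qed.

Lemma dis_disp i (g1 g2 : R * R -> R) : dis i (disp g1 g2) = if i then g2 else g1.
Proof. by apply/funext => x; case: i; rewrite /dis /disp /= addrC addKr. Qed.

Lemma dis_comp i f g : dis i (f \o g) = (dis i f \o g) \+ dis i g.
Proof. by apply/funext => x; rewrite /dis /=; ring. Qed.

Lemma CB_lipmap f M : (forall i, CB 1 (dis i f) M) -> lipmap f.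
Proof.
move=> hf; have M0 : 0 <= M := CB_ge0 (hf true).
exists (1 + 2 * M); first by rewrite addr_ge0 ?mulr_ge0.
move=> x y; apply: norm_pj_le => i; rewrite pjB.
have -> : pj i (f x) - pj i (f y) = pj i (x - y) + (dis i f (y + (x - y)) - dis i f y).
  by rewrite [y + _]addrC subrK pjB /dis; ring.
rewrite (le_trans (ler_normD _ _))// mulrDl mul1r lerD//; first exact: norm_pj.
exact: CB_lip.
Qed.

Lemma nice_lipmap f : nice f -> lipmap f.
Proof. by move=> [_ /(_ 1%N)[M hM] _]; exact: CB_lipmap hM. Qed.

Lemma nice_comp f g : nice f -> nice g -> nice (f \o g).
Proof.
move=> nf ng; have [ef bf pf] := nf; have [eg bg pg] := ng.
split; first exact: equiv2_comp.
  move=> n; have [M hM] := bf n; have [N hN] := bg n.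
  have [C C0 hC] := @CB_comp R n N.
  exists (C * M + N) => i; rewrite dis_comp; apply: CBD => //.
  by rewrite -[g in X in CB _ X _]disp_dis; exact: hC.
exact: tE_preserving_comp (nice_lipmap nf) _ _.
Qed.

Definition hshift (t : R) x : R * R := x + (t, 0).

Lemma hshift0 : hshift 0 = id.
Proof. by apply/funext => x; rewrite /hshift addr0. Qed.

Lemma hshiftD s t x : hshift s (hshift t x) = hshift (s + t) x.
Proof. by rewrite /hshift -addrA; congr (_ + _); rewrite /= addrC; congr pair; rewrite /= addr0. Qed.

Lemma nice_hshift t : nice (hshift t).
Proof.
split=> [x k l|n|F L pF lF]; last exact: tE_trans lF.
  by rewrite /hshift /=; apply/pair_equal_spec; split; rewrite /= addrAC.
exists `|t| => -[].
  apply: (@CB_le _ n _ `|0| _); first by rewrite normr0.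
  by apply: eq_CB (CB_cst n 0) => x; rewrite /dis /hshift /= addr0 subrr.
by apply: eq_CB (CB_cst n t) => x; rewrite /dis /hshift /= addrC addKr.
Qed.

Lemma nice_id : nice (id : R * R -> R * R).
Proof. by rewrite -hshift0; exact: nice_hshift. Qed.

Lemma dis_shear i (q : nat) l th : dis i (shear q (sinwave q l th)) =
  wave (if i then l else q%:R * l) (2 * pi * q%:R) (- (2 * pi * q%:R * q%:R)) th.
Proof.
apply/funext => x; rewrite /dis /shear /sinwave /wave /=.
case: i => /=; rewrite addrC addKr ?mulrA; congr (_ * sin _); ring.
Qed.

Lemma CB_shear n i (q : nat) l th : (0 < q)%N ->
  CB n (dis i (shear q (sinwave q l th))) (q%:R * `|l| * (8 * q%:R ^+ 2) ^+ n).
Proof.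
move=> q0; have q1 : 1 <= q%:R :> R by rewrite ler1n.
have q2 : 1 <= q%:R ^+ 2 :> R by rewrite exprn_ege1.
have pi4 := @pi_le4 R; have pi0 := @pi_gt0 R.
have h1 : q%:R <= q%:R ^+ 2 :> R by rewrite expr2 ler_peMl// (le_trans ler01).
have q0' : 0 <= q%:R :> R by rewrite ler0n.
rewrite dis_shear; apply: (@CB_le _ _ _ (`|if i then l else q%:R * l| * (8 * q%:R ^+ 2) ^+ n)).
  rewrite ler_wpM2r// ?exprn_ge0 ?mulr_ge0 ?exprn_ge0//.
  by case: i; rewrite ?normrM ?(ger0_norm q0')// ler_peMl.
apply: CB_wave; first by lra.
  rewrite ger0_norm ?mulr_ge0 ?(ltW pi0)//.
  apply: ler_pM => //; first by rewrite mulr_ge0// ltW.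
  by lra.
rewrite normrN ger0_norm ?mulr_ge0 ?(ltW pi0)// -mulrA -expr2.
by rewrite ler_wpM2r ?exprn_ge0//; lra.
Qed.

Lemma sinwave_int (q : nat) (l th u : R) (k : int) :
  sinwave q l th (u + k%:~R) = sinwave q l th u.
Proof.
rewrite /sinwave -[in RHS](sinD2zpi _ (q%:Z * k)); congr (_ * sin _).
by rewrite intrM -pmulrn; ring.
Qed.

Lemma equiv2_shear (q : nat) (l th : R) : equiv2 (shear q (sinwave q l th)).
Proof.
move=> x k m; rewrite /shear /=.
have -> : x.1 + k%:~R - q%:R * (x.2 + m%:~R) = x.1 - q%:R * x.2 + (k - q%:Z * m)%:~R.
  by rewrite intrB intrM -pmulrn; ring.
by rewrite sinwave_int; apply/pair_equal_spec; split; rewrite /= addrAC.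
Qed.

Lemma tE_preserving_shear (q : nat) (l th : R) : tE_preserving (shear q (sinwave q l th)).
Proof.
move=> F L pF lF; set v := sinwave q l th.
pose A (s : R) x : R * R := (x.1 + s * x.2, x.2); pose V x : R * R := (x.1, x.2 + v x.1).
have lA s : lipmap (A s).
  exists (1 + `|s|); first by rewrite addr_ge0.
  move=> x y; rewrite normr_pair_le /=; apply/andP; split.
    have -> : x.1 + s * x.2 - (y.1 + s * y.2) = (x - y).1 + s * (x - y).2 by rewrite /=; ring.
    rewrite (le_trans (ler_normD _ _))// mulrDl mul1r lerD ?normr_fst_le// normrM ler_wpM2l//.
    exact: normr_snd_le.
  by rewrite (le_trans (normr_snd_le (x - y)))// ler_peMl// lerDl.
have [C lv] := sinwave_lip q l th; have C0 := lip1_ge0 lv.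
have lV : lipmap V.
  exists (1 + C); first by rewrite addr_ge0.
  move=> x y; rewrite normr_pair_le /=; apply/andP; split.
    by rewrite (le_trans (normr_fst_le (x - y)))// ler_peMl// lerDl.
  have -> : x.2 + v x.1 - (y.2 + v y.1) = (x - y).2 + (v x.1 - v y.1) by rewrite /=; ring.
  rewrite (le_trans (ler_normD _ _))// mulrDl mul1r lerD ?normr_snd_le//.
  by apply: le_trans (lv _ _) _; rewrite ler_wpM2l// (normr_fst_le (x - y)).
have pA : periodic2 (F \o A q%:R).
  move=> x k m; rewrite /= -[RHS](pF _ (k + q%:Z * m) m); congr F; congr pair => /=.
  by rewrite intrD intrM -pmulrn; ring.
have pAV : periodic2 ((F \o A q%:R) \o V).
  move=> x k m; rewrite /= -[RHS](pA _ k m); congr (F (A _ _)); congr pair => /=.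
  by rewrite /v sinwave_int addrAC.
have [L1 l1] := lip2_lipmap lF (lA q%:R).
have [L2 l2] := lip2_lipmap l1 lV.
have [L3 l3] := lip2_lipmap l2 (lA (- q%:R)).
have -> : F \o shear q v = ((F \o A q%:R) \o V) \o A (- q%:R).
  apply/funext => x; rewrite /= /A /V /shear /= mulNr; congr (F (_, _)); ring.
rewrite (tE_shear1 (a := fun u => - q%:R * u) pAV l2 l3).
rewrite (tE_shear2 (a := v) pA l1 l2).
by rewrite (tE_shear1 (a := fun u => q%:R * u) pF lF l1).
Qed.

Lemma nice_shear (q : nat) l th : (0 < q)%N -> nice (shear q (sinwave q l th)).
Proof.
move=> q0; split; [exact: equiv2_shear| |exact: tE_preserving_shear].
by move=> n; exists (q%:R * `|l| * (8 * q%:R ^+ 2) ^+ n) => i; exact: CB_shear.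
Qed.

Definition flow H K (t : R) := H \o hshift t \o K.

Lemma nice_flow H K t : nice H -> nice K -> nice (flow H K t).
Proof. by move=> nH nK; apply: nice_comp nK; apply: nice_comp => //; exact: nice_hshift. Qed.

Definition conjugate_pair H K := [/\ nice H, nice K, cancel H K & cancel K H].

Lemma flowD H K s t x : conjugate_pair H K -> flow H K s (flow H K t x) = flow H K (s + t) x.
Proof. by move=> [_ _ HK _]; rewrite /flow /= HK hshiftD. Qed.

Lemma flow_iter H K t n x : conjugate_pair H K -> iter n (flow H K t) x = flow H K (n%:R * t) x.
Proof.
move=> c; elim: n => [|n IH]; first by have [_ _ _ KH] := c; rewrite /flow mul0r hshift0 /= KH.
by rewrite iterS IH flowD// -natr1 mulrDl mul1r addrC.
Qed.

Lemma shear_conj (q : nat) (t : R) x :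
  shear q (sinwave q q%:R 0) (hshift t (shear q (sinwave q (- q%:R) 0) x)) =
  hshift t (shear q (sinwave q (2 * (q%:R * sin (pi * (q%:R * t)))) (pi * (q%:R * t) + pi / 2)) x).
Proof.
rewrite /hshift /shear /sinwave /=; set u := x.1 - _.
have -> : x.1 + q%:R * (- q%:R * sin (2 * pi * q%:R * u + 0)) + t -
  q%:R * (x.2 + - q%:R * sin (2 * pi * q%:R * u + 0) + 0) = u + t by rewrite /u; ring.
have -> : 2 * (q%:R * sin (pi * (q%:R * t))) * sin (2 * pi * q%:R * u + (pi * (q%:R * t) + pi / 2)) =
   q%:R * (sin (2 * pi * q%:R * (u + t)) - sin (2 * pi * q%:R * u)).
  rewrite addrA sinDpihalf sin_sub.
  rewrite (_ : (2 * pi * q%:R * (u + t) - 2 * pi * q%:R * u) / 2 = pi * (q%:R * t)); last by field.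
  rewrite (_ : (2 * pi * q%:R * (u + t) + 2 * pi * q%:R * u) / 2 = 2 * pi * q%:R * u + pi * (q%:R * t)); last by field.
  by ring.
rewrite !addr0; apply/pair_equal_spec; split => /=; ring.
Qed.

Lemma shear_cancel (q : nat) (l : R) : cancel (shear q (sinwave q l 0)) (shear q (sinwave q (- l) 0)).
Proof.
move=> x; rewrite /shear /sinwave /=; set u := x.1 - q%:R * x.2.
have -> : x.1 + q%:R * (l * sin (2 * pi * q%:R * u + 0)) -
  q%:R * (x.2 + l * sin (2 * pi * q%:R * u + 0)) = u by rewrite /u; ring.
by rewrite [RHS]surjective_pairing; congr pair; ring.
Qed.

Lemma conj_close H K n t : nice H -> nice K -> exists2 C : R, 0 <= C &
  forall Om (d : R), d <= 1 -> (forall i, CB n (dis i Om) d) ->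
  forall i, CB n (dis i (H \o hshift t \o Om \o K) \- dis i (flow H K t)) (C * d).
Proof.
move=> nH nK; have nHt : nice (H \o hshift t) by apply: nice_comp => //; exact: nice_hshift.
have [_ /(_ n.+1)[N hN] _] := nHt.
have [_ /(_ n)[G hG] _] := nK.
have [C1 C10 h1] := @CB_comp_diff R n N (CB_ge0 (hN true)).
have [C2 C20 h2] := @CB_comp R n G.
exists (C2 * (C1 + 1)); first by rewrite mulr_ge0// addr_ge0.
move=> Om d d1 hO i.
have a1 := h1 _ _ _ _ (hN i) d1 (hO false) (hO true).
have a2 := CBD a1 (hO i).
have a3 := h2 _ _ _ _ a2 (hG false) (hG true).
rewrite -mulrA mulrDl mul1r; apply: eq_CB a3 => x.
rewrite !disp_dis /flow /dis /=; ring.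
Qed.

End NiceMaps.

Section ConjugationStep.
Context {R : realType}.
Implicit Types (H K : R * R -> R * R) (F G : R * R -> R) (x y : R * R).

Definition twist (q : nat) (t : R) : R * R -> R * R :=
  shear q (sinwave q (2 * (q%:R * sin (pi * (q%:R * t)))) (pi * (q%:R * t) + pi / 2)).

Definition push H (q : nat) := H \o shear q (sinwave q q%:R 0).
Definition pull K (q : nat) := shear q (sinwave q (- q%:R) 0) \o K.

Lemma flow_push H K (q : nat) t : flow (push H q) (pull K q) t = H \o hshift t \o twist q t \o K.
Proof. by apply/funext => x; rewrite /flow /push /pull /= shear_conj. Qed.

Lemma conjugate_pair_push H K (q : nat) : (0 < q)%N -> conjugate_pair H K ->
  conjugate_pair (push H q) (pull K q).
Proof.
move=> q0 [nH nK HK KH]; split.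
- by apply: nice_comp => //; exact: nice_shear.
- by apply: nice_comp => //; exact: nice_shear.
- by move=> x; rewrite /push /pull /= HK shear_cancel.
- move=> x; rewrite /push /pull /=.
  have := @shear_cancel R q (- q%:R) (K x); rewrite opprK => ->; exact: KH.
Qed.

Lemma CB_twist n i (q : nat) t : (0 < q)%N ->
  CB n (dis i (twist q t)) (2 * 8 ^+ n * (q%:R ^+ (2 * n + 2) * `|sin (pi * (q%:R * t))|)).
Proof.
move=> q0; apply: CB_le (CB_shear _ _ _ _ q0).
rewrite !normrM (@ger0_norm _ 2)// (@ger0_norm _ q%:R)// exprMn -exprM exprD le_eqVlt; apply/orP; left; apply/eqP.
by rewrite expr2; ring.
Qed.

Lemma twist_dist (q : nat) t y : (0 < q)%N ->
  `|twist q t y - y| <= 2 * (q%:R ^+ 2 * `|sin (pi * (q%:R * t))|).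
Proof.
move=> q0; apply: norm_pj_le => i; rewrite pjB.
by have := CB_bound y (CB_twist 0 i t q0); rewrite expr0 mulr1 muln0 add0n.
Qed.

Lemma flow_push_dist H K (q : nat) (C t : R) x : (0 < q)%N -> 0 <= C ->
  (forall x y, `|H x - H y| <= C * `|x - y|) ->
  `|flow (push H q) (pull K q) t x - flow H K t x| <=
  C * (2 * (q%:R ^+ 2 * `|sin (pi * (q%:R * t))|)).
Proof.
move=> q0 C0 lH; rewrite flow_push /flow /=; apply: le_trans (lH _ _) _.
rewrite ler_wpM2l// /hshift opprD addrACA subrr addr0.
exact: twist_dist.
Qed.

Lemma push_mixing H K (C L e : R) : conjugate_pair H K -> 0 <= C ->
  (forall x y, `|H x - H y| <= C * `|x - y|) -> 0 <= L -> 0 < e ->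
  exists Q : nat, forall q t F G, (Q <= q)%N -> (0 < q)%N -> 2^-1 <= `|sin (pi * (q%:R * t))| ->
    testfun F -> testfun G -> lip2 F L -> lip2 G L ->
    `|tE (fun x => F (flow (push H q) (pull K q) t x) * G x) - tE F * tE G| <= e.
Proof.
move=> [nH nK HK KH] C0 lH L0 e0; have [Q hQ] := mixing_block (L * C) 1 e0.
exists Q => q t F G Qq q0 st tF tG lF lG.
have [pF _ _] := tF; have [pG _ _] := tG; have [eH _ pH] := nH.
have lFH : lip2 (F \o H) (L * C) := lip2_comp lF lH.
have lGH : lip2 (G \o H) (L * C) := lip2_comp lG lH.
have nf : nice (flow (push H q) (pull K q) t).
  by apply: nice_flow; apply: nice_comp => //; exact: nice_shear.
have [ef _ _] := nf.
have [L' lF'] := lip2_lipmap lF (nice_lipmap nf).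
have lP : lip2 (fun x => F (flow (push H q) (pull K q) t x) * G x) (L' * 1 + 1 * L).
  by apply: (lip2M lF' _ lG) => x; [exact: (testfun_norm _ tF)|exact: testfun_norm].
have pP : periodic2 (fun x => F (flow (push H q) (pull K q) t x) * G x).
  by move=> x k l; rewrite ef pF pG.
rewrite -(pH _ _ pP lP) -(pH _ _ pF lF) -(pH _ _ pG lG).
apply: le_trans (hQ q (2 * (q%:R * sin (pi * (q%:R * t)))) (pi * (q%:R * t) + pi / 2) t
  (F \o H) (G \o H) Qq _ (periodic2_comp pF eH) (periodic2_comp pG eH) lFH lGH _ _).
- rewrite le_eqVlt; apply/orP; left; apply/eqP; congr `|_ - _|; apply: eq_tE => x.
  by rewrite /= flow_push /= HK.
- rewrite normrM normrM (@ger0_norm _ 2)// (@ger0_norm _ q%:R)//.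
  have q0' : 0 <= q%:R :> R by rewrite ler0n.
  by move: st; set s := `|_|; nra.
- by move=> x; exact: (testfun_norm (H x) tF).
- by move=> x; exact: (testfun_norm (H x) tG).
Qed.

Variables (q : nat -> nat) (al : R) (p : nat -> nat).
Hypothesis q6 : forall n, (6 <= q n)%N.
Hypothesis q_growth : forall n, (q n ^ q n <= q n.+1)%N.
Hypothesis al_approx : forall n, 0 < (q n)%:R * al - (p n)%:R <= 2 * (q n)%:R / (q n.+1)%:R.

(* [m] is the mixing time of the stage, while [M] bounds those of the earlier
   stages, whose mixing has to survive. *)
Definition step_close (k M m : nat) H K H' K' := [/\
  forall i, CB k (dis i (flow H' K' al) \- dis i (flow H K al)) (2^-1 ^+ k),
  forall i, CB k (dis i (flow H' K' (- al)) \- dis i (flow H K (- al))) (2^-1 ^+ k),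
  forall n x, `|flow H' K' ((q n)%:R * al) x - flow H K ((q n)%:R * al) x| <= 2^-1 ^+ k,
  forall j x, (j <= M)%N -> `|flow H' K' (j%:R * al) x - flow H K (j%:R * al) x| <= 2^-1 ^+ k &
  forall F G, testfun F -> testfun G -> lip2 F k%:R -> lip2 G k%:R ->
    `|tE (fun x => F (flow H' K' (m%:R * al) x) * G x) - tE F * tE G| <= 2^-1 ^+ k].

Lemma conjugation_step (k M : nat) H K : conjugate_pair H K -> exists H' K' m,
  conjugate_pair H' K' /\ step_close k M m H K H' K'.
Proof.
move=> cHK; have [nH nK HK KH] := cHK.
have e0 : 0 < 2^-1 ^+ k :> R by rewrite exprn_gt0// invr_gt0.
have e1 : 2^-1 ^+ k <= 1 :> R by rewrite exprn_ile1 ?invr_ge0// invf_le1// ler1n.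
have [C C0 lH] := nice_lipmap nH.
have [C1 C10 h1] := conj_close k al nH nK.
have [C2 C20 h2] := conj_close k (- al) nH nK.
have [Q1 hQ1] := push_mixing cHK C0 lH (ler0n R k) e0.
pose D : R := C1 + C2 + C + 1.
have D0 : 0 < D by rewrite /D; lra.
have p8 : 0 < 8 ^+ k :> R by rewrite exprn_gt0.
have p81 : 1 <= 8 ^+ k :> R by rewrite exprn_ege1// ler1n.
have e20 : 0 < 2^-1 ^+ k / (2 * 8 ^+ k * D) by rewrite divr_gt0// !mulr_gt0.
have [Q2 hQ2] := @small_sine R q al p q6 q_growth al_approx (2 * k + 2) M.+1 _ e20.
pose N := maxn Q1 Q2.
have NN : (N <= q N)%N by exact: growth_ge.
have Q1N : (Q1 <= q N)%N by apply: leq_trans NN; rewrite leq_maxl.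
have Q2N : (Q2 <= q N)%N by apply: leq_trans NN; rewrite leq_maxr.
have {hQ2}[hj hn] := hQ2 _ Q2N.
have q0 : (0 < q N)%N by have := q6 N; lia.
have [m hm] := mixing_time q6 q_growth al_approx N.
exists (push H (q N)), (pull K (q N)), m; split; first exact: conjugate_pair_push.
have small t : (q N)%:R ^+ (2 * k + 2) * `|sin (pi * ((q N)%:R * t))| <= 2^-1 ^+ k / (2 * 8 ^+ k * D) ->
    2 * 8 ^+ k * ((q N)%:R ^+ (2 * k + 2) * `|sin (pi * ((q N)%:R * t))|) <= 2^-1 ^+ k / D.
  move=> h; apply: le_trans (ler_wpM2l _ h) _; first by rewrite mulr_ge0// ltW.
  rewrite le_eqVlt; apply/orP; left; apply/eqP; field.
  by rewrite !gt_eqF.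
have eD (c : R) : 0 <= c -> c <= D -> c * (2^-1 ^+ k / D) <= 2^-1 ^+ k.
  by move=> c0 cD; rewrite mulrCA ler_piMr ?(ltW e0)// ler_pdivrMr// mul1r.
have eD1 : 2^-1 ^+ k / D <= 1.
  by rewrite ler_pdivrMr// mul1r (le_trans e1)// /D; lra.
have dist t x : (q N)%:R ^+ (2 * k + 2) * `|sin (pi * ((q N)%:R * t))| <= 2^-1 ^+ k / (2 * 8 ^+ k * D) ->
    `|flow (push H (q N)) (pull K (q N)) t x - flow H K t x| <= 2^-1 ^+ k.
  move=> /small h; apply: le_trans (flow_push_dist K t x q0 C0 lH) _.
  apply: le_trans (eD C C0 _); last by rewrite /D; lra.
  apply: ler_wpM2l => //; apply: le_trans h; rewrite -mulrA ler_wpM2l//.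
  have q1 : 1 <= (q N)%:R :> R by rewrite ler1n.
  have q2 : (q N)%:R ^+ 2 <= (q N)%:R ^+ (2 * k + 2) :> R.
    by rewrite ler_weXn2l// leq_addl.
  apply: (@le_trans _ _ (1 * ((q N)%:R ^+ (2 * k + 2) * `|sin (pi * ((q N)%:R * t))|))).
    by rewrite mul1r ler_wpM2r.
  by rewrite ler_wpM2r// mulr_ge0// exprn_ge0// ler0n.
have ha := hj 1%N isT; rewrite mul1r in ha.
have hna : (q N)%:R ^+ (2 * k + 2) * `|sin (pi * ((q N)%:R * - al))| <= 2^-1 ^+ k / (2 * 8 ^+ k * D).
  by rewrite !mulrN sinN normrN.
split.
- move=> i; rewrite flow_push; apply: CB_le (eD C1 C10 _) _; first by rewrite /D; lra.
  by apply: h1 => // j; apply: CB_le (small _ ha) _; exact: CB_twist.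
- move=> i; rewrite flow_push; apply: CB_le (eD C2 C20 _) _; first by rewrite /D; lra.
  by apply: h2 => // j; apply: CB_le (small _ hna) _; exact: CB_twist.
- by move=> n x; exact: dist (hn n).
- by move=> j x jM; apply: dist; apply: hj; exact: leqW.
- by move=> F G tF tG lF lG; exact: hQ1.
Qed.

End ConjugationStep.

Section NiceLimits.
Context {R : realType}.
Implicit Types (f S : R * R -> R * R) (F G : R * R -> R) (x y : R * R) (i : bool).

Lemma equiv2P f : (forall i, periodic2 (dis i f)) <-> equiv2 f.
Proof.
split=> [h x k l|h i x k l]; last by rewrite /dis h; case: i => /=; ring.
have := h false x k l; have := h true x k l; rewrite /dis /= => h1 h2.
rewrite [LHS]surjective_pairing; congr pair.
  by lra.
by lra.
Qed.

Lemma half_pow_le0 (a C : R) : (forall k, a <= C * 2^-1 ^+ k) -> a <= 0.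
Proof.
move=> h; apply/ler_addgt0Pr => e e0; rewrite add0r.
by have [m hm] := half_pow_small C e0; apply: le_trans (h m) (ltW (hm _ _)).
Qed.

Lemma geom_telescope (V : normedZmodType R) (u : nat -> V) (k : nat) :
  (forall j, (k <= j)%N -> `|u j.+1 - u j| <= 2^-1 ^+ j) ->
  forall j, (k <= j)%N -> `|u j - u k| <= 2 * 2^-1 ^+ k.
Proof.
move=> h; suff H j : `|u (k + j)%N - u k| <= 2 * 2^-1 ^+ k - 2 * 2^-1 ^+ (k + j).
  move=> j kj; rewrite -(subnKC kj); apply: le_trans (H _) _.
  by rewrite gerBl mulr_ge0// exprn_ge0// invr_ge0.
elim: j => [|j IH]; first by rewrite addn0 !subrr normr0.
rewrite addnS -(subrKA (u (k + j)%N)) (le_trans (ler_normD _ _))//.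
have := h (k + j)%N (leq_addr _ _); rewrite exprS; move: IH.
by set A := `|_|; set B := `|_|; set w := _ ^+ (k + j); lra.
Qed.

Lemma CB_geometric n i (T : nat -> R * R -> R * R) : (forall k, nice (T k)) ->
  (forall k i, CB k (dis i (T k.+1) \- dis i (T k)) (2^-1 ^+ k)) ->
  exists M, forall j, CB n (dis i (T (n + j)%N)) M.
Proof.
move=> nT dT; have [_ /(_ n)[M hM] _] := nT n; exists (M + 2).
suff H j : CB n (dis i (T (n + j)%N)) (M + (2 - 2 * 2^-1 ^+ j)).
  move=> j; apply: CB_le (H j); rewrite lerD2l gerBl.
  by rewrite mulr_ge0// exprn_ge0// invr_ge0.
elim: j => [|j IH]; first by rewrite addn0 expr0 mulr1 subrr addr0.
have h := CB_leq (leq_addr j n) (dT (n + j)%N i).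
have p1 : 2^-1 ^+ (n + j) <= 2^-1 ^+ j :> R.
  by rewrite exprD ler_piMl ?exprn_ge0 ?invr_ge0// exprn_ile1 ?invr_ge0// invf_le1// ler1n.
rewrite addnS; apply: CB_le (eq_CB _ (CBD IH h)).
  by rewrite exprS; move: p1; set a := _ ^+ (n + j); set b := _ ^+ j; lra.
by move=> x /=; ring.
Qed.

Lemma nice_limit (T : nat -> R * R -> R * R) : (forall k, nice (T k)) ->
  (forall k i, CB k (dis i (T k.+1) \- dis i (T k)) (2^-1 ^+ k)) ->
  exists2 S, nice S & forall k x, `|S x - T k x| <= 2 * 2^-1 ^+ k.
Proof.
move=> nT dT.
have /choice[tau htau] (ix : bool * (R * R)) : exists l : R,
    (fun k => dis ix.1 (T k) ix.2) @ \oo --> l /\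
    forall k, `|l - dis ix.1 (T k) ix.2| <= 2 * 2^-1 ^+ k.
  have [|l h1 h2] := @geom_cauchy_cvg R (fun k => dis ix.1 (T k) ix.2) 1.
    by move=> k; rewrite mul1r; exact: (CB_bound ix.2 (dT k ix.1)).
  by exists l; split => // k; have := h2 k; rewrite mulr1.
pose S := disp (fun x => tau (false, x)) (fun x => tau (true, x)).
have dS i x : dis i S x = tau (i, x) by rewrite dis_disp; case: i.
have cS i x : (fun k => dis i (T k) x) @ \oo --> dis i S x.
  by rewrite dS; have [] := htau (i, x).
have ST k x : `|S x - T k x| <= 2 * 2^-1 ^+ k.
  apply: norm_pj_le => i; have [_ /(_ k)/=] := htau (i, x); rewrite -dS.
  by rewrite pjB /dis opprB addrA subrK.
have bS n : exists M, forall i, CB n (dis i S) M.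
  have H i : exists M, CB n (dis i S) M.
    have [M hM] := CB_geometric n.+2 i nT dT; exists M.
    apply: (@CB_limit R n (fun j => dis i (T (n.+2 + j)%N)) _ M 1) => //.
      move=> j; rewrite mul1r addnS; apply: CB_leq (CB_le _ (dT _ i)).
        by rewrite !addSn ltnS leqW// leq_addr.
      by rewrite exprD ler_piMl ?exprn_ge0 ?invr_ge0// exprn_ile1 ?invr_ge0// invf_le1// ler1n.
    move=> x; apply: (@cvg_comp _ _ _ (fun j => (n.+2 + j)%N) (fun k => dis i (T k) x)); last exact: cS.
    exact: cvg_addnl.
  have [M hM] := H false; have [N hN] := H true.
  exists (Num.max M N) => -[]; [apply: CB_le hN|apply: CB_le hM].
    by rewrite le_max lexx orbT.
  by rewrite le_max lexx.
have [M1 hM1] := bS 1%N; have lS := CB_lipmap hM1.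
exists S => //; split => //.
  apply/equiv2P => i x k l; have ek m j : periodic2 (dis j (T m)).
    by have [e _ _] := nT m; exact: (proj2 (equiv2P _) e).
  apply: (@cvg_unique _ (@Rhausdorff R) ((fun m => dis i (T m) x) @ \oo)); last exact: cS.
  apply: cvg_trans (cS i _); apply: near_eq_cvg; near=> m.
  by rewrite (ek m i x k l).
move=> F L pF lF; have [L' lF'] := lip2_lipmap lF lS.
apply/eqP; rewrite -subr_eq0 -normr_le0; apply: (@half_pow_le0 _ (L * 2)) => k.
have [_ _ pT] := nT k; rewrite -(pT _ _ pF lF).
have [L'' lF''] := lip2_lipmap lF (nice_lipmap (nT k)).
apply: (tE_dist lF' lF'') => x; apply: le_trans (lF _ _) _.
by rewrite -mulrA ler_wpM2l ?(lip2_ge0 lF).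
Unshelve. all: by end_near.
Qed.

Lemma iter_close (T : nat -> R * R -> R * R) S m : nice S ->
  (forall k x, `|S x - T k x| <= 2 * 2^-1 ^+ k) ->
  exists C : R, forall k x, `|iter m S x - iter m (T k) x| <= C * 2^-1 ^+ k.
Proof.
move=> nS ST; have [D D0 lS] := nice_lipmap nS.
elim: m => [|m [C IH]]; first by exists 0 => k x; rewrite subrr normr0 mul0r.
exists (D * C + 2) => k x; rewrite !iterS -(subrKA (S (iter m (T k) x))).
rewrite (le_trans (ler_normD _ _))// mulrDl lerD// -mulrA.
by apply: le_trans (lS _ _) _; rewrite ler_wpM2l.
Qed.

Lemma limit_cancel (T T' : nat -> R * R -> R * R) S S' : nice S' ->
  (forall k x, `|S x - T k x| <= 2 * 2^-1 ^+ k) ->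
  (forall k x, `|S' x - T' k x| <= 2 * 2^-1 ^+ k) ->
  (forall k, cancel (T k) (T' k)) -> cancel S S'.
Proof.
move=> nS' ST ST' TT' x; have [D D0 lS'] := nice_lipmap nS'.
apply/eqP; rewrite -subr_eq0 -normr_le0; apply: (@half_pow_le0 _ (D * 2 + 2)) => k.
rewrite -(subrKA (S' (T k x))) (le_trans (ler_normD _ _))// mulrDl lerD//.
  by apply: le_trans (lS' _ _) _; rewrite -mulrA ler_wpM2l.
by have := ST' k (T k x); rewrite TT'.
Qed.

End NiceLimits.

Section LimitDiffeo.
Context {R : realType}.
Variables (q : nat -> nat) (al : R) (p : nat -> nat).
Hypothesis q6 : forall n, (6 <= q n)%N.
Hypothesis q_growth : forall n, (q n ^ q n <= q n.+1)%N.
Hypothesis al_approx : forall n, 0 < (q n)%:R * al - (p n)%:R <= 2 * (q n)%:R / (q n.+1)%:R.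

Lemma conjugation_sequence : exists (H K : nat -> R * R -> R * R) (m M : nat -> nat),
  [/\ forall k, conjugate_pair (H k) (K k),
      forall k j, (k < j)%N -> (m k <= M j)%N &
      forall k, step_close q al k (M k) (m k) (H k) (K k) (H k.+1) (K k.+1)].
Proof.
pose stage := {s : ((R * R -> R * R) * (R * R -> R * R)) * nat | conjugate_pair s.1.1 s.1.2}.
have /choice[f hf] (x : nat * stage) : exists y : stage * nat,
    (sval y.1).2 = maxn (sval x.2).2 y.2 /\
    step_close q al x.1 (sval x.2).2 y.2 (sval x.2).1.1 (sval x.2).1.2 (sval y.1).1.1 (sval y.1).1.2.
  case: x => k [[[H K] M] /= cHK].
  have [H' [K' [m [c s]]]] := conjugation_step q6 q_growth al_approx k M cHK.
  by exists (exist _ ((H', K'), maxn M m) c, m).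
have c0 : conjugate_pair (id : R * R -> R * R) id by split=> //; exact: nice_id.
pose s0 : stage := exist _ ((id, id), 0%N) c0.
pose s := fix s n := if n is n'.+1 then (f (n', s n')).1 else s0.
exists (fun k => (sval (s k)).1.1), (fun k => (sval (s k)).1.2), (fun k => (f (k, s k)).2),
  (fun k => (sval (s k)).2); split.
- by move=> k; exact: svalP (s k).
- move=> k; elim=> [//|j IH]; rewrite ltnS leq_eqVlt => /orP[/eqP <-|kj].
    by have [-> _] := hf (k, s k); rewrite leq_maxr.
  by have [-> _] := hf (j, s j); rewrite (leq_trans (IH kj))// leq_maxl.
- by move=> k; have [_] := hf (k, s k).
Qed.

Lemma approx_tends0 (C e : R) : 0 < e -> exists N, forall n, (N <= n)%N ->
  C * ((q n)%:R * al - (p n)%:R) <= e.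
Proof.
move=> e0; exists (Num.bound (8 * `|C| / e)).+3 => n Nn.
have /andP[ep _] := al_approx n; have qn := growth_ge q6 q_growth n.
have q0 : 0 < (q n)%:R :> R by rewrite ltr0n; have := q6 n; lia.
have := @approx_gain R q al p q6 q_growth al_approx 0 n; rewrite expr1 => /(_ _).
rewrite (leq_trans _ qn) ?(leq_trans _ Nn)// => /(_ isT).
have q1 : 1 <= (q n)%:R :> R by rewrite ler1n; have := q6 n; lia.
set E := _ - _ in ep *; move=> h.
have h1 : E <= 8 / (q n)%:R.
  by apply: le_trans h; nra.
have h2 : `|C| * (8 / (q n)%:R) <= e.
  rewrite mulrA ler_pdivrMr// mulrC [e * _]mulrC -ler_pdivrMr//.
  have p0 : 0 <= 8 * `|C| / e by rewrite divr_ge0 ?mulr_ge0// ltW.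
  apply: le_trans (ltW (archi_boundP p0)) _; rewrite ler_nat.
  by move: Nn qn; lia.
apply: le_trans h2; apply: (@le_trans _ _ (`|C| * E)).
  by rewrite ler_wpM2r ?ler_norm// ltW.
by rewrite ler_wpM2l.
Qed.

Lemma rigid_mixing_lift : exists (S S' : R * R -> R * R) (m : nat -> nat),
  [/\ nice S /\ nice S', cancel S S', cancel S' S,
      (forall F G, testfun F -> testfun G ->
        (fun k => tE (fun x => F (iter (m k) S x) * G x)) @ \oo --> tE F * tE G) &
      forall e, 0 < e -> exists N, forall n x, (N <= n)%N ->
        `|iter (q n) S x - (x + ((p n)%:R, 0))| <= e].
Proof.
have [H [K [m [M [cHK mM st]]]]] := conjugation_sequence.
have nf k t : nice (flow (H k) (K k) t) by have [? ? _ _] := cHK k; exact: nice_flow.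
have [S nS ST] : exists2 S, nice S & forall k x, `|S x - flow (H k) (K k) al x| <= 2 * 2^-1 ^+ k.
  by apply: nice_limit => // k; have [] := st k.
have [S' nS' ST'] : exists2 S, nice S & forall k x, `|S x - flow (H k) (K k) (- al) x| <= 2 * 2^-1 ^+ k.
  by apply: nice_limit => // k; have [] := st k.
have fl0 k x : flow (H k) (K k) 0 x = x.
  by have [_ _ _ KH] := cHK k; rewrite /flow /= hshift0 KH.
have near_iter (n k : nat) x : (forall j, (k <= j)%N ->
    `|flow (H j.+1) (K j.+1) (n%:R * al) x - flow (H j) (K j) (n%:R * al) x| <= 2^-1 ^+ j) ->
    `|iter n S x - flow (H k) (K k) (n%:R * al) x| <= 2 * 2^-1 ^+ k.
  move=> /geom_telescope h; have [C hC] := iter_close n nS ST.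
  rewrite -subr_le0; apply: (@half_pow_le0 _ _ `|C|) => j.
  rewrite lerBlDr; apply: (@le_trans _ _ (`|C| * 2^-1 ^+ (j + k) + 2 * 2^-1 ^+ k)).
    rewrite -(subrKA (flow (H (j + k)) (K (j + k)) (n%:R * al) x)) (le_trans (ler_normD _ _))// lerD//.
      have := hC (j + k)%N x; rewrite flow_iter// => hh; apply: le_trans hh _.
      by rewrite ler_wpM2r ?ler_norm// exprn_ge0// invr_ge0.
    by apply: h; rewrite leq_addl.
  rewrite lerD2r ler_wpM2l// exprD ler_piMr ?exprn_ge0 ?invr_ge0//.
  by rewrite exprn_ile1 ?invr_ge0// invf_le1// ler1n.
exists S, S', m; split => //.
- apply: limit_cancel nS' ST ST' _ => k x.
  by rewrite flowD// addNr fl0.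
- apply: limit_cancel nS ST' ST _ => k x.
  by rewrite flowD// addrN fl0.
- move=> F G tF tG; have [pF [LF lF] _] := tF; have [pG [LG lG] _] := tG.
  apply/cvgrPdist_le => e e0; have [k0 hk0] := half_pow_small (LF * 2 + 1) e0.
  have LF0 := lip2_ge0 lF; have LG0 := lip2_ge0 lG.
  near=> k.
  have kF : LF <= k%:R.
    apply: (le_trans (ltW (archi_boundP LF0))); rewrite ler_nat; near: k; exact: nbhs_infty_ge.
  have kG : LG <= k%:R.
    apply: (le_trans (ltW (archi_boundP LG0))); rewrite ler_nat; near: k; exact: nbhs_infty_ge.
  have k0k : (k0 <= k)%N by near: k; exact: nbhs_infty_ge.
  have [_ _ _ _ hmix] := st k.
  have wk (W : R * R -> R) (L : R) : lip2 W L -> L <= k%:R -> lip2 W k%:R.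
    by move=> lW Lk x y; apply: le_trans (lW x y) _; rewrite ler_wpM2r.
  have h1 := hmix F G tF tG (wk _ _ lF kF) (wk _ _ lG kG).
  have h2 x : `|iter (m k) S x - flow (H k.+1) (K k.+1) ((m k)%:R * al) x| <= 2 * 2^-1 ^+ k.
    apply: le_trans (near_iter _ _ _ _) _.
      by move=> j kj; have [_ _ _ hj _] := st j; apply: hj; exact: mM.
    by rewrite exprS mulrA mulfV// mul1r ler_peMl ?ler1n// exprn_ge0// invr_ge0.
  have [L1 l1] := lip2_lipmap lF (lipmap_iter (m k) (nice_lipmap nS)).
  have [L2 l2] := lip2_lipmap lF (nice_lipmap (nf k.+1 ((m k)%:R * al))).
  have bF (f : R * R -> R * R) x : `|(F \o f) x| <= 1 by exact: (testfun_norm _ tF).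
  have bG x : `|G x| <= 1 by exact: (testfun_norm _ tG).
  have h3 : `|tE (fun x => F (iter (m k) S x) * G x) -
      tE (fun x => F (flow (H k.+1) (K k.+1) ((m k)%:R * al) x) * G x)| <= LF * (2 * 2^-1 ^+ k).
    apply: (tE_dist (lip2M l1 (bF _) lG bG) (lip2M l2 (bF _) lG bG)) => x /=.
    rewrite -mulrBl normrM; apply: (@le_trans _ _ (`|F (iter (m k) S x) - F (flow (H k.+1) (K k.+1) ((m k)%:R * al) x)|)).
      by rewrite ler_piMr.
    by apply: le_trans (lF _ _) _; rewrite ler_wpM2l.
  rewrite distrC -(subrKA (tE (fun x => F (flow (H k.+1) (K k.+1) ((m k)%:R * al) x) * G x))).
  rewrite (le_trans (ler_normD _ _))// (le_trans (lerD h3 h1))//.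
  by have /ltW := hk0 k k0k; rewrite mulrDl mul1r mulrA.
- move=> e e0; have e2 : 0 < e / 2 by rewrite divr_gt0.
  have [k /(_ k (leqnn k)) hk] := half_pow_small 2 e2.
  have [nH _ _ KH] := cHK k; have [C C0 lH] := nice_lipmap nH; have [eH _ _] := nH.
  have [N hN] := approx_tends0 C e2.
  exists N => n x Nn; rewrite -(subrKA (flow (H k) (K k) ((q n)%:R * al) x)).
  rewrite (le_trans (ler_normD _ _))// [leRHS]splitr lerD//.
    apply: le_trans (ltW hk); apply: near_iter => j _.
    by have [_ _ hj _ _] := st j; exact: hj.
  have -> : x + ((p n)%:R, 0) = H k (K k x + ((p n)%:R, 0)).
    have := eH (K k x) (p n) 0; rewrite addr0 KH -pmulrn.
    have -> : ((K k x).1 + (p n)%:R, (K k x).2) = K k x + ((p n)%:R, 0).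
      by apply/pair_equal_spec; rewrite /= addr0.
    by move=> ->; apply/pair_equal_spec; rewrite /= addr0.
  apply: le_trans (lH _ _) _; apply: le_trans (hN n Nn); rewrite ler_wpM2l//.
  rewrite /hshift opprD addrACA subrr add0r; apply: norm_pj_le => -[] /=.
    by rewrite subrr normr0; have /andP[/ltW] := al_approx n.
  by rewrite ger0_norm//; have /andP[/ltW] := al_approx n.
Unshelve. all: by end_near.
Qed.

End LimitDiffeo.

(** * The limit diffeomorphism *)

Section SmoothTorusMaps.
Context {R : realType}.
Implicit Types (f g : R * R -> R) (S : R * R -> R * R) (x y : R * R).

Fixpoint diffn (n : nat) f : Prop := (forall x, differentiable f x) /\
  if n is m.+1 then forall i, diffn m (pd i f) else True.

Lemma CB_diffn n f M : CB n f M -> diffn n f.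
Proof.
elim: n f M => [|n IH] f M h; split => //; first by move=> x; exact: CB_diff h.
  by move=> x; exact: CB_diff h.
by move=> i; apply: IH (CB_pd i h).
Qed.

Lemma diffnD n f g : diffn n f -> diffn n g -> diffn n (f \+ g).
Proof.
elim: n f g => [|n IH] f g [df hf] [dg hg]; split => //.
- by move=> x; exact: differentiableD.
- by move=> x; exact: differentiableD.
- by move=> i; rewrite pdDE//; apply: IH; [exact: hf|exact: hg].
Qed.

Lemma diffn_proj n : diffn n (fst : R * R -> R) /\ diffn n (snd : R * R -> R).
Proof.
case: n => [|n]; first by split; split=> // x; [exact: differentiable_fst|exact: differentiable_snd].
split.
  split=> [x|i]; first exact: differentiable_fst.
  apply: (@CB_diffn _ _ `|if i then 0 else 1|); apply: eq_CB (CB_cst n (if i then 0 else 1)) => x.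
  by rewrite pd_fst; case: i.
split=> [x|i]; first exact: differentiable_snd.
apply: (@CB_diffn _ _ `|if i then 1 else 0|); apply: eq_CB (CB_cst n (if i then 1 else 0)) => x.
by rewrite pd_snd; case: i.
Qed.

Lemma iterPartial_pair (s : seq bool) f g : (forall n, diffn n f) -> (forall n, diffn n g) ->
  exists f' g', [/\ forall n, diffn n f', forall n, diffn n g' &
    iterPartial s (fun x => (f x, g x)) = fun x => (f' x, g' x)].
Proof.
move=> hf hg; elim: s => [|i s [f' [g' [hf' hg' E]]]]; first by exists f, g.
exists (pd i f'), (pd i g'); split.
- by move=> n; have [_] := hf' n.+1; exact.
- by move=> n; have [_] := hg' n.+1; exact.
- apply/funext => x /=; rewrite E.
  have [df _] := hf' 0%N; have [dg _] := hg' 0%N.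
  rewrite deriveE; last exact: differentiable_pair.
  by rewrite diff_pair//= /pd !deriveE.
Qed.

Lemma nice_smoothOn S : nice S -> smoothOn setT S.
Proof.
move=> [_ bS _] s x _.
have hS i n : diffn n (fun y => pj i (S y)).
  have [M hM] := bS n.
  have -> : (fun y => pj i (S y)) = (if i then snd else fst) \+ dis i S.
    by apply/funext => y; case: i; rewrite /dis /=; ring.
  apply: diffnD; last exact: CB_diffn (hM i).
  by have [h1 h2] := diffn_proj n; case: i.
have [f [g [hf hg E]]] := iterPartial_pair s (hS false) (hS true).
have -> : S = fun y => (pj false (S y), pj true (S y)).
  by apply/funext => y; rewrite /= -surjective_pairing.
have [df _] := hf 0%N; have [dg _] := hg 0%N.
have d : differentiable (fun x => (f x, g x)) x by exact: differentiable_pair.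
rewrite E; split; first exact: differentiable_continuous.
by move=> i; exact: diff_derivable.
Qed.

Lemma nice_torusSmooth S : nice S -> torusSmooth (tmap S).
Proof.
move=> nS x; exists setT, S; split => //; [exact: openT|exact: nice_smoothOn|].
by move=> y _; rewrite tmap_pi//; have [] := nS.
Qed.

End SmoothTorusMaps.

Section TorusDistance.
Context {R : realType}.
Implicit Types (x y : R * R) (p r : torus R).

Lemma planeNorm_ge0 x : 0 <= planeNorm x.
Proof. exact: sqrtr_ge0. Qed.

Lemma planeNorm_le x : planeNorm x <= 2 * `|x|.
Proof.
have h : (planeNorm x) ^+ 2 <= (2 * `|x|) ^+ 2.
  rewrite /planeNorm sqr_sqrtr ?addr_ge0 ?sqr_ge0//.
  have h1 := normr_fst_le x; have h2 := normr_snd_le x.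
  have h3 := normr_ge0 x.1; have h4 := normr_ge0 x.2.
  rewrite -[x.1 ^+ 2]real_normK ?num_real// -[x.2 ^+ 2]real_normK ?num_real//.
  by rewrite !expr2; nra.
by rewrite -(@ler_pXn2r _ 2)// nnegrE ?planeNorm_ge0// mulr_ge0.
Qed.

Lemma torusDist_ge0 p r : 0 <= torusDist p r.
Proof.
apply: lb_le_inf; last by move=> _ [x [y [_ _ ->]]]; exact: planeNorm_ge0.
by exists (planeNorm (tcoord p - tcoord r)), (tcoord p), (tcoord r); rewrite !tcoordK.
Qed.

Lemma torusDist_le x y : torusDist (torusPi x) (torusPi y) <= 2 * `|x - y|.
Proof.
apply: le_trans (planeNorm_le _); apply: ge_inf; last by exists x, y.
by exists 0 => _ [u [v [_ _ ->]]]; exact: planeNorm_ge0.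
Qed.

Lemma sup_image_itv (T : pointedType) (u : T -> R) (e : R) :
  (forall t, 0 <= u t <= e) -> 0 <= sup [set u t | t in [set: T]] <= e.
Proof.
move=> h; have ub : ubound [set u t | t in [set: T]] e.
  by move=> _ [t _ <-]; have /andP[] := h t.
apply/andP; split; last by apply: ge_sup => //; exists (u point), point.
have /andP[h0 _] := h point; apply: le_trans h0 _.
by apply: ub_le_sup; [exists e|exists point].
Qed.

Lemma splitbij_inv_eq (T : Type) (f : {splitbij [set: T] >-> [set: T]}) (g : T -> T) :
  cancel g f -> (f^-1)%FUN = g.
Proof. by move=> gf; apply/funext => x; rewrite -{1}(gf x) funK ?inE. Qed.

Lemma uniformDist_iter_itv (T : torusBij R) n (e : R) :
  (forall p, torusDist (iter n T p) p <= e) -> (forall p, torusDist p (iter n T p) <= e) ->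
  0 <= uniformDist [splitbij of iter n T] [splitbij of idfun] <= e + e.
Proof.
move=> h1 h2; rewrite /uniformDist.
set s1 := sup _; set s2 := sup _.
have /andP[a1 a2] : 0 <= s1 <= e.
  by apply: (@sup_image_itv (torus R)) => p; rewrite torusDist_ge0 /= h1.
have /andP[b1 b2] : 0 <= s2 <= e.
  apply: (@sup_image_itv (torus R)) => p; rewrite torusDist_ge0 /=.
  have E : iter n T (([splitbij of iter n T]^-1)%FUN p) = p.
    exact: (@invK _ _ _ _ [splitbij of iter n T] p (mem_set I)).
  have E2 : ([the {splitbij [set: torus R] >-> [set: torus R]} of idfun]^-1)%FUN p = p by [].
  by rewrite E2 -{2}E h2.
by rewrite addr_ge0// lerD.
Qed.

End TorusDistance.

Theorem corollary1 (R : realType) (q : nat -> nat)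
  (q_gt0 : forall n, (0 < q n)%N)
  (q_first : 108 * pi <= (q 0%N)%:R :> R)
  (q_growth : forall n, (q n ^ q n <= q n.+1)%N) :
  exists T : torusBij R,
    [/\ torusDiffeo T, weakMixing T & uniformlyRigid T q].
Proof.
have q6 n : (6 <= q n)%N.
  elim: n => [|n IH]; last first.
    apply: leq_trans IH (leq_trans _ (q_growth n)).
    by rewrite -{1}[q n]expn1 leq_pexp2l.
  by rewrite -(ler_nat R); apply: le_trans q_first; have := @pi_ge2 R; lra.
have [al [p al_approx]] := liouville_number (R := R) q6 q_growth.
have [S [S' [m [[nS nS'] SS' S'S mix rig]]]] := rigid_mixing_lift q6 q_growth al_approx.
have [eS _ pS] := nS; have [eS' _ pS'] := nS'.
have [lS lS'] := (nice_lipmap nS, nice_lipmap nS').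
have TT' := tmap_cancel eS' SS'; have T'T := tmap_cancel eS S'S.
have [T ET] := PbijTT (Bijective TT' T'T).
have ET' : (T^-1)%FUN = tmap S' by apply: splitbij_inv_eq; rewrite -ET.
have wm : weakMixing T by rewrite -ET; exact: (torus_weak_mixing eS eS' lS lS' pS pS' SS' S'S mix).
exists T; split => //.
  by split; [rewrite -ET|rewrite ET']; exact: nice_torusSmooth.
have [mp _] := wm; split => //; first exact: growth_homo.
apply/cvgrPdist_le => e e0; have e4 : 0 < e / 4 by rewrite divr_gt0.
have [N hN] := rig _ e4; exists N => // n /= Nn; rewrite sub0r normrN.
have E r : iter (q n) T r = torusPi (iter (q n) S (tcoord r)) by rewrite -ET iter_tmap.
have E2 r : r = torusPi (tcoord r + ((p n)%:R, 0)).
  rewrite -[LHS]tcoordK; apply/torusPiP; exists (- (p n)%:Z), 0.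
  by rewrite [LHS]surjective_pairing; congr pair; rewrite /= ?mulrNz -?pmulrn; ring.
have h1 r : torusDist (iter (q n) T r) r <= e / 2.
  rewrite E {2}[r]E2; apply: le_trans (torusDist_le _ _) _.
  by have := hN n (tcoord r) Nn; lra.
have h2 r : torusDist r (iter (q n) T r) <= e / 2.
  rewrite E {1}[r]E2; apply: le_trans (torusDist_le _ _) _.
  by rewrite distrC; have := hN n (tcoord r) Nn; lra.
have /andP[u0 u1] := uniformDist_iter_itv h1 h2.
by rewrite ger0_norm// (le_trans u1)// -splitr.
Qed.
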